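(* Let $\mathfrak{g}_1,\mathfrak{g}_2$ be dg Lie algebras. Every $L_\infty$ quasi-isomorphism $\mathcal{F}\colon\mathfrak{g}_1\to\mathfrak{g}_2$ is invertible in the category $\mathcal{H}om_{dg}$; that is, there is an $L_\infty$ morphism $\mathcal{G}\colon\mathfrak{g}_2\to\mathfrak{g}_1$ such that $\mathcal{G}\circ\mathcal{F}$ is homotopic to $\mathrm{Id}_{\mathfrak{g}_1}$ and $\mathcal{F}\circ\mathcal{G}$ is homotopic to $\mathrm{Id}_{\mathfrak{g}_2}$.
   Context: Ground field $\mathbb{C}$; dg Lie algebras are $\mathbb{Z}$-graded (unbounded) with differential of degree $+1$; $V[n]^k=V^{n+k}$. For a dg Lie algebra $\mathfrak{g}$, $C(\mathfrak{g},\mathbb{C})=S(\mathfrak{g}[1])$ is its chain complex, a counital cocommutative dg coalgebra whose differential is built from the differential and the bracket of $\mathfrak{g}$; $C_+(\mathfrak{g},\mathbb{C})=\bigoplus_{n\ge1}S^n(\mathfrak{g}[1])$ is the kernel of the counit, with its (reduced) coproduct $\Delta$. An $L_\infty$ morphism $\mathfrak{g}_1\to\mathfrak{g}_2$ is a morphism of dg coalgebras $C_+(\mathfrak{g}_1,\mathbb{C})\to C_+(\mathfrak{g}_2,\mathbb{C})$; composition is composition of coalgebra maps. It is determined by its Taylor components $F_n\colon\Lambda^n(\mathfrak{g}_1)\to\mathfrak{g}_2[1-n]$, $n\ge1$; $F_1$ is a map of complexes, and the morphism is an $L_\infty$ quasi-isomorphism if $F_1$ induces an isomorphism on cohomology.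 The dg Lie algebra $\Bbbk(\mathfrak{g}_1,\mathfrak{g}_2)=\mathrm{Hom}_{\mathbb{C}}(C_+(\mathfrak{g}_1,\mathbb{C}),\mathfrak{g}_2)$ has the differential $d_{\Bbbk}$ induced by the differentials of $C_+(\mathfrak{g}_1,\mathbb{C})$ and $\mathfrak{g}_2$, and bracket $[\theta_1,\theta_2]$ given (with Koszul signs) by the composition $C_+(\mathfrak{g}_1,\mathbb{C})\xrightarrow{\Delta}C_+(\mathfrak{g}_1,\mathbb{C})^{\otimes2}\xrightarrow{\theta_1\otimes\theta_2}\mathfrak{g}_2\otimes\mathfrak{g}_2\xrightarrow{[\,,]}\mathfrak{g}_2$. The solutions $F\in\Bbbk(\mathfrak{g}_1,\mathfrak{g}_2)^1$ of the Maurer–Cartan equation $d_{\Bbbk}F+\frac12[F,F]=0$ correspond bijectively, via Taylor components, to the $L_\infty$ morphisms $\mathfrak{g}_1\to\mathfrak{g}_2$. For $H\in\Bbbk(\mathfrak{g}_1,\mathfrak{g}_2)^0$ and a Maurer–Cartan solution $F$, let $F_H=F(1)$, where $F(t)$ is the solution of $\frac{dF(t)}{dt}=-d_{\Bbbk}H+[H,F(t)]$, $F(0)=F$ (the flow exists since $\Bbbk(\mathfrak{g}_1,\mathfrak{g}_2)$ is pro-nilpotent with respect to the filtration by the arity $n$); formally $F_H+d_{\Bbbk}=\exp(\mathrm{ad}(H))(F+d_{\Bbbk})$, and $F_H$ is again a Maurer–Cartan solution. Two $L_\infty$ morphisms $F_1,F_2\colon\mathfrak{g}_1\to\mathfrak{g}_2$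 are homotopic if $F_2=(F_1)_H$ for some $H\in\Bbbk(\mathfrak{g}_1,\mathfrak{g}_2)^0$; this is an equivalence relation compatible with composition. The category $\mathcal{H}om_{dg}$ has dg Lie algebras as objects and $L_\infty$ morphisms modulo homotopy as morphisms. *)

(* Defs.v *)
From HB Require Import structures.
From mathcomp Require Import all_boot all_order all_algebra.
From mathcomp Require Import boolp reals complex.

Set Implicit Arguments.
Unset Strict Implicit.
Unset Printing Implicit Defensive.

Import GRing.Theory.
Local Open Scope ring_scope.

Inductive lcomb (K T : Type) : Type :=
| LGen of T
| LZero
| LAdd of lcomb K T & lcomb K T
| LScale of K & lcomb K T.
Arguments LGen {K T}.
Arguments LZero {K T}.

HB.instance Definition _ (K T : Type) := gen_eqMixin (lcomb K T).
HB.instance Definition _ (K T : Type) := gen_choiceMixin (lcomb K T).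

Section Presented.
Variables (K : fieldType) (T : Type) (rel : lcomb K T -> lcomb K T -> Prop).

Inductive lcong : lcomb K T -> lcomb K T -> Prop :=
| lc_rel a b : rel a b -> lcong a b
| lc_refl a : lcong a a
| lc_sym a b : lcong a b -> lcong b a
| lc_trans a b c : lcong a b -> lcong b c -> lcong a c
| lc_add a a' b b' : lcong a a' -> lcong b b' -> lcong (LAdd a b) (LAdd a' b')
| lc_scale k a a' : lcong a a' -> lcong (LScale k a) (LScale k a')
| lc_addA a b c : lcong (LAdd a (LAdd b c)) (LAdd (LAdd a b) c)
| lc_addC a b : lcong (LAdd a b) (LAdd b a)
| lc_add0 a : lcong (LAdd LZero a) a
| lc_addN a : lcong (LAdd (LScale (-1) a) a) LZero
| lc_scaleA k l a : lcong (LScale k (LScale l a)) (LScale (k * l) a)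
| lc_scale1 a : lcong (LScale 1 a) a
| lc_scaleDr k a b :
    lcong (LScale k (LAdd a b)) (LAdd (LScale k a) (LScale k b))
| lc_scaleDl k l a :
    lcong (LScale (k + l) a) (LAdd (LScale k a) (LScale l a)).

Definition lcongb a b := `[< lcong a b >].

Lemma lcongb_equiv : equiv_class_of lcongb.
Proof.
split=> [a|a b|b a c].
- by apply/asboolP; apply: lc_refl.
- by apply/asboolP/asboolP; apply: lc_sym.
- by move=> /asboolP h1 /asboolP h2; apply/asboolP; apply: lc_trans h1 h2.
Qed.
Canonical lcongb_equivRel := EquivRelPack lcongb_equiv.

Definition pres : Type := {eq_quot lcongb}%qT.
HB.instance Definition _ := Choice.on pres.

Definition pclass (a : lcomb K T) : pres := (\pi_({eq_quot lcongb}) a)%qT.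
Definition prepr (x : pres) : lcomb K T := repr (x : {eq_quot lcongb}%qT).

Lemma preprK x : pclass (prepr x) = x.
Proof. exact: reprK. Qed.

Lemma pclassP a b : pclass a = pclass b <-> lcong a b.
Proof.
split=> [/eqP|h]; last by apply/eqP; rewrite eqmodE; apply/asboolP.
by rewrite eqmodE => /asboolP.
Qed.

Lemma prepr_class a : lcong (prepr (pclass a)) a.
Proof. by apply/pclassP; rewrite preprK. Qed.

Definition padd (x y : pres) := pclass (LAdd (prepr x) (prepr y)).
Definition pscale k (x : pres) := pclass (LScale k (prepr x)).
Definition popp (x : pres) := pscale (-1) x.
Definition pzero := pclass LZero.

Lemma pclassD a b : pclass (LAdd a b) = padd (pclass a) (pclass b).
Proof. by apply/pclassP/lc_sym/lc_add; apply: prepr_class. Qed.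
Lemma pclassZ k a : pclass (LScale k a) = pscale k (pclass a).
Proof. by apply/pclassP/lc_sym/lc_scale; apply: prepr_class. Qed.

Lemma paddA : associative padd.
Proof.
move=> x y z; rewrite -(preprK x) -(preprK y) -(preprK z) -!pclassD.
exact/pclassP/lc_addA.
Qed.
Lemma paddC : commutative padd.
Proof. by move=> x y; apply/pclassP/lc_addC. Qed.
Lemma padd0 : left_id pzero padd.
Proof. by move=> x; rewrite -(preprK x) -pclassD; apply/pclassP/lc_add0. Qed.
Lemma paddN : left_inverse pzero popp padd.
Proof.
by move=> x; rewrite -(preprK x) /popp -pclassZ -pclassD; apply/pclassP/lc_addN.
Qed.
HB.instance Definition _ := GRing.isZmodule.Build pres paddA paddC padd0 paddN.

Lemma pscaleA k l x : pscale k (pscale l x) = pscale (k * l) x.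
Proof. by rewrite -(preprK x) -!pclassZ; apply/pclassP/lc_scaleA. Qed.
Lemma pscale1 : left_id 1 pscale.
Proof. by move=> x; rewrite -(preprK x) -pclassZ; apply/pclassP/lc_scale1. Qed.
Lemma pscaleDr : right_distributive pscale padd.
Proof.
move=> k x y; rewrite -(preprK x) -(preprK y).
rewrite -(pclassD (prepr x)) -(pclassZ k (LAdd _ _)) -(pclassZ k (prepr x)).
rewrite -(pclassZ k (prepr y)) -(pclassD (LScale k _)).
exact/pclassP/lc_scaleDr.
Qed.
Lemma pscaleDl x : {morph pscale^~ x : k l / k + l >-> padd k l}.
Proof.
move=> k l; rewrite -(preprK x) -(pclassZ (k + l)) -(pclassZ k) -(pclassZ l).
rewrite -(pclassD (LScale k _)).
exact/pclassP/lc_scaleDl.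
Qed.
HB.instance Definition _ :=
  GRing.Zmodule_isLmodule.Build K pres pscaleA pscale1 pscaleDr pscaleDl.

Definition pgen (t : T) : pres := pclass (LGen t).

Fixpoint lc_eval (U : lmodType K) (f : T -> U) (a : lcomb K T) : U :=
  match a with
  | LGen t => f t
  | LZero => 0
  | LAdd a b => lc_eval f a + lc_eval f b
  | LScale k a => k *: lc_eval f a
  end.

Definition lc_compat (U : lmodType K) (f : T -> U) :=
  forall a b, rel a b -> lc_eval f a = lc_eval f b.

Lemma lc_eval_cong (U : lmodType K) (f : T -> U) : lc_compat f ->
  forall a b, lcong a b -> lc_eval f a = lc_eval f b.
Proof.
move=> fP a b; elim=> //=.
- by move=> a' b' c _ -> _ ->.
- by move=> a1 a2 b1 b2 _ -> _ ->.
- by move=> k a1 a2 _ ->.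
- by move=> *; rewrite addrA.
- by move=> *; rewrite addrC.
- by move=> *; rewrite add0r.
- by move=> *; rewrite scaleN1r addNr.
- by move=> *; rewrite scalerA.
- by move=> *; rewrite scale1r.
- by move=> *; rewrite scalerDr.
- by move=> *; rewrite scalerDl.
Qed.

Lemma pclass_eval a : pclass a = lc_eval pgen a.
Proof.
by elim: a => [t||a IHa b IHb|k a IHa] //=;
  rewrite ?pclassD ?pclassZ ?IHa ?IHb.
Qed.

Lemma pgen_compat : lc_compat pgen.
Proof. by move=> a b ab; rewrite -!pclass_eval; apply/pclassP/lc_rel. Qed.

Lemma pres_ind (P : pres -> Prop) :
    P 0 -> (forall x y, P x -> P y -> P (x + y)) ->
    (forall k x, P x -> P (k *: x)) -> (forall t, P (pgen t)) ->
  forall x, P x.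
Proof.
move=> P0 PD PZ Pg x; rewrite -(preprK x) pclass_eval.
by elim: (prepr x) => [t||a IHa b IHb|k a IHa] //=; [apply: PD | apply: PZ].
Qed.

Section Lift.
Variables (U : lmodType K) (f : T -> U) (fP : lc_compat f).

Definition pres_lift_fun of lc_compat f := fun x : pres => lc_eval f (prepr x).

Lemma pres_lift_class a : pres_lift_fun fP (pclass a) = lc_eval f a.
Proof. by apply: lc_eval_cong => //; apply: prepr_class. Qed.

Lemma pres_lift_linear : linear (pres_lift_fun fP).
Proof.
move=> k x y; rewrite -(preprK x) -(preprK y).
have -> : k *: pclass (prepr x) + pclass (prepr y) =
          pclass (LAdd (LScale k (prepr x)) (prepr y)).
  by rewrite pclassD pclassZ.
by rewrite !pres_lift_class.
Qed.
HB.instance Definition _ :=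
  GRing.isLinear.Build K pres U _ (pres_lift_fun fP) pres_lift_linear.

Definition pres_lift : {linear pres -> U} := pres_lift_fun fP.

Lemma pres_liftE t : pres_lift (pgen t) = f t.
Proof. exact: pres_lift_class. Qed.
End Lift.

Lemma pres_linear_ext (U : lmodType K) (f g : {linear pres -> U}) :
  (forall t, f (pgen t) = g (pgen t)) -> f =1 g.
Proof.
move=> fg; apply: pres_ind => [|x y fx fy|k x fx|//].
- by rewrite !linear0.
- by rewrite !linearD fx fy.
- by rewrite !linearZ /= fx.
Qed.

End Presented.

Section Tensor.
Variables (K : fieldType) (V W : lmodType K).

Inductive tens_rel : lcomb K (V * W) -> lcomb K (V * W) -> Prop :=
| tens_linl k x y w : tens_rel (LGen (k *: x + y, w))
                               (LAdd (LScale k (LGen (x, w))) (LGen (y, w)))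
| tens_linr k v x y : tens_rel (LGen (v, k *: x + y))
                               (LAdd (LScale k (LGen (v, x))) (LGen (v, y))).

Definition tens : lmodType K := pres tens_rel.
Definition tprod (v : V) (w : W) : tens := pgen tens_rel (v, w).

Definition bilin (U : lmodType K) (b : V -> W -> U) :=
  (forall w, linear (b^~ w)) /\ (forall v, linear (b v)).

Section BilinTheory.
Variables (U : lmodType K) (b : V -> W -> U).
Hypothesis bP : bilin b.

Lemma bilin0l w : b 0 w = 0.
Proof.
by have := bP.1 w (-1) 0 0; rewrite /= scaler0 addr0 scaleN1r addNr.
Qed.
Lemma bilin0r v : b v 0 = 0.
Proof.
by have := bP.2 v (-1) 0 0; rewrite /= scaler0 addr0 scaleN1r addNr.
Qed.
Lemma bilinZl k v w : b (k *: v) w = k *: b v w.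
Proof. by have := bP.1 w k v 0; rewrite /= bilin0l !addr0. Qed.
Lemma bilinZr k v w : b v (k *: w) = k *: b v w.
Proof. by have := bP.2 v k w 0; rewrite /= bilin0r !addr0. Qed.
End BilinTheory.

Lemma bilin_compat (U : lmodType K) (b : V -> W -> U) (bP : bilin b) :
  lc_compat tens_rel (fun p => b p.1 p.2).
Proof. by case: bP => bl br _ _ []* /=; rewrite ?bl ?br. Qed.

Definition tens_lift (U : lmodType K) (b : V -> W -> U) (bP : bilin b) :
  {linear tens -> U} := pres_lift (bilin_compat bP).

Lemma tens_liftE (U : lmodType K) (b : V -> W -> U) (bP : bilin b) v w :
  tens_lift bP (tprod v w) = b v w.
Proof. exact: pres_liftE. Qed.

Lemma tprod_bilin : bilin tprod.
Proof.
split=> [w k x y|v k x y].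
- exact: (pgen_compat (tens_linl k x y w)).
- exact: (pgen_compat (tens_linr k v x y)).
Qed.

End Tensor.

Section TensorMap.
Variable K : fieldType.

Lemma tens_map_bilin (V W V' W' : lmodType K)
  (f : {linear V -> V'}) (g : {linear W -> W'}) :
  bilin (fun v w => tprod (f v) (g w)).
Proof.
have [hl hr] := tprod_bilin V' W'.
by split=> [w k x y|v k x y]; rewrite linearP ?hl ?hr.
Qed.

Definition tens_map (V W V' W' : lmodType K)
    (f : {linear V -> V'}) (g : {linear W -> W'}) :
  {linear tens V W -> tens V' W'} := tens_lift (tens_map_bilin f g).

Lemma tens_mapE (V W V' W' : lmodType K)
    (f : {linear V -> V'}) (g : {linear W -> W'}) v w :
  tens_map f g (tprod v w) = tprod (f v) (g w).
Proof. exact: tens_liftE. Qed.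

Lemma tens_ext (V W U : lmodType K) (f g : {linear tens V W -> U}) :
  (forall v w, f (tprod v w) = g (tprod v w)) -> f =1 g.
Proof. by move=> fg; apply: pres_linear_ext => -[v w]; apply: fg. Qed.
End TensorMap.

(* A graded space is the total space of its homogeneous components, with the
   projections [gproj k] onto the component of degree [k]. *)
Record gradedSpace (K : fieldType) := GradedSpace {
  gspace :> lmodType K;
  gproj : int -> {linear gspace -> gspace};
  gprojM : forall i j x, gproj i (gproj j x) = if i == j then gproj j x else 0;
  gproj_sum : forall x, exists2 s : seq int,
    uniq s & x = \sum_(k <- s) gproj k x
}.

Definition homog (K : fieldType) (V : gradedSpace K) (k : int) (x : V) : bool :=
  gproj V k x == x.

Definition has_degree (K : fieldType) (V W : gradedSpace K) (p : int)
  (f : V -> W) := forall k x, homog k x -> homog (k + p) (f x).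

Section Shift.
Variables (K : fieldType) (V : gradedSpace K) (n : int).

Lemma shift_projM i j (x : V) :
  gproj V (n + i) (gproj V (n + j) x) = if i == j then gproj V (n + j) x else 0.
Proof. by rewrite gprojM (inj_eq (addrI n)). Qed.

Lemma shift_proj_sum (x : V) : exists2 s : seq int,
  uniq s & x = \sum_(k <- s) gproj V (n + k) x.
Proof.
have [s us xE] := gproj_sum x.
exists [seq k - n | k <- s]; first by rewrite map_inj_uniq //; apply: addIr.
by rewrite big_map {1}xE; apply: eq_bigr => k _; rewrite addrCA subrr addr0.
Qed.

Definition shift : gradedSpace K :=
  @GradedSpace K V (fun k => gproj V (n + k)) shift_projM shift_proj_sum.
End Shift.

Record dgLie (K : fieldType) := DgLie {
  dgl_space :> gradedSpace K;
  dgl_d : {linear dgl_space -> dgl_space};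
  dgl_br : dgl_space -> dgl_space -> dgl_space;
  dgl_br_bilin : bilin dgl_br;
  dgl_d_degree : has_degree 1 dgl_d;
  dgl_br_degree : forall i j (x y : dgl_space),
    homog i x -> homog j y -> homog (i + j) (dgl_br x y);
  dgl_dd : forall x, dgl_d (dgl_d x) = 0;
  dgl_antisym : forall i j (x y : dgl_space), homog i x -> homog j y ->
    dgl_br x y = - ((-1) ^ (i * j) *: dgl_br y x);
  dgl_jacobi : forall i j k (x y z : dgl_space),
    homog i x -> homog j y -> homog k z ->
    dgl_br x (dgl_br y z) =
      dgl_br (dgl_br x y) z + (-1) ^ (i * j) *: dgl_br y (dgl_br x z);
  dgl_leibniz : forall i (x y : dgl_space), homog i x ->
    dgl_d (dgl_br x y) = dgl_br (dgl_d x) y + (-1) ^ i *: dgl_br x (dgl_d y)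
}.

Section Letters.
Variables (K : fieldType) (V : gradedSpace K).

Record letter := Letter {
  ldeg : int;
  lval : V;
  lhomog : homog ldeg lval
}.

Definition word := seq letter.
Definition wdeg (w : word) : int := \sum_(x <- w) ldeg x.

Lemma gproj_homog k (x : V) : homog k (gproj V k x).
Proof. by rewrite /homog gprojM eqxx. Qed.

Definition component k (x : V) : letter := Letter (gproj_homog k x).
End Letters.

Section Signs.
Variable K : fieldType.
Lemma sgzD i j : (-1 : K) ^ (i + j) = (-1) ^ i * (-1) ^ j.
Proof. by rewrite expfzDr // oppr_eq0 oner_eq0. Qed.
Lemma sgzz i : (-1 : K) ^ i * (-1) ^ i = 1.
Proof. by rewrite -expfzMl mulrNN mulr1 exp1rz. Qed.
Lemma sgz_pm i : (-1 : K) ^ i = 1 \/ (-1 : K) ^ i = -1.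
Proof.
have := sgzz i; rewrite -expr2 => /eqP; rewrite sqrf_eq1.
by move=> /orP[] /eqP; [left | right].
Qed.
End Signs.

Ltac sgz_cases K :=
  rewrite ?(mulrDl, mulrDr, mul1r, mulr1, sgzD, expr1z);
  repeat match goal with
    |- context [?e ^ (?i * ?j)] => match goal with
      |- context [e ^ (j * i)] =>
        tryif constr_eq i j then fail else rewrite (mulrC j i) end end;
  repeat match goal with |- context [_ ^ ?i] =>
    case: (sgz_pm K i) => -> end;
  by rewrite ?(mulr1, mul1r, mulrN1, mulN1r, opprK).

Section Symmetric.
Variables (K : fieldType) (V : gradedSpace K).
Local Notation letter := (letter V).
Local Notation word := (word V).

(* The word [[:: x1; ...; xn]] stands for the product x1 ... xn in S^n(V).
   The empty word is sent to 0, so that the presented space is the direct sum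
   of the S^n(V) for n >= 1. *)
Inductive sym_rel : lcomb K word -> lcomb K word -> Prop :=
| sym_nil : sym_rel (LGen [::]) LZero
| sym_lin u v (x y z : letter) k :
    ldeg y = ldeg x -> ldeg z = ldeg x -> lval z = k *: lval x + lval y ->
    sym_rel (LGen (u ++ z :: v))
            (LAdd (LScale k (LGen (u ++ x :: v))) (LGen (u ++ y :: v)))
| sym_swap u v (x y : letter) :
    sym_rel (LGen (u ++ [:: x, y & v]))
            (LScale ((-1) ^ (ldeg x * ldeg y)) (LGen (u ++ [:: y, x & v]))).

Definition Sp : lmodType K := pres sym_rel.
Definition Sword (w : word) : Sp := pgen sym_rel w.

Definition multilin (U : lmodType K) (f : word -> U) :=
  forall u v (x y z : letter) k,
    ldeg y = ldeg x -> ldeg z = ldeg x -> lval z = k *: lval x + lval y ->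
    f (u ++ z :: v) = k *: f (u ++ x :: v) + f (u ++ y :: v).

Definition gsym (U : lmodType K) (f : word -> U) :=
  forall u v (x y : letter),
    f (u ++ [:: x, y & v]) = (-1) ^ (ldeg x * ldeg y) *: f (u ++ [:: y, x & v]).

Definition multisym (U : lmodType K) (f : word -> U) := multilin f /\ gsym f.

Section Lift.
Variables (U : lmodType K) (f : word -> U).
Hypotheses (f0 : f [::] = 0) (fP : multisym f).

Lemma multisym_compat : lc_compat sym_rel f.
Proof.
by case: fP => fl fs _ _ [|u v x y z k xy xz zE|u v x y] /=; rewrite ?f0; auto.
Qed.

Definition Slift : {linear Sp -> U} := pres_lift multisym_compat.
Lemma SliftE w : Slift (Sword w) = f w. Proof. exact: pres_liftE. Qed.
End Lift.

Lemma Sword_nil : Sword [::] = 0.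
Proof. exact: (pgen_compat sym_nil). Qed.

Lemma Sword_multisym : multisym Sword.
Proof.
split=> [u v x y z k xy xz zE|u v x y].
- exact: (pgen_compat (sym_lin u v xy xz zE)).
- exact: (pgen_compat (sym_swap u v x y)).
Qed.

Lemma Sp_ind (P : Sp -> Prop) :
    P 0 -> (forall x y, P x -> P y -> P (x + y)) ->
    (forall k x, P x -> P (k *: x)) -> (forall w, P (Sword w)) ->
  forall x, P x.
Proof. exact: pres_ind. Qed.

Lemma Sp_ext (U : lmodType K) (f g : {linear Sp -> U}) :
  (forall w, f (Sword w) = g (Sword w)) -> f =1 g.
Proof. exact: pres_linear_ext. Qed.

Lemma wdeg_cons x w : wdeg (x :: w : word) = ldeg x + wdeg w.
Proof. by rewrite /wdeg big_cons. Qed.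

Lemma wdeg_cat u w : wdeg (u ++ w : word) = wdeg u + wdeg w.
Proof. by rewrite /wdeg big_cat. Qed.

Section MultisymTheory.
Variable U : lmodType K.
Implicit Types f g : word -> U.

Lemma multisym_add f g :
  multisym f -> multisym g -> multisym (fun w => f w + g w).
Proof.
move=> [fl fs] [gl gs]; split=> [u v x y z k xy xz zE|u v x y].
- by rewrite (fl _ _ _ _ _ _ xy xz zE) (gl _ _ _ _ _ _ xy xz zE) scalerDr addrACA.
- by rewrite fs gs scalerDr.
Qed.

Lemma multisym_weight (c : int -> K) f :
  multisym f -> multisym (fun w => c (wdeg w) *: f w).
Proof.
move=> [fl fs]; split=> [u v x y z k xy xz zE|u v x y].
- rewrite (fl _ _ _ _ _ _ xy xz zE) !wdeg_cat !wdeg_cons xy xz.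
  by rewrite scalerDr !scalerA mulrC.
- rewrite fs !wdeg_cat !wdeg_cons !scalerA mulrC.
  by rewrite (addrCA (ldeg x)).
Qed.

Lemma multisym_scale (c : K) f :
  multisym f -> multisym (fun w => c *: f w).
Proof. exact: (multisym_weight (fun=> c)). Qed.

Lemma multisym_cons x f : multisym f -> multisym (fun w => f (x :: w)).
Proof.
move=> [fl fs]; split=> [u v y z t k yz yt tE|u v y z].
- exact: (fl (x :: u)).
- exact: (fs (x :: u)).
Qed.

Lemma multisym_eq f g : f =1 g -> multisym f -> multisym g.
Proof. by move=> /funext ->. Qed.

End MultisymTheory.

Lemma Sp_proj_nil k :
  (if wdeg ([::] : word) == k then Sword [::] else 0) = 0.
Proof. by rewrite Sword_nil if_same. Qed.

Lemma Sp_proj_multisym k :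
  multisym (fun w => if wdeg w == k then Sword w else 0).
Proof.
apply: (@multisym_eq _ (fun w => ((wdeg w == k)%:R : K) *: Sword w)).
  by move=> w /=; case: eqP; rewrite ?scale1r ?scale0r.
exact: (multisym_weight (fun i => (i == k)%:R)) Sword_multisym.
Qed.

Definition Sp_proj k : {linear Sp -> Sp} :=
  Slift (Sp_proj_nil k) (Sp_proj_multisym k).

Lemma Sp_projE k w : Sp_proj k (Sword w) = if wdeg w == k then Sword w else 0.
Proof. exact: SliftE. Qed.

Lemma Sp_projM i j x :
  Sp_proj i (Sp_proj j x) = if i == j then Sp_proj j x else 0.
Proof.
elim/Sp_ind: x => [|x y IHx IHy|k x IHx|w].
- by rewrite !linear0 if_same.
- by rewrite !linearD IHx IHy; case: eqP; rewrite ?addr0.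
- by rewrite !linearZ /= IHx; case: eqP; rewrite ?scaler0.
- rewrite Sp_projE; have [wj|] := eqVneq (wdeg w) j.
    by rewrite Sp_projE wj eq_sym.
  by rewrite linear0 if_same.
Qed.

Lemma Sp_proj_sum x : exists2 s : seq int,
  uniq s & x = \sum_(k <- s) Sp_proj k x.
Proof.
suff [s sP] : exists s : seq int, forall s', uniq s' -> {subset s <= s'} ->
    x = \sum_(k <- s') Sp_proj k x.
  exists (undup s); rewrite ?undup_uniq //; apply: sP; first exact: undup_uniq.
  by move=> k; rewrite mem_undup.
elim/Sp_ind: x => [|x y [s sP] [t tP]|k x [s sP]|w].
- by exists [::] => s' _ _; rewrite big1 // => k _; rewrite linear0.
- exists (s ++ t) => s' us' sub.
  under eq_bigr do rewrite linearD; rewrite big_split /= -sP -?tP // => k kin;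
    by apply: sub; rewrite mem_cat kin ?orbT.
- exists s => s' us' sub.
  by under eq_bigr do rewrite linearZ /=; rewrite -scaler_sumr -sP.
- exists [:: wdeg w] => s' us' sub.
  rewrite (bigD1_seq (wdeg w)) ?sub ?mem_head //= Sp_projE eqxx.
  rewrite big1 ?addr0 // => k /negbTE kw.
  by rewrite Sp_projE eq_sym kw.
Qed.

Definition SpG : gradedSpace K := GradedSpace Sp_projM Sp_proj_sum.

Lemma Ssign_nil (q : int) :
  (-1) ^ (q * wdeg ([::] : word)) *: Sword [::] = 0.
Proof. by rewrite Sword_nil scaler0. Qed.
Lemma Ssign_multisym (q : int) :
  multisym (fun w => (-1) ^ (q * wdeg w) *: Sword w).
Proof. exact: (multisym_weight (fun i => (-1) ^ (q * i))) Sword_multisym. Qed.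
Definition Ssign (q : int) : {linear Sp -> Sp} :=
  Slift (Ssign_nil q) (Ssign_multisym q).

(* All ways of distributing the letters of a word over two subwords, with the
   exponent of the Koszul sign.  The two splittings with an empty subword do
   not contribute to [Sdelta] since [Sword [::] = 0]. *)
Fixpoint unshuffles (w : word) : seq (int * (word * word)) :=
  if w is x :: w' then
    [seq (p.1, (x :: p.2.1, p.2.2)) | p <- unshuffles w'] ++
    [seq (p.1 + ldeg x * wdeg p.2.1, (p.2.1, x :: p.2.2)) | p <- unshuffles w']
  else [:: (0, ([::], [::]))].

Definition split_sum (U : lmodType K) (f : word -> word -> U) (w : word) : U :=
  \sum_(p <- unshuffles w) (-1) ^ p.1 *: f p.2.1 p.2.2.

Lemma split_sum_cons (U : lmodType K) (f : word -> word -> U) x w :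
  split_sum f (x :: w) =
  split_sum (fun a b => f (x :: a) b + (-1) ^ (ldeg x * wdeg a) *: f a (x :: b)) w.
Proof.
rewrite /split_sum /= big_cat !big_map /= -big_split /=; apply: eq_bigr => p _.
by rewrite scalerDr scalerA sgzD.
Qed.

Lemma split_sumP (U : lmodType K) (c : K) (f g h : word -> word -> U) w :
  (forall a b, f a b = c *: g a b + h a b) ->
  split_sum f w = c *: split_sum g w + split_sum h w.
Proof.
move=> fE; rewrite /split_sum scaler_sumr -big_split /=; apply: eq_bigr => p _.
by rewrite fE scalerDr !scalerA mulrC.
Qed.

Lemma split_sumZ (U : lmodType K) (c : K) (f g : word -> word -> U) w :
  (forall a b, f a b = c *: g a b) -> split_sum f w = c *: split_sum g w.
Proof.
move=> fE; rewrite /split_sum scaler_sumr /=; apply: eq_bigr => p _.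
by rewrite fE !scalerA mulrC.
Qed.

Definition bimultisym (U : lmodType K) (f : word -> word -> U) :=
  (forall b, multisym (f^~ b)) /\ (forall a, multisym (f a)).

Lemma bimultisym_step (U : lmodType K) (f : word -> word -> U) x :
  bimultisym f -> bimultisym
    (fun a b => f (x :: a) b + (-1) ^ (ldeg x * wdeg a) *: f a (x :: b)).
Proof.
move=> [fl fr]; split=> [b|a].
- apply: multisym_add; first exact: (multisym_cons x (fl b)).
  exact: (multisym_weight (fun i => (-1) ^ (ldeg x * i)) (fl _)).
- apply: multisym_add; first exact: fr.
  exact: (multisym_scale _ (multisym_cons x (fr a))).
Qed.

Lemma split_sum_multisym (U : lmodType K) (f : word -> word -> U) :
  bimultisym f -> multisym (split_sum f).
Proof.
suff hd (g : word -> word -> U) : bimultisym g ->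
    (forall v (x y z : letter) k,
       ldeg y = ldeg x -> ldeg z = ldeg x -> lval z = k *: lval x + lval y ->
       split_sum g (z :: v) = k *: split_sum g (x :: v) + split_sum g (y :: v)) /\
    (forall v (x y : letter), split_sum g [:: x, y & v] =
       (-1) ^ (ldeg x * ldeg y) *: split_sum g [:: y, x & v]).
  move=> fP; split=> [u v x y z k xy xz zE|u v x y];
    elim: u f fP => [|t u IHu] f fP /=.
  - by have [h _] := hd _ fP; apply: h.
  - by rewrite !(split_sum_cons f t) IHu //; apply: bimultisym_step.
  - by have [_ h] := hd _ fP; apply: h.
  - by rewrite !(split_sum_cons f t) IHu //; apply: bimultisym_step.
move=> [gl gr]; split=> [v x y z k xy xz zE|v x y].
- rewrite !split_sum_cons; apply: split_sumP => a b.
  have [h _] := gl b; rewrite (h [::] a _ _ _ _ xy xz zE) /=.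
  have [{}h _] := gr a; rewrite (h [::] b _ _ _ _ xy xz zE) /=.
  by rewrite xy xz !scalerDr !scalerA mulrC addrACA.
- rewrite !split_sum_cons; apply: split_sumZ => a b /=.
  have [_ h] := gl b; rewrite (h [::] a x y) /=.
  have [_ {}h] := gr a; rewrite (h [::] b x y) /=.
  rewrite !wdeg_cons !scalerDr !scalerA !mulrDr !sgzD (mulrC (ldeg y) (ldeg x)).
  rewrite -!addrA; congr (_ + _); rewrite addrCA; congr (_ *: _ + _).
    by rewrite mulrA sgzz mul1r.
  congr (_ + _); congr (_ *: _).
  by rewrite mulrC (mulrC ((-1) ^ (ldeg y * wdeg a))).
Qed.

Lemma Sdelta_bimultisym : bimultisym (fun a b => tprod (Sword a) (Sword b)).
Proof.
have [tl tr] := tprod_bilin Sp Sp; have [sl ss] := Sword_multisym.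
split=> [b|a]; split=> [u v x y z k xy xz zE|u v x y].
- by rewrite (sl _ _ _ _ _ _ xy xz zE) tl.
- by rewrite ss (bilinZl (tprod_bilin _ _)).
- by rewrite (sl _ _ _ _ _ _ xy xz zE) tr.
- by rewrite ss (bilinZr (tprod_bilin _ _)).
Qed.

Definition Sdelta_word : word -> tens Sp Sp :=
  split_sum (fun a b => tprod (Sword a) (Sword b)).

Lemma Sdelta_nil : Sdelta_word [::] = 0.
Proof.
rewrite /Sdelta_word /split_sum big_seq1 /= Sword_nil scale1r.
exact: (bilin0l (tprod_bilin _ _)).
Qed.

Definition Sdelta : {linear Sp -> tens Sp Sp} :=
  Slift Sdelta_nil (split_sum_multisym Sdelta_bimultisym).

Lemma SdeltaE w : Sdelta (Sword w) = Sdelta_word w.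
Proof. exact: SliftE. Qed.

End Symmetric.

Section Differential.
Variables (K : fieldType) (g : dgLie K).
Local Notation V := (shift g 1).
Local Notation letter := (letter V).
Local Notation word := (word V).

Lemma dletter_homog (x : letter) :
  homog (V := V) (ldeg x + 1) (dgl_d g (lval x)).
Proof. by have := dgl_d_degree (lhomog x); rewrite /homog /= addrA. Qed.
Definition dletter (x : letter) : letter := Letter (dletter_homog x).

Lemma bletter_homog (x y : letter) :
  homog (V := V) (ldeg x + ldeg y + 1) (dgl_br (lval x) (lval y)).
Proof.
have := dgl_br_degree (lhomog x) (lhomog y); rewrite /homog /=.
by rewrite addrACA addrC addrCA addrC -!addrA.
Qed.
Definition bletter (x y : letter) : letter := Letter (bletter_homog x y).

(* Coderivation extending the maps g[1] -> g[1], sx |-> - s(dx), and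
   S^2(g[1]) -> g[1], sx sy |-> (-1)^|x| s[x, y], where [ldeg] is the degree of
   sx, namely |x| - 1.  A pair [(n, w)] stands for the term (-1)^n w;
   [ad_terms x w] lists the terms in which the letter x, originally placed
   before w, is bracketed with a letter of w. *)
Fixpoint ad_terms (x : letter) (w : word) : seq (int * word) :=
  if w is y :: w' then
    (ldeg x + 1, bletter x y :: w') ::
    [seq (p.1 + (ldeg x + 1) * ldeg y, y :: p.2) | p <- ad_terms x w']
  else [::].

Fixpoint d_terms (w : word) : seq (int * word) :=
  if w is x :: w' then
    (1, dletter x :: w') ::
    ad_terms x w' ++ [seq (p.1 + ldeg x, x :: p.2) | p <- d_terms w']
  else [::].

Section Sums.
Variable U : lmodType K.
Implicit Types f : word -> U.

Definition wsum f (s : seq (int * word)) : U := \sum_(p <- s) (-1) ^ p.1 *: f p.2.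

Lemma wsum_map f n x s :
  wsum f [seq (p.1 + n, x :: p.2) | p <- s] =
  (-1) ^ n *: wsum (fun w => f (x :: w)) s.
Proof.
rewrite /wsum big_map scaler_sumr; apply: eq_bigr => p _ /=.
by rewrite sgzD scalerA mulrC.
Qed.

Lemma wsumP k f1 f2 f s : (forall w, f w = k *: f1 w + f2 w) ->
  wsum f s = k *: wsum f1 s + wsum f2 s.
Proof.
move=> fE; rewrite /wsum scaler_sumr -big_split /=; apply: eq_bigr => p _.
by rewrite fE scalerDr !scalerA mulrC.
Qed.

Lemma wsumZ k f1 f s : (forall w, f w = k *: f1 w) -> wsum f s = k *: wsum f1 s.
Proof.
move=> fE; rewrite /wsum scaler_sumr /=; apply: eq_bigr => p _.
by rewrite fE !scalerA mulrC.
Qed.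

Lemma ad_sum_cons f x y w :
  wsum f (ad_terms x (y :: w)) =
  (-1) ^ (ldeg x + 1) *: f (bletter x y :: w) +
  (-1) ^ ((ldeg x + 1) * ldeg y) *: wsum (fun v => f (y :: v)) (ad_terms x w).
Proof. by rewrite -wsum_map /wsum /= big_cons. Qed.

Lemma d_sum_cons f x w :
  wsum f (d_terms (x :: w)) =
  - f (dletter x :: w) + wsum f (ad_terms x w) +
  (-1) ^ ldeg x *: wsum (fun v => f (x :: v)) (d_terms w).
Proof. by rewrite -wsum_map /wsum /= big_cons big_cat /= expr1z scaleN1r addrA. Qed.

#[local] Arguments ad_terms : simpl never.
#[local] Arguments d_terms : simpl never.

Lemma multilinZ f u v (x z : letter) k : multilin f ->
  ldeg z = ldeg x -> lval z = k *: lval x -> f (u ++ z :: v) = k *: f (u ++ x :: v).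
Proof.
move=> fl xz zE; rewrite (fl u v x x z (k - 1) erefl xz).
  by rewrite scalerBl scale1r subrK.
by rewrite zE scalerBl scale1r subrK.
Qed.

Lemma ad_sum_linl f w (x y z : letter) k : multilin f ->
    ldeg y = ldeg x -> ldeg z = ldeg x -> lval z = k *: lval x + lval y ->
  wsum f (ad_terms z w) = k *: wsum f (ad_terms x w) + wsum f (ad_terms y w).
Proof.
move=> fl xy xz zE; elim: w f fl => [|t w IHw] f fl.
  by rewrite /wsum !big_nil scaler0 addr0.
rewrite !ad_sum_cons xy xz (IHw (fun v => f (t :: v))); last first.
  by move=> u v *; apply: (fl (t :: u)).
rewrite (fl [::] w (bletter x t) (bletter y t) (bletter z t) k) /= ?xy ?xz //.
  by rewrite !scalerDr !scalerA ![_ * k]mulrC addrACA.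
by rewrite zE (dgl_br_bilin g).1.
Qed.

Lemma ad_sum_multisym f x : multisym f -> multisym (fun w => wsum f (ad_terms x w)).
Proof.
have cons_ms t f1 : multisym f1 -> multisym (fun v => f1 (t :: v)).
  exact: multisym_cons.
move=> fP; split=> [u v y z t k yz yt tE|u v y z];
  elim: u f fP => [|s u IHu] f fP /=.
- rewrite !ad_sum_cons yz yt.
  rewrite (fP.1 [::] v (bletter x y) (bletter x z) (bletter x t) k) /= ?yz ?yt //;
    last by rewrite tE (dgl_br_bilin g).2.
  rewrite (@wsumP k (fun w => f (y :: w)) (fun w => f (z :: w))).
    by rewrite !scalerDr !scalerA ![_ * k]mulrC addrACA.
  by move=> w; apply: (fP.1 [::]).
- rewrite !(ad_sum_cons _ _ s) (IHu _ (cons_ms s _ fP)).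
  have /= -> := fP.1 (bletter x s :: u) v y z t k yz yt tE.
  by rewrite !scalerDr !scalerA ![_ * k]mulrC addrACA.
- rewrite !ad_sum_cons.
  rewrite (fP.2 [::] v y (bletter x z)) (fP.2 [::] v z (bletter x y)) /=.
  rewrite (@wsumZ ((-1) ^ (ldeg y * ldeg z)) (fun w => f [:: z, y & w]));
    last by move=> w; apply: (fP.2 [::]).
  rewrite !scalerDr !scalerA addrCA; congr (_ *: _ + (_ *: _ + _ *: _)).
  + sgz_cases K.
  + sgz_cases K.
  + sgz_cases K.
- rewrite !(ad_sum_cons _ _ s) (IHu _ (cons_ms s _ fP)).
  have /= -> := fP.2 (bletter x s :: u) v y z.
  by rewrite !scalerDr !scalerA ![_ * (-1) ^ (ldeg y * ldeg z)]mulrC.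
Qed.

Lemma bletter_swap f w (x y : letter) : multilin f ->
  f (bletter x y :: w) =
  - (-1) ^ ((ldeg x + 1) * (ldeg y + 1)) *: f (bletter y x :: w).
Proof.
move=> fl; apply: (@multilinZ f [::] w _ _ _ fl) => /=; first by rewrite (addrC (ldeg x)).
have hx := lhomog x; have hy := lhomog y.
by rewrite (dgl_antisym hx hy) scaleNr -!(addrC 1).
Qed.

Lemma d_sum_multisym f : multisym f -> multisym (fun w => wsum f (d_terms w)).
Proof.
have cons_ms t f1 : multisym f1 -> multisym (fun v => f1 (t :: v)).
  exact: multisym_cons.
move=> fP; split=> [u v y z t k yz yt tE|u v x y];
  elim: u f fP => [|s u IHu] f fP /=.
- rewrite !d_sum_cons yz yt (ad_sum_linl v fP.1 yz yt tE).
  rewrite (fP.1 [::] v (dletter y) (dletter z) (dletter t) k) /= ?yz ?yt //;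
    last by rewrite tE linearP.
  rewrite (@wsumP k (fun w => f (y :: w)) (fun w => f (z :: w))
                    (fun w => f (t :: w))); last first.
    by move=> w; apply: (fP.1 [::]).
  rewrite !scalerDr !scalerA ![_ * k]mulrC opprD scalerN.
  by rewrite [RHS]addrACA [X in _ = X + _]addrACA.
- rewrite !(d_sum_cons _ s) (IHu _ (cons_ms s _ fP)).
  have /= -> := fP.1 (dletter s :: u) v y z t k yz yt tE.
  rewrite ((ad_sum_multisym s fP).1 _ _ _ _ _ _ yz yt tE).
  rewrite !scalerDr !scalerA ![_ * k]mulrC opprD scalerN.
  by rewrite [RHS]addrACA [X in _ = X + _]addrACA.
- rewrite !d_sum_cons !ad_sum_cons.
  rewrite (bletter_swap v x y fP.1).
  have /= -> := fP.2 [::] v (dletter x) y.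
  have /= -> := fP.2 [::] v x (dletter y).
  rewrite (@wsumZ ((-1) ^ (ldeg x * ldeg y)) (fun w => f [:: y, x & w]) (fun w => f [:: x, y & w]));
    last by move=> w; apply: (fP.2 [::]).
  rewrite !scalerDr !scalerN !scalerA.
  rewrite !addrA [LHS](ACl (4*2*5*1*3*6)) /=.
  congr (- (_ *: _) + _ *: _ + _ *: _ - _ *: _ + _ *: _ + _ *: _).
  + sgz_cases K.
  + sgz_cases K.
  + sgz_cases K.
  + sgz_cases K.
  + sgz_cases K.
  + sgz_cases K.
- rewrite !(d_sum_cons _ s) (IHu _ (cons_ms s _ fP)).
  have /= -> := fP.2 (dletter s :: u) v x y.
  rewrite ((ad_sum_multisym s fP).2 _ _ x y).
  by rewrite !scalerDr !scalerN !scalerA ![_ * (-1) ^ (ldeg x * ldeg y)]mulrC.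
Qed.
End Sums.
End Differential.

Section Chains.
Variables (K : fieldType) (g : dgLie K).
Local Notation V := (shift g 1).

Definition CEp : gradedSpace K := SpG V.

Lemma CEd_nil : wsum (@Sword K V) (d_terms [::]) = 0.
Proof. by rewrite /wsum big_nil. Qed.

Definition CEd : {linear CEp -> CEp} :=
  Slift CEd_nil (d_sum_multisym (@Sword_multisym K V)).

Definition CEdelta : {linear CEp -> tens CEp CEp} := Sdelta V.

(* The projection onto S^1(g[1]) = g[1], seen as a map of degree 1 to g. *)
Definition single_letter (w : word V) : g := if w is [:: x] then lval x else 0.

Lemma single_letter_multisym : multisym (V := V) single_letter.
Proof.
split=> [[|t [|t' u]] [|s v] x y z k _ _ zE|[|t [|t' u]] v x y] //=;
  by rewrite ?scaler0 ?addr0.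
Qed.

Definition CEproj : {linear CEp -> g} :=
  Slift (f := single_letter) erefl single_letter_multisym.

Definition lie_tens : {linear tens g g -> g} := tens_lift (dgl_br_bilin g).

Definition cocycle (k : int) (x : g) := homog k x /\ dgl_d g x = 0.
Definition cohomologous (k : int) (x y : g) :=
  exists2 z : g, homog (k - 1) z & x - y = dgl_d g z.

End Chains.

Record Linf (K : fieldType) (g1 g2 : dgLie K) := MkLinf {
  Lmap :> {linear CEp g1 -> CEp g2};
  Lmap_degree : has_degree 0 Lmap;
  Lmap_delta : forall c, CEdelta g2 (Lmap c) = tens_map Lmap Lmap (CEdelta g1 c);
  Lmap_d : forall c, CEd g2 (Lmap c) = Lmap (CEd g1 c)
}.

Section LinfCategory.
Variable K : fieldType.

Section Id.
Variable g : dgLie K.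
Let f : {linear CEp g -> CEp g} := idfun.
Lemma Linf_id_degree : has_degree 0 f.
Proof. by move=> k x; rewrite addr0. Qed.
Lemma Linf_id_delta c : CEdelta g (f c) = tens_map f f (CEdelta g c).
Proof.
by apply/esym; apply: (tens_ext (g := idfun)) => v w; apply: tens_mapE.
Qed.
Definition Linf_id : Linf g g :=
  MkLinf Linf_id_degree Linf_id_delta (fun=> erefl).
End Id.

Section Comp.
Variables (g1 g2 g3 : dgLie K) (G : Linf g2 g3) (F : Linf g1 g2).
Let f : {linear CEp g1 -> CEp g3} := G \o F.
Lemma Linf_comp_degree : has_degree 0 f.
Proof.
move=> k x kx; have := Lmap_degree G (Lmap_degree F kx).
by rewrite addr0.
Qed.
Lemma Linf_comp_delta c : CEdelta g3 (f c) = tens_map f f (CEdelta g1 c).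
Proof.
rewrite /f /= !Lmap_delta.
apply: (tens_ext (f := tens_map G G \o tens_map F F)) => v w.
by rewrite [LHS]/= (tens_mapE F F) (tens_mapE G G) (tens_mapE f f).
Qed.
Lemma Linf_comp_d c : CEd g3 (f c) = f (CEd g1 c).
Proof. by rewrite /f /= !Lmap_d. Qed.
Definition Linf_comp : Linf g1 g3 :=
  MkLinf Linf_comp_degree Linf_comp_delta Linf_comp_d.
End Comp.

Variables g1 g2 : dgLie K.

(* All Taylor components at once: [taylor F] is the element of degree 1 of the
   convolution dg Lie algebra Hom(CEp g1, g2) attached to [F]. *)
Definition taylor (F : Linf g1 g2) : {linear CEp g1 -> g2} := CEproj g2 \o F.

(* The first Taylor component on the part of degree [k] of g1, which is the
   part of degree [k - 1] of g1[1]. *)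
Definition taylor1 (F : Linf g1 g2) (k : int) (x : g1) : g2 :=
  taylor F (Sword [:: component (V := shift g1 1) (k - 1) x]).

Definition Linf_qiso (F : Linf g1 g2) := forall k : int,
  (forall x y : g1, cocycle k x -> cocycle k y ->
     cohomologous k (taylor1 F k x) (taylor1 F k y) -> cohomologous k x y) /\
  (forall y : g2, cocycle k y ->
     exists2 x : g1, cocycle k x & cohomologous k (taylor1 F k x) y).

Definition conv_diff (p : int) (theta : {linear CEp g1 -> g2}) (c : CEp g1) : g2 :=
  dgl_d g2 (theta c) - (-1) ^ p *: theta (CEd g1 c).

(* Here [q] is the degree of [theta2], which produces the Koszul sign
   (theta1 # theta2)(a # b) = (-1)^(q |a|) theta1 a # theta2 b, # being the
   tensor product. *)
Definition conv_br (q : int) (theta1 theta2 : {linear CEp g1 -> g2})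
    (c : CEp g1) : g2 :=
  lie_tens g2 (tens_map (theta1 \o Ssign (shift g1 1) q) theta2 (CEdelta g1 c)).

(* [u] is a polynomial curve in V and [u'] is its derivative. *)
Definition poly_deriv (V : lmodType K) (u u' : K -> V) :=
  exists s : seq V,
    (forall t, u t = \sum_(i < size s) t ^+ i *: s`_i) /\
    (forall t, u' t = \sum_(i < size s) (t ^+ i.-1 *+ i) *: s`_i).

(* dF/dt = - d H + [H, F].  By the filtration by arity, the solution with given
   F(0) exists, is unique, and is polynomial in t on each chain. *)
Definition gauge_flow (H : {linear CEp g1 -> g2}) (F : K -> {linear CEp g1 -> g2}) :=
  (forall t, has_degree 1 (F t)) /\
  (forall c, poly_deriv (F^~ c)
     (fun t => - conv_diff 0 H c + conv_br 1 H (F t) c)).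

Definition homotopic (F1 F2 : Linf g1 g2) :=
  exists2 H : {linear CEp g1 -> g2}, has_degree 0 H &
  exists F : K -> {linear CEp g1 -> g2},
    [/\ gauge_flow H F, F 0 =1 taylor F1 & F 1 =1 taylor F2].

End LinfCategory.

(* Main.v *)
(** Obstruction theory in arity produces one-sided statements, which are combined
    by factoring [F]. Let [C] be the product of [g2] with the cone of [g1]. Then
    [F = p i], where [p : C -> g2] is the projection, and [i : g1 -> C], whose
    components are [F] and a map to the cone, has an injective linear part; the
    projection [p] has the strict section [s]. The linear parts of [i] and [s] are
    injective quasi-isomorphisms, so over a field they are the inclusions of
    deformation retracts, and the maps on [S^n] vanishing on the retract form an
    acyclic complex. Hence, correcting one arity at a time,
    - [i] has a retraction [r], that is [r i = id];
    - if [A] and [B] agree after composition with [i] (or with [s]), then they are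
      homotopic, through a flow that is constant on the image of [i] (of [s]).
    Take [G = r s]. Since [r s p s = r s], [r s p] is homotopic to [r], whence
    [G F = r s p i ~ r i = id]. Since [F r i = F = p i], [F r] is homotopic to [p],
    whence [F G = F r s ~ p s = id]. Only precomposition of homotopies is used,
    under which the generator of a flow stays constant in time. *)

Require Import Defs.
From HB Require Import structures.
From mathcomp Require Import all_boot all_order all_algebra ssrAC.
From mathcomp Require Import boolp reals complex.
From mathcomp Require classical_sets.

Set Implicit Arguments.
Unset Strict Implicit.
Unset Printing Implicit Defensive.

Import Order.TTheory GRing.Theory Num.Theory.
Local Open Scope ring_scope.

(** * Splittings of words *)

(** Correcting a map one arity at a time meets obstructions on S^n of the source, and these die only
    relative to a retract on which the map is already right; so the morphism along which maps are
    extended must have an injective linear part. [F] need not have one, and is therefore traded for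
    two morphisms into [C] that do. Postcomposing a flow with a nonlinear morphism would make its
    generator depend on time, which dictates the order of the compositions. Everything is computed
    on words. The tensor square is only presented by generators and relations, so an element killed
    by the coproduct is recognised through a multiplication [mu], which composed with the coproduct
    is [2 ^ n - 2] on S^n. Characteristic zero enters through this number, through the factorials in
    [cexp] and through the count of letters outside the retract in [contract_words]. *)

Lemma lin_scale (K : fieldType) (U W : lmodType K) (f : {linear U -> W}) k x :
  f (k *: x) = k *: f x.
Proof. exact: linearZ. Qed.

Lemma multilin_scale (K : fieldType) (V : gradedSpace K) (U : lmodType K)
    (f : word V -> U) u v (x z : letter V) c : multilin f ->
  ldeg z = ldeg x -> lval z = c *: lval x -> f (u ++ z :: v) = c *: f (u ++ x :: v).
Proof.
(* Multilinearity is applied with both letters equal to [x], which avoids a zero letter; [c = 0]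
   then shows that [f] vanishes when a letter has value 0. *)
move=> fl xz zE; rewrite (fl u v x x z (c - 1) erefl xz).
  by rewrite scalerBl scale1r subrK.
by rewrite zE scalerBl scale1r subrK.
Qed.

Section SplitSum.
Variables (K : fieldType) (V : gradedSpace K) (U : lmodType K).
Local Notation word := (word V).
Implicit Types (f g : word -> word -> U) (w : word).

(** The two side conditions on [a] and [b] allow Koszul signs to be compared, and inductions on
    arity to be run, under the sum. *)
Lemma eq_split_sum f g w :
  (forall a b, wdeg a + wdeg b = wdeg w -> (size a + size b = size w)%N ->
     f a b = g a b) -> split_sum f w = split_sum g w.
Proof.
elim: w f g => [|x w IHw] f g fg.
  by rewrite /split_sum !big_seq1 /= fg // /wdeg big_nil addr0.
rewrite !split_sum_cons; apply: IHw => a b dab sab.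
rewrite !fg /= ?wdeg_cons ?addnS ?addSn ?sab -?dab ?addrA //.
by rewrite (addrC (wdeg a)).
Qed.

Lemma split_sum_closed (P : U -> Prop) f w :
  P 0 -> (forall c x y, P x -> P y -> P (c *: x + y)) ->
  (forall a b, wdeg a + wdeg b = wdeg w -> (size a + size b = size w)%N ->
     P (f a b)) -> P (split_sum f w).
Proof.
move=> P0 PD; elim: w f => [|x w IHw] f fP.
  rewrite /split_sum big_seq1 /= expr0z scale1r; apply: fP => //.
  by rewrite /wdeg big_nil addr0.
rewrite split_sum_cons; apply: IHw => a b dab sab; rewrite addrC.
apply: PD; apply: fP; rewrite /= ?addnS ?addSn ?sab // !wdeg_cons -dab.
  by rewrite addrCA.
by rewrite addrA.
Qed.

Lemma split_sumD f g w :
  split_sum (fun a b => f a b + g a b) w = split_sum f w + split_sum g w.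
Proof. by rewrite (@split_sumP _ _ _ 1 _ f g) ?scale1r // => a b; rewrite scale1r. Qed.

Lemma split_sum_scale c f w :
  split_sum (fun a b => c *: f a b) w = c *: split_sum f w.
Proof. exact: split_sumZ. Qed.

Lemma split_sum_lin (U' : lmodType K) (T : {linear U -> U'}) f w :
  T (split_sum f w) = split_sum (fun a b => T (f a b)) w.
Proof. by rewrite /split_sum linear_sum; apply: eq_bigr => p _; rewrite linearZ. Qed.

Lemma split_sum0 w : split_sum (fun _ _ => 0 : U) w = 0.
Proof. by rewrite /split_sum big1 // => p _; rewrite scaler0. Qed.

Lemma split_sum_sum (I : Type) (r : seq I) (F : I -> word -> word -> U) w :
  split_sum (fun a b => \sum_(i <- r) F i a b) w = \sum_(i <- r) split_sum (F i) w.
Proof.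
by rewrite /split_sum exchange_big; apply: eq_bigr => p _; rewrite scaler_sumr.
Qed.

(** Graded cocommutativity, read through test functions on pairs of words. *)
Lemma split_sumC f w :
  split_sum f w = split_sum (fun a b => (-1) ^ (wdeg a * wdeg b) *: f b a) w.
Proof.
elim: w f => [|x w IHw] f.
  by rewrite /split_sum !big_seq1 /= /wdeg big_nil mul0r expr0z !scale1r.
rewrite !split_sum_cons IHw; apply: eq_split_sum => a b _ _.
rewrite !wdeg_cons scalerDr !scalerA addrC; congr (_ *: _ + _ *: _); sgz_cases K.
Qed.

(** Coassociativity, read through test functions. *)
Lemma split_sumA (f : word -> word -> word -> U) w :
  split_sum (fun a bc => split_sum (f a) bc) w =
  split_sum (fun ab c => split_sum (fun a b => f a b c) ab) w.
Proof.
elim: w f => [|x w IHw] f.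
  by rewrite /split_sum !big_seq1.
rewrite !split_sum_cons.
(* The three terms are the three possible destinations of the first letter [x]; both sides reduce to
   the statement for [f']. *)
pose f' a b c := f (x :: a) b c + (-1) ^ (ldeg x * wdeg a) *: f a (x :: b) c
  + (-1) ^ (ldeg x * (wdeg a + wdeg b)) *: f a b (x :: c).
transitivity (split_sum (fun a bc => split_sum (f' a) bc) w); last rewrite IHw.
  apply: eq_split_sum => a bc _ _.
  rewrite split_sum_cons /f' -split_sum_scale -split_sumD; apply: eq_split_sum => b c _ _.
  by rewrite scalerDr scalerA -addrA mulrDr sgzD.
apply: eq_split_sum => ab c _ _.
rewrite split_sum_cons /f' split_sumD; congr (_ + _).
rewrite -split_sum_scale.
by apply: eq_split_sum => a b <- _.
Qed.

End SplitSum.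

Section Coderivation.
Variables (K : fieldType) (g : dgLie K) (U : lmodType K).
Local Notation V := (shift g 1).
Local Notation word := (word V).
Local Notation letter := (letter V).
Implicit Types (f : word -> U) (k : word -> word -> U) (w : word) (x y : letter).

Lemma wsumD f f' s : wsum (fun w => f w + f' w) s = wsum f s + wsum f' s.
Proof. by rewrite (@wsumP _ _ _ 1 f f') ?scale1r // => w; rewrite scale1r. Qed.

Lemma wsum_scale c f s : wsum (fun w => c *: f w) s = c *: wsum f s.
Proof. exact: wsumZ. Qed.

Lemma wsum_lin (U' : lmodType K) (T : {linear U -> U'}) f s :
  T (wsum f s) = wsum (fun w => T (f w)) s.
Proof. by rewrite /wsum linear_sum; apply: eq_bigr => p _; rewrite linearZ. Qed.

Lemma wsum0 s : wsum (fun _ : word => 0 : U) s = 0.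
Proof. by rewrite /wsum big1 // => p _; rewrite scaler0. Qed.

Lemma eq_wsum_ad f f' x w :
  (forall u, wdeg u = ldeg x + 1 + wdeg w -> size u = size w -> f u = f' u) ->
  wsum f (ad_terms x w) = wsum f' (ad_terms x w).
Proof.
elim: w f f' => [|y w IHw] f f' ff'; first by rewrite /wsum !big_nil.
rewrite !ad_sum_cons ff' /=; first congr (_ + _ *: _).
- apply: IHw => u du su; apply: ff'; last by rewrite /= su.
  by rewrite !wdeg_cons du addrCA.
- by rewrite !wdeg_cons /= !addrA (addrAC (ldeg x) 1).
- by [].
Qed.

Lemma eq_wsum_d f f' w :
  (forall u, wdeg u = 1 + wdeg w -> (size u <= size w <= (size u).+1)%N ->
     f u = f' u) ->
  wsum f (d_terms w) = wsum f' (d_terms w).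
Proof.
elim: w f f' => [|x w IHw] f f' ff'; first by rewrite /wsum !big_nil.
rewrite !d_sum_cons ff' /=; first congr (_ + _ + _ *: _).
- apply: eq_wsum_ad => u du su; apply: ff'; last by rewrite /= su leqnn leqnSn.
  by rewrite !wdeg_cons du !addrA (addrC 1).
- apply: IHw => u du /= su; apply: ff' => //=.
  by rewrite !wdeg_cons du addrCA.
- by rewrite !wdeg_cons /= !addrA (addrC 1).
- by rewrite leqnn leqnSn.
Qed.

(** Bracketing with [x] is a coderivation of degree [ldeg x + 1]: the letter met by [x] lies in the
    left or in the right part, and in the second case [x] and the bracket must pass the left
    part. *)
Lemma split_sum_ad k x w :
  wsum (split_sum k) (ad_terms x w) =
  split_sum (fun a b => wsum (k^~ b) (ad_terms x a) +
    (-1) ^ ((ldeg x + 1) * wdeg a) *: wsum (k a) (ad_terms x b)) w.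
Proof.
elim: w k => [|y w IHw] k.
  rewrite /split_sum big_seq1 /wsum /= !big_nil.
  by rewrite !scaler0 addr0 scaler0.
rewrite ad_sum_cons !split_sum_cons.
have -> : (fun v => split_sum k (y :: v)) =
  split_sum (fun a b => k (y :: a) b + (-1) ^ (ldeg y * wdeg a) *: k a (y :: b)).
  by apply/funext => v; rewrite split_sum_cons.
rewrite {}IHw -!split_sum_scale -split_sumD; apply: eq_split_sum => a b _ _.
rewrite [X in _ + _ *: (X + _)](_ : _ = wsum (fun u => k (y :: u) b) (ad_terms x a)
  + (-1) ^ (ldeg y * (ldeg x + 1 + wdeg a)) *: wsum (k^~ (y :: b)) (ad_terms x a)).
  rewrite !wsumD !wsum_scale !ad_sum_cons !wdeg_cons /=.
  rewrite !scalerDr !scalerA !addrA.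
  rewrite [LHS](ACl (1*3*5*4*2*6)) /=.
  congr (_ *: _ + _ *: _ + _ *: _ + _ *: _ + _ *: _ + _ *: _); sgz_cases K.
rewrite wsumD; congr (_ + _); rewrite -wsum_scale; apply: eq_wsum_ad => u -> _.
by [].
Qed.

(** The terms of the differential form a coderivation of degree 1; the brackets of the first letter
    are handled by [split_sum_ad]. *)
Lemma split_sum_d k w :
  wsum (split_sum k) (d_terms w) =
  split_sum (fun a b => wsum (k^~ b) (d_terms a) +
    (-1) ^ (wdeg a) *: wsum (k a) (d_terms b)) w.
Proof.
elim: w k => [|x w IHw] k.
  rewrite /split_sum big_seq1 /wsum /= !big_nil.
  by rewrite !scaler0 addr0 scaler0.
rewrite d_sum_cons !split_sum_cons split_sum_ad.
have -> : (fun v => split_sum k (x :: v)) =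
  split_sum (fun a b => k (x :: a) b + (-1) ^ (ldeg x * wdeg a) *: k a (x :: b)).
  by apply/funext => v; rewrite split_sum_cons.
rewrite {}IHw -scaleN1r -!split_sum_scale -!split_sumD; apply: eq_split_sum => a b _ _.
rewrite [X in _ + _ *: (X + _)](_ : _ = wsum (fun u => k (x :: u) b) (d_terms a)
  + (-1) ^ (ldeg x * (1 + wdeg a)) *: wsum (k^~ (x :: b)) (d_terms a)).
  rewrite !wsumD !wsum_scale !d_sum_cons !wdeg_cons /=.
  rewrite !scaleN1r !scalerDr ?scalerN !scalerA ?opprD ?addrA.
  rewrite [LHS](ACl (1*3*5*7*6*2*4*8)) /=.
  congr (- _ + _ + _ *: _ + _ *: _ + _ *: _ - _ *: _ + _ *: _ + _ *: _); sgz_cases K.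
rewrite wsumD; congr (_ + _); rewrite -wsum_scale; apply: eq_wsum_d => u -> _.
by [].
Qed.

End Coderivation.

(** * Tensor products and arity *)

Section TensorProduct.
Variables (K : fieldType) (V W : lmodType K).

Lemma tprod0l (w : W) : tprod (0 : V) w = 0.
Proof. exact: bilin0l (tprod_bilin V W) w. Qed.
Lemma tprod0r (v : V) : tprod v (0 : W) = 0.
Proof. exact: bilin0r (tprod_bilin V W) v. Qed.
Lemma tprodZl k (v : V) (w : W) : tprod (k *: v) w = k *: tprod v w.
Proof. exact: bilinZl (tprod_bilin V W) k v w. Qed.
Lemma tprodZr k (v : V) (w : W) : tprod v (k *: w) = k *: tprod v w.
Proof. exact: bilinZr (tprod_bilin V W) k v w. Qed.
Lemma tprodDl (v v' : V) (w : W) : tprod (v + v') w = tprod v w + tprod v' w.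
Proof. by have := (tprod_bilin V W).1 w 1 v v'; rewrite /= !scale1r. Qed.
Lemma tprodDr (v : V) (w w' : W) : tprod v (w + w') = tprod v w + tprod v w'.
Proof. by have := (tprod_bilin V W).2 v 1 w w'; rewrite !scale1r. Qed.

Definition tprodl (w : W) := fun v : V => tprod v w.
Lemma tprodl_linear w : linear (tprodl w). Proof. exact: (tprod_bilin V W).1. Qed.
HB.instance Definition _ w :=
  GRing.isLinear.Build K V (tens V W) _ (tprodl w) (tprodl_linear w).
Definition tprodr (v : V) := fun w : W => tprod v w.
Lemma tprodr_linear v : linear (tprodr v). Proof. exact: (tprod_bilin V W).2. Qed.
HB.instance Definition _ v :=
  GRing.isLinear.Build K W (tens V W) _ (tprodr v) (tprodr_linear v).

End TensorProduct.

Section TensorLift.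
Variables (K : fieldType) (V : gradedSpace K) (U : lmodType K).
Local Notation word := (word V).
Variable k : word -> word -> U.
Hypotheses (kP : bimultisym k) (k0l : forall b, k [::] b = 0)
  (k0r : forall a, k a [::] = 0).

(** The lift to the tensor square goes one variable at a time: [kr a y] is lifted in the second
    variable, is then multisymmetric in the word [a], and lifts again. *)
Let kr a : {linear Sp V -> U} := Slift (k0r a) (kP.2 a).

Lemma Sp_bilin_nil y : kr [::] y = 0.
Proof.
elim/Sp_ind: y => [|x y IHx IHy|c x IHx|w].
- by rewrite linear0.
- by rewrite linearD IHx IHy addr0.
- by rewrite linearZ /= IHx scaler0.
- by rewrite /kr SliftE k0l.
Qed.

Lemma Sp_bilin_multisym y : multisym (fun a => kr a y).
Proof.
split=> [u v x y' z c xy xz zE|u v x x']; lazy beta;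
  elim/Sp_ind: y => [|t t' IHt IHt'|c' t IHt|w].
- by rewrite !linear0 addr0.
- by rewrite !linearD IHt IHt' addrACA.
- by rewrite !(lin_scale (kr _)) IHt !scalerDr !scalerA mulrC.
- by rewrite /kr !SliftE ((kP.1 w).1 _ _ _ _ _ _ xy xz zE).
- by rewrite !linear0.
- by rewrite !linearD IHt IHt'.
- by rewrite !(lin_scale (kr _)) IHt !scalerA mulrC.
- by rewrite /kr !SliftE ((kP.1 w).2).
Qed.

Definition Sp_bilin x y := Slift (Sp_bilin_nil y) (Sp_bilin_multisym y) x.

Lemma Sp_bilin_words a b : Sp_bilin (Sword a) (Sword b) = k a b.
Proof. by rewrite /Sp_bilin SliftE /kr SliftE. Qed.

Lemma Sp_bilinP : bilin Sp_bilin.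
Proof.
split=> [y|x]; first exact: linearP.
have B0 y : Sp_bilin 0 y = 0 by rewrite /Sp_bilin linear0.
have BD x1 x2 y : Sp_bilin (x1 + x2) y = Sp_bilin x1 y + Sp_bilin x2 y.
  by rewrite /Sp_bilin linearD.
have BZ c x1 y : Sp_bilin (c *: x1) y = c *: Sp_bilin x1 y.
  by rewrite /Sp_bilin lin_scale.
elim/Sp_ind: x => [|x x' IHx IHx'|c x IHx|w] d t t'.
- by rewrite !B0 scaler0 addr0.
- by rewrite !BD IHx IHx' scalerDr addrACA.
- by rewrite !BZ IHx !scalerDr !scalerA mulrC.
- by rewrite /Sp_bilin !SliftE linearP.
Qed.

Definition Tlift : {linear tens (Sp V) (Sp V) -> U} := tens_lift Sp_bilinP.

Lemma TliftE a b : Tlift (tprod (Sword a) (Sword b)) = k a b.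
Proof. by rewrite /Tlift tens_liftE Sp_bilin_words. Qed.

Lemma Tlift_delta w : Tlift (Sdelta V (Sword w)) = split_sum k w.
Proof.
rewrite SdeltaE /Sdelta_word split_sum_lin; apply: eq_split_sum => a b _ _.
exact: TliftE.
Qed.

End TensorLift.

Section Arity.
Variables (K : fieldType) (V : gradedSpace K).
Local Notation word := (word V).

Lemma arity_scale_multisym (U : lmodType K) (s : nat -> K) (f : word -> U) : multisym f ->
  multisym (fun w : word => s (size w) *: f w).
Proof.
move=> [fl fs]; split=> [u v x y z k xy xz zE|u v x y].
- rewrite (fl _ _ _ _ _ _ xy xz zE) !size_cat /=.
  by rewrite scalerDr !scalerA mulrC.
- by rewrite fs !size_cat /= !scalerA mulrC.
Qed.

Lemma arity_scale_nil (s : nat -> K) : s (size (@nil (letter V))) *: Sword [::] = 0 :>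
  Sp V.
Proof. by rewrite Sword_nil scaler0. Qed.

(** The operators that are scalar on each S^n. Truncations in arity and the inverse of [mu] after
    the coproduct are all of this form, and compose by [arity_scaleM]. *)
Definition arity_scale (s : nat -> K) : {linear Sp V -> Sp V} :=
  Slift (arity_scale_nil s) (arity_scale_multisym s (@Sword_multisym K V)).

Lemma arity_scaleE s w : arity_scale s (Sword w) = s (size w) *: Sword w.
Proof. exact: SliftE. Qed.

Lemma arity_scaleM s s' c :
  arity_scale s (arity_scale s' c) = arity_scale (fun n => s n * s' n) c.
Proof.
pose T : {linear Sp V -> Sp V} := arity_scale s \o arity_scale s'.
rewrite -[LHS]/(T c); apply: Sp_ext => w; rewrite /T /= arity_scaleE linearZ /=.
by rewrite !arity_scaleE scalerA mulrC.
Qed.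

Lemma eq_arity_scale s s' c : (forall n, (0 < n)%N -> s n = s' n) ->
  arity_scale s c = arity_scale s' c.
Proof.
move=> ss'; apply: Sp_ext => -[|x w]; rewrite !arity_scaleE.
  by rewrite Sword_nil !scaler0.
by rewrite ss'.
Qed.

(** The filtration by arity, encoded as the fixed points of a truncation, so that its closure
    properties follow from linearity. *)
Definition arity_le n (c : Sp V) := arity_scale (fun m => (m <= n)%:R) c = c.

Lemma arity_le_word n w : (size w <= n)%N -> arity_le n (Sword w).
Proof. by move=> h; rewrite /arity_le arity_scaleE h scale1r. Qed.

Lemma arity_le_lin n (a : K) x y : arity_le n x -> arity_le n y -> arity_le n (a *: x +
  y).
Proof. by rewrite /arity_le linearP => -> ->. Qed.

Lemma arity_leD n x y : arity_le n x -> arity_le n y -> arity_le n (x + y).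
Proof. by rewrite /arity_le linearD => -> ->. Qed.
Lemma arity_leZ n (a : K) x : arity_le n x -> arity_le n (a *: x).
Proof. by rewrite /arity_le linearZ => ->. Qed.

Lemma arity_leS m n c : (m <= n)%N -> arity_le m c -> arity_le n c.
Proof.
move=> mn cm; rewrite /arity_le -cm arity_scaleM; apply: eq_arity_scale => k _.
by case: (leqP k m) => [km|_]; rewrite ?mulr0 // (leq_trans km mn) mulr1.
Qed.

Lemma eq_on_arity (U : lmodType K) (f f' : {linear Sp V -> U}) n c : arity_le n c ->
  (forall w, (size w <= n)%N -> f (Sword w) = f' (Sword w)) -> f c = f' c.
Proof.
move=> <- ff'.
pose A := arity_scale (fun m => (m <= n)%:R).
pose T : {linear Sp V -> U} := f \o A.
pose T' : {linear Sp V -> U} := f' \o A.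
rewrite -[LHS]/(T c) -[RHS]/(T' c); apply: Sp_ext => w.
rewrite /T /T' /= /A arity_scaleE !linearZ /=.
by case: leqP => wn; rewrite ?scale0r // ff'.
Qed.

End Arity.

Section Glue.
Variables (K : fieldType) (V : gradedSpace K) (U : lmodType K).
Variable phi : int -> V -> U.
Hypothesis phi_lin : forall k, linear (phi k).

Let phi0 k : phi k 0 = 0.
Proof. by have := phi_lin k (-1) 0 0; rewrite scaler0 addr0 scaleN1r addNr. Qed.

Let glue_sum (s : seq int) x := \sum_(k <- s) phi k (gproj V k x).

(** The finite support of [x] is only known to exist. Asking that every larger list give the same
    value makes that value canonical, and lets several vectors share one list in the proof of
    linearity. *)
Lemma glue_ex x : exists y, exists s : seq int, forall s', uniq s' -> {subset s <= s'} ->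
  y = glue_sum s' x.
Proof.
have [s us xE] := gproj_sum x.
exists (glue_sum s x), s => s' us' ss'.
rewrite /glue_sum [RHS](bigID (fun k => k \in s)) /= [X in _ = _ + X]big1 ?addr0;
  last first.
  move=> k ks; rewrite xE linear_sum big_seq big1 ?phi0 // => i si.
  by rewrite gprojM; case: eqP => // ki; rewrite ki si in ks.
rewrite -[RHS]big_filter; apply: perm_big; apply: uniq_perm => //.
  by rewrite filter_uniq.
by move=> k; rewrite mem_filter; case ks: (k \in s) => //=; rewrite ss'.
Qed.

Definition glue_fun of (forall k, linear (phi k)) := fun x => projT1 (cid (glue_ex x)).

Lemma glue_linear : linear (glue_fun phi_lin).
Proof.
move=> a x y; rewrite /glue_fun.
case: cid => z [s sP]; case: cid => zx [sx sxP]; case: cid => zy [sy syP] /=.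
pose t := undup (s ++ sx ++ sy).
have ut : uniq t by exact: undup_uniq.
rewrite (sP t) //; last by move=> k ks; rewrite mem_undup mem_cat ks.
rewrite (sxP t) //; last by move=> k ks; rewrite mem_undup !mem_cat ks orbT.
rewrite (syP t) //; last by move=> k ks; rewrite mem_undup !mem_cat ks !orbT.
rewrite /glue_sum scaler_sumr -big_split /=; apply: eq_bigr => k _.
by rewrite linearP phi_lin.
Qed.
HB.instance Definition _ :=
  GRing.isLinear.Build K V U _ (glue_fun phi_lin) glue_linear.

Definition glue : {linear V -> U} := glue_fun phi_lin.

Lemma glueE k x : homog k x -> glue x = phi k x.
Proof.
move=> kx; rewrite /glue /= /glue_fun; case: cid => z [s sP] /=.
rewrite (sP (undup (k :: s))) ?undup_uniq //; last first.
  by move=> i si; rewrite mem_undup inE si orbT.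
rewrite /glue_sum (bigD1_seq k) ?undup_uniq ?mem_undup ?mem_head //=.
rewrite (eqP kx) big1 ?addr0 // => i ik.
by rewrite -(eqP kx) gprojM (negbTE ik) phi0.
Qed.

End Glue.

Section HomogTheory.
Variables (K : fieldType) (V : gradedSpace K).

Lemma letter_eq (x y : letter V) : ldeg x = ldeg y -> lval x = lval y -> x = y.
Proof.
case: x y => [i x xi] [j y yj] /= ij; case: j / ij yj => yj xy.
by case: y / xy yj => yj; rewrite (bool_irrelevance xi yj).
Qed.

Lemma component_letter (x : letter V) : component (ldeg x) (lval x) = x.
Proof. by apply: letter_eq => //=; apply/eqP/lhomog. Qed.

Lemma homog0 k : homog k (0 : V).
Proof. by rewrite /homog linear0. Qed.
Lemma homogD k (x y : V) : homog k x -> homog k y -> homog k (x + y).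
Proof. by rewrite /homog linearD => /eqP -> /eqP ->. Qed.
Lemma homogZ k a (x : V) : homog k x -> homog k (a *: x).
Proof. by rewrite /homog linearZ /= => /eqP ->. Qed.
Lemma homogN k (x : V) : homog k x -> homog k (- x).
Proof. by rewrite /homog linearN /= => /eqP ->. Qed.
Lemma homogB k (x y : V) : homog k x -> homog k y -> homog k (x - y).
Proof. by move=> kx ky; apply/homogD/homogN. Qed.
Lemma homog_sum k (I : Type) (r : seq I) (F : I -> V) :
  (forall i, homog k (F i)) -> homog k (\sum_(i <- r) F i).
Proof. by move=> FP; elim/big_ind: _ => //; [apply: homog0 | apply: homogD]. Qed.

Lemma homog_ext (U : lmodType K) (f f' : {linear V -> U}) :
  (forall k x, homog k x -> f x = f' x) -> f =1 f'.
Proof.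
move=> ff' x; have [s _ xE] := gproj_sum x; rewrite xE !linear_sum.
by apply: eq_bigr => k _; apply: (ff' k); apply: gproj_homog.
Qed.

End HomogTheory.

Section Degrees.
Variables (K : fieldType) (V : gradedSpace K).

Lemma SsignE q (w : word V) : Ssign V q (Sword w) = (-1) ^ (q * wdeg w) *: Sword w.
Proof. exact: SliftE. Qed.

Lemma Sword_homog (w : word V) : homog (V := SpG V) (wdeg w) (Sword w).
Proof. by rewrite /homog /= Sp_projE eqxx. Qed.

Lemma has_degree_words (W : gradedSpace K) (p : int) (T : {linear Sp V -> W}) :
  (forall w, homog (wdeg w + p) (T (Sword w))) -> has_degree (V := SpG V) p T.
Proof.
move=> TP k x /eqP <-; rewrite -[gproj _ _ _]/(Sp_proj V k x).
elim/Sp_ind: x => [|x y IHx IHy|a x IHx|w].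
- by rewrite !linear0; apply: homog0.
- by rewrite !linearD; apply: homogD.
- by rewrite !lin_scale; apply: homogZ.
- by rewrite Sp_projE; case: eqP => [<-//|_]; rewrite linear0; apply: homog0.
Qed.

Lemma degree_word (W : gradedSpace K) (p : int) (T : Sp V -> W) w :
  has_degree (V := SpG V) p T -> homog (wdeg w + p) (T (Sword w)).
Proof. by apply; apply: Sword_homog. Qed.

Lemma Siota_linear k : linear (fun x : V => Sword [:: component k x]).
Proof.
move=> a x y.
apply: ((Sword_multisym V).1 [::] [::] (component k x) (component k y)) => //=.
exact: linearP.
Qed.

(** The inclusion of S^1; it has to be glued from the degrees, since the letters of a word are
    homogeneous. *)
Definition Siota : {linear V -> Sp V} := glue Siota_linear.

Lemma SiotaE (x : letter V) : Siota (lval x) = Sword [:: x].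
Proof. by rewrite /Siota (glueE _ (lhomog x)) component_letter. Qed.

End Degrees.

(** * Recovering a chain from its coproduct *)

Section Product.
Variables (K : numFieldType) (V : gradedSpace K).
Local Notation word := (word V).
Local Notation letter := (letter V).

Lemma gsym_move (U : lmodType K) (f : word -> U) a (x : letter) b : gsym f ->
  f (a ++ x :: b) = (-1) ^ (ldeg x * wdeg a) *: f (x :: a ++ b).
Proof.
elim: a f => [|y a IHa] f fs.
  by rewrite /wdeg big_nil mulr0 expr0z scale1r.
rewrite cat_cons (IHa (fun v => f (y :: v))); last by move=> u; apply: (fs (y :: u)).
rewrite (fs [::] _ y x) wdeg_cons scalerA; congr (_ *: _); sgz_cases K.
Qed.

(** Moving the letters of [a ++ b] back to their places in [w] cancels the Koszul sign of the
    splitting, so all [2 ^+ size w] splittings contribute [f w]. *)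
Lemma split_sum_cat (U : lmodType K) (f : word -> U) w : gsym f ->
  split_sum (fun a b => f (a ++ b)) w = 2 ^+ size w *: f w.
Proof.
elim: w f => [|x w IHw] f fs.
  by rewrite /split_sum big_seq1 /= expr0z.
rewrite split_sum_cons.
have fs' : gsym (fun v => f (x :: v)) by move=> u; apply: (fs (x :: u)).
under eq_split_sum => a b _ _.
  rewrite gsym_move // scalerA sgzz scale1r cat_cons -mulr2n -scaler_nat.
  over.
by rewrite split_sum_scale (IHw _ fs') scalerA /= exprS.
Qed.

Lemma split_sum_nill (U : lmodType K) (f : word -> U) w :
  split_sum (fun a b => (nilp a)%:R *: f b) w = f w.
Proof.
elim: w f => [|x w IHw] f; first by rewrite /split_sum big_seq1 /= expr0z !scale1r.
rewrite split_sum_cons -[RHS](IHw (fun v => f (x :: v))).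
apply: eq_split_sum => -[|y a] b _ _ /=; rewrite !scale0r ?scaler0 add0r //.
by rewrite /wdeg big_nil mulr0 expr0z scale1r.
Qed.

Lemma split_sum_nilr (U : lmodType K) (f : word -> U) w :
  split_sum (fun a b => (nilp b)%:R *: f a) w = f w.
Proof.
elim: w f => [|x w IHw] f; first by rewrite /split_sum big_seq1 /= expr0z !scale1r.
rewrite split_sum_cons -[RHS](IHw (fun v => f (x :: v))).
by apply: eq_split_sum => a b _ _ /=; rewrite !scale0r ?scaler0 addr0 //.
Qed.

(** Concatenation, made to vanish when a factor is empty: otherwise it would not descend to [Sp],
    where the empty word is 0. *)
Let mu_word (a b : word) : Sp V := (~~ nilp a)%:R *: ((~~ nilp b)%:R *: Sword (a ++ b)).

Lemma mu_word_nil b : mu_word [::] b = 0.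
Proof. by rewrite /mu_word /= scale0r. Qed.
Lemma mu_wordr_nil a : mu_word a [::] = 0.
Proof. by rewrite /mu_word /= scale0r scaler0. Qed.

Lemma mu_word_bimultisym : bimultisym mu_word.
Proof.
have [Sl Ss] := Sword_multisym V.
split=> [b|a].
- apply: (arity_scale_multisym (fun n => (n != 0)%:R)).
  apply: (multisym_scale (~~ nilp b)%:R).
  split=> [u v x y z k xy xz zE|u v x y]; rewrite -!catA; first exact: Sl.
  exact: Ss.
- apply: (multisym_scale (~~ nilp a)%:R).
  apply: (arity_scale_multisym (fun n => (n != 0)%:R)).
  split=> [u v x y z k xy xz zE|u v x y]; rewrite !catA; first exact: Sl.
  exact: Ss.
Qed.

Definition mu : {linear tens (Sp V) (Sp V) -> Sp V} :=
  Tlift mu_word_bimultisym mu_word_nil mu_wordr_nil.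

Lemma mu_delta c : mu (Sdelta V c) = arity_scale V (fun n => 2 ^+ n - 2) c.
Proof.
pose T : {linear Sp V -> Sp V} := mu \o Sdelta V.
rewrite -[LHS]/(T c); apply: Sp_ext => w.
rewrite arity_scaleE /T /= Tlift_delta.
have [wn|wn] := posnP (size w).
  by rewrite (size0nil wn) Sword_nil scaler0 /split_sum big_seq1 /= /mu_word scale0r
    scaler0.
have e a b : (size a + size b = size w)%N -> mu_word a b =
  (Sword (a ++ b) - (nilp a)%:R *: Sword b) - (nilp b)%:R *: Sword a.
  case: a => [|x a]; case: b => [|y b] /= sab;
    rewrite /mu_word /= ?(scale0r, scale1r, subr0, subrr, scaler0) //.
    by move: wn; rewrite -sab.
  by rewrite cats0 subrr.
transitivity (split_sum (fun a b : word => (Sword (a ++ b) - (nilp a)%:R *: Sword b) -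
  (nilp b)%:R *: Sword a) w).
  by apply: eq_split_sum => a b _; apply: e.
under eq_split_sum do rewrite -!scaleN1r.
rewrite !split_sumD !split_sum_scale split_sum_nill split_sum_nilr.
rewrite (split_sum_cat _ (Sword_multisym V).2) !scaleN1r -addrA -opprD scalerBl.
by rewrite scaler_nat mulr2n.
Qed.

(* [2 ^ n - 2] is the number of splittings of a word of length [n] into two
   nonempty subwords; it vanishes only for [n = 1], where [_^-1] gives 0. *)
Lemma mu_delta_inv c :
  arity_scale V (fun n => (2 ^+ n - 2)^-1) (mu (Sdelta V c)) =
  c - arity_scale V (fun n => (n <= 1)%:R) c.
Proof.
rewrite mu_delta arity_scaleM.
pose T : {linear Sp V -> Sp V} := idfun \- arity_scale V (fun n => (n <= 1)%:R).
rewrite -[RHS]/(T c); apply: Sp_ext => w; rewrite /T /= !arity_scaleE.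
case: w => [|x [|y w]] /=; first by rewrite Sword_nil !scaler0 subr0.
  by rewrite expr1 subrr mulr0 scale0r scale1r subrr.
rewrite scale0r subr0 mulVf ?scale1r // subr_eq0 gt_eqF //.
by rewrite -[ltLHS]expr1 ltr_eXn2l // ltr1n.
Qed.

(** Primitive elements lie in S^1: by [mu_delta_inv] the coproduct determines all the other
    components. *)
Lemma primitive_arity c : Sdelta V c = 0 -> arity_le 1 c.
Proof.
move=> c0; have := mu_delta_inv c; rewrite c0 !linear0 => /esym/eqP.
by rewrite subr_eq0 => /eqP /esym.
Qed.

Lemma arity_le_scale n s (c : Sp V) : arity_le n c -> arity_le n (arity_scale V s c).
Proof.
move=> <-; rewrite /arity_le !arity_scaleM; apply: eq_arity_scale => k _.
by case: leqP; rewrite ?mulr0 ?mulr1 ?mul1r ?mul0r.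
Qed.

Lemma arity_le_mu m n x y : arity_le m x -> arity_le n y -> arity_le (m + n) (mu (tprod
  x y)).
Proof.
move=> <- <-; elim/Sp_ind: x => [|x x' IHx IHx'|k x IHx|a].
- by rewrite linear0 tprod0l /arity_le !linear0.
- by rewrite linearD tprodDl linearD; apply: arity_leD.
- by rewrite lin_scale tprodZl lin_scale; apply: arity_leZ.
elim/Sp_ind: y => [|y y' IHy IHy'|k y IHy|b].
- by rewrite linear0 tprod0r /arity_le !linear0.
- by rewrite linearD tprodDr linearD; apply: arity_leD.
- by rewrite lin_scale tprodZr lin_scale; apply: arity_leZ.
rewrite !arity_scaleE !tprodZl !tprodZr !(lin_scale mu).
case: leqP => am; last by rewrite scale0r /arity_le linear0.
case: leqP => bn; last by rewrite scale0r scaler0 /arity_le linear0.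
apply/arity_leZ/arity_leZ; rewrite /mu TliftE; apply/arity_leZ/arity_leZ/arity_le_word.
by rewrite size_cat leq_add.
Qed.

End Product.

(** * Coalgebra maps: leading terms and uniqueness *)

Section CoalgebraMaps.
Variables (K : numFieldType) (V W : gradedSpace K).

Lemma tens_map_delta (U1 U2 : lmodType K) (A : {linear Sp V -> U1}) (B : {linear Sp V ->
  U2}) w :
  tens_map A B (Sdelta V (Sword w)) =
  split_sum (fun a b => tprod (A (Sword a)) (B (Sword b))) w.
Proof.
rewrite SdeltaE /Sdelta_word split_sum_lin; apply: eq_split_sum => a b _ _.
exact: tens_mapE.
Qed.

Definition coalg_map (A : {linear Sp V -> Sp W}) :=
  forall c, Sdelta W (A c) = tens_map A A (Sdelta V c).

Lemma split_sum_map (U : lmodType K) (eps : letter V -> letter W)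
    (f : word W -> word W -> U) w : (forall x, ldeg (eps x) = ldeg x) ->
  split_sum (fun a b => f (map eps a) (map eps b)) w = split_sum f (map eps w).
Proof.
move=> epsE; elim: w f => [|x w IHw] f; first by rewrite /split_sum !big_seq1.
rewrite /= !split_sum_cons -IHw; apply: eq_split_sum => a b _ _ /=; rewrite epsE.
by congr (_ + (-1) ^ (_ * _) *: _); rewrite /wdeg big_map; apply: eq_bigr.
Qed.

(** In the top arity a coalgebra map is the symmetric power of its linear part. The coproduct of the
    difference only involves proper subwords, where the induction hypothesis gives the bound;
    [mu_delta_inv] carries the bound back to the difference. *)
Lemma coalg_map_symbol (A : {linear Sp V -> Sp W}) (eps : letter V -> letter W) w :
  coalg_map A -> (forall x, ldeg (eps x) = ldeg x) ->
  (forall x, A (Sword [:: x]) = Sword [:: eps x]) ->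
  arity_le (size w).-1 (A (Sword w) - Sword (map eps w)).
Proof.
move=> AP epsE eps1.
have [n wn] := ubnP (size w); elim: n w wn => // n IHn [|x [|y w]] wn.
- by rewrite !Sword_nil linear0 subr0 /arity_le linear0.
- by rewrite eps1 subrr /arity_le linear0.
set u := [:: x, y & w] in wn *; set c := _ - _.
have cE : arity_le (size u).-1 (mu W (Sdelta W c)).
  rewrite /c linearB AP tens_map_delta [X in mu W (_ - X)]SdeltaE /Sdelta_word
    -(split_sum_map _ _ epsE).
  rewrite -scaleN1r -split_sum_scale -split_sumD split_sum_lin.
  apply: split_sum_closed => [|k x' y'|a b _ sab].
  - by rewrite /arity_le linear0.
  - exact: arity_le_lin.
  rewrite scaleN1r; set A1 := A _; set B1 := A _.
  have [a0|a0] := posnP (size a).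
    by rewrite /A1 (size0nil a0) /= !Sword_nil linear0 !tprod0l subr0 linear0 /arity_le
      linear0.
  have [b0|b0] := posnP (size b).
    by rewrite /B1 (size0nil b0) /= !Sword_nil linear0 !tprod0r subr0 linear0 /arity_le
      linear0.
  have an : (size a < n)%N by move: wn; rewrite ltnS -sab; apply: leq_trans;
    rewrite -addn1 leq_add2l.
  have bn : (size b < n)%N by move: wn; rewrite ltnS -sab; apply: leq_trans;
    rewrite -add1n leq_add2r.
  have IHa := IHn a an; have IHb := IHn b bn.
  have -> : tprod A1 B1 - tprod (Sword (map eps a)) (Sword (map eps b)) =
    tprod (A1 - Sword (map eps a)) B1 + tprod (Sword (map eps a)) (B1 - Sword (map eps
      b)).
    rewrite -!scaleN1r tprodDl tprodDr tprodZl tprodZr addrA.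
    by rewrite -[X in _ = X + _]addrA -[X in _ + (_ + X)]scale1r -scalerDl addNr scale0r
      addr0.
  rewrite linearD; apply: arity_leD.
  - have -> : (size u).-1 = ((size a).-1 + size b)%N by rewrite -sab -(prednK a0).
    apply: arity_le_mu => //.
    rewrite -(subrK (Sword (map eps b)) B1); apply: arity_leD.
      by apply: arity_leS IHb; apply: leq_pred.
    by apply: arity_le_word; rewrite size_map.
  - have -> : (size u).-1 = (size a + (size b).-1)%N by rewrite -sab -(prednK b0) addnS.
    apply: arity_le_mu => //.
    by apply: arity_le_word; rewrite size_map.
have := arity_le_scale (fun n => (2 ^+ n - 2)^-1) cE; rewrite mu_delta_inv => cE'.
(* The part not recovered by [mu_delta_inv] has arity at most 1, which is harmless since [u] has at
   least two letters. *)
rewrite -(subrK (arity_scale W (fun n => (n <= 1)%:R) c) c); apply: arity_leD => //.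
apply: (@arity_leS _ _ 1) => //.
by rewrite /arity_le arity_scaleM; apply: eq_arity_scale => -[|[|k]] _;
  rewrite ?mulr0 ?mulr1.
Qed.

Lemma coalg_map_arity (A : {linear Sp V -> Sp W}) (eps : letter V -> letter W) w :
  coalg_map A -> (forall x, ldeg (eps x) = ldeg x) ->
  (forall x, A (Sword [:: x]) = Sword [:: eps x]) ->
  arity_le (size w) (A (Sword w)).
Proof.
move=> AP epsE eps1; rewrite -(subrK (Sword (map eps w)) (A _)); apply: arity_leD.
  by apply: arity_leS (coalg_map_symbol w AP epsE eps1); apply: leq_pred.
by apply: arity_le_word; rewrite size_map.
Qed.

End CoalgebraMaps.

Section Uniqueness.
Variables (K : numFieldType) (V : gradedSpace K) (g : dgLie K).
Local Notation W := (shift g 1).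

Lemma arity1E (c : Sp W) : arity_le 1 c -> c = Siota W (CEproj g c).
Proof.
move=> c1; pose f : {linear Sp W -> Sp W} := idfun.
pose f' : {linear Sp W -> Sp W} := Siota W \o CEproj g.
apply: (eq_on_arity (f := f) (f' := f') c1) => -[|x [|y w]] // _.
  by rewrite Sword_nil !linear0.
by rewrite /f' /= /CEproj SliftE SiotaE.
Qed.

Lemma primitiveE (c : Sp W) : Sdelta W c = 0 -> c = Siota W (CEproj g c).
Proof. by move=> /primitive_arity; apply: arity1E. Qed.

(** Uniqueness half of cofreeness: once two coalgebra maps agree on shorter words, their difference
    on [w] is primitive, hence equal to its projection. *)
Lemma coalg_map_unique (A B : {linear Sp V -> Sp W}) : coalg_map A -> coalg_map B ->
  (forall c, CEproj g (A c) = CEproj g (B c)) -> A =1 B.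
Proof.
move=> AP BP AB; apply: Sp_ext => w.
have [n wn] := ubnP (size w); elim: n w wn => // n IHn w wn.
apply/eqP; rewrite -subr_eq0; apply/eqP.
rewrite [LHS]primitiveE ?linearB /= ?AB ?subrr ?linear0 //.
rewrite AP BP !tens_map_delta; apply/eqP; rewrite subr_eq0; apply/eqP.
apply: eq_split_sum => a b _ sab.
have [a0|a0] := posnP (size a).
  by rewrite (size0nil a0) Sword_nil !linear0 !tprod0l.
have [b0|b0] := posnP (size b).
  by rewrite (size0nil b0) Sword_nil !linear0 !tprod0r.
rewrite !IHn //.
- by move: wn; rewrite ltnS -sab; apply: leq_trans; rewrite -add1n leq_add2r.
- by move: wn; rewrite ltnS -sab; apply: leq_trans; rewrite -addn1 leq_add2l.
Qed.

End Uniqueness.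

(** * The convolution algebra *)

Section Bracket.
Variables (K : fieldType) (h : dgLie K).

Definition brl (y : h) := fun x : h => dgl_br x y.
Lemma brl_linear y : linear (brl y). Proof. exact: (dgl_br_bilin h).1. Qed.
HB.instance Definition _ y := GRing.isLinear.Build K h h _ (brl y) (brl_linear y).
Definition brr (x : h) := fun y : h => dgl_br x y.
Lemma brr_linear x : linear (brr x). Proof. exact: (dgl_br_bilin h).2. Qed.
HB.instance Definition _ x := GRing.isLinear.Build K h h _ (brr x) (brr_linear x).

Lemma dgl_brDl (x x' y : h) : dgl_br (x + x') y = dgl_br x y + dgl_br x' y.
Proof. exact: (linearD (brl y)). Qed.
Lemma dgl_brDr (x y y' : h) : dgl_br x (y + y') = dgl_br x y + dgl_br x y'.
Proof. exact: (linearD (brr x)). Qed.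
Lemma dgl_brZl k (x y : h) : dgl_br (k *: x) y = k *: dgl_br x y.
Proof. exact: (lin_scale (brl y)). Qed.
Lemma dgl_brZr k (x y : h) : dgl_br x (k *: y) = k *: dgl_br x y.
Proof. exact: (lin_scale (brr x)). Qed.
Lemma dgl_br0l (y : h) : dgl_br 0 y = 0.
Proof. exact: (linear0 (brl y)). Qed.
Lemma dgl_br0r (x : h) : dgl_br x 0 = 0.
Proof. exact: (linear0 (brr x)). Qed.
Lemma dgl_brBl (x x' y : h) : dgl_br (x - x') y = dgl_br x y - dgl_br x' y.
Proof. exact: (linearB (brl y)). Qed.
Lemma dgl_brBr (x y y' : h) : dgl_br x (y - y') = dgl_br x y - dgl_br x y'.
Proof. exact: (linearB (brr x)). Qed.
Lemma dgl_br_sumr (I : Type) (s : seq I) (F : I -> h) x :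
  dgl_br x (\sum_(i <- s) F i) = \sum_(i <- s) dgl_br x (F i).
Proof. exact: (linear_sum (brr x)). Qed.
Lemma dgl_br_suml (I : Type) (s : seq I) (F : I -> h) y :
  dgl_br (\sum_(i <- s) F i) y = \sum_(i <- s) dgl_br (F i) y.
Proof. exact: (linear_sum (brl y)). Qed.
Lemma dgl_br_splitl (V : gradedSpace K) (f : word V -> word V -> h) (w : word V) y :
  dgl_br (split_sum f w) y = split_sum (fun a b => dgl_br (f a b) y) w.
Proof. exact: (split_sum_lin (brl y)). Qed.
Lemma dgl_br_splitr (V : gradedSpace K) (f : word V -> word V -> h) (w : word V) x :
  dgl_br x (split_sum f w) = split_sum (fun a b => dgl_br x (f a b)) w.
Proof. exact: (split_sum_lin (brr x)). Qed.
Lemma dgl_br_wsuml (g : dgLie K) (f : word (shift g 1) -> h) (s : seq (int * word (shift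
  g 1))) y :
  dgl_br (wsum f s) y = wsum (fun u => dgl_br (f u) y) s.
Proof. exact: (wsum_lin (brl y)). Qed.
Lemma dgl_br_wsumr (g : dgLie K) (f : word (shift g 1) -> h) (s : seq (int * word (shift
  g 1))) x :
  dgl_br x (wsum f s) = wsum (fun u => dgl_br x (f u)) s.
Proof. exact: (wsum_lin (brr x)). Qed.
End Bracket.

Section Convolution.
Variables (K : fieldType) (V : gradedSpace K) (h : dgLie K).
Local Notation word := (word V).
Implicit Types (f : word -> h).

(** The bracket of the convolution algebra for functions on words, where no tensor product
    intervenes; as in [conv_br], [q] is the degree of the second argument. *)
Definition wbr (q : int) f f' : word -> h :=
  split_sum (fun a b => (-1) ^ (q * wdeg a) *: dgl_br (f a) (f' b)).

Definition wdegree (p : int) f := forall w, homog (wdeg w + p) (f w).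

Lemma wbr_degree p q f f' : wdegree p f -> wdegree q f' -> wdegree (p + q) (wbr q f f').
Proof.
move=> fp fq w; apply: (@split_sum_closed _ _ _ (homog (wdeg w + (p + q)))).
- exact: homog0.
- by move=> c x y hx hy; apply: homogD => //; apply: homogZ.
- by move=> a b <- _; apply: homogZ; rewrite addrACA; apply: dgl_br_degree.
Qed.

Lemma wbr_antisym p q f f' w : wdegree p f -> wdegree q f' ->
  wbr q f f' w = - ((-1) ^ (p * q) *: wbr p f' f w).
Proof.
move=> fp fq; rewrite /wbr split_sumC -scaleN1r scalerA -split_sum_scale.
apply: eq_split_sum => a b _ _.
rewrite (dgl_antisym (fp b) (fq a)) -scaleN1r !scalerA; congr (_ *: _).
sgz_cases K.
Qed.

Lemma split_sum_swap3 (U : lmodType K) (f : word -> word -> word -> U) w :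
  split_sum (fun a bc => split_sum (f a) bc) w =
  split_sum (fun a bc => split_sum (fun b c => (-1) ^ (wdeg a * wdeg b) *: f b a c) bc) w.
Proof.
rewrite !split_sumA; apply: eq_split_sum => ab c _ _.
exact: split_sumC.
Qed.

(** The Jacobi identity of [h] on each splitting into three parts: coassociativity regroups the
    first term, and cocommutativity exchanges the first two parts in the second. *)
Lemma wbr_jacobi p q r f f' f'' w : wdegree p f -> wdegree q f' -> wdegree r f'' ->
  wbr (q + r) f (wbr r f' f'') w =
  wbr r (wbr q f f') f'' w + (-1) ^ (p * q) *: wbr (p + r) f' (wbr r f f'') w.
Proof.
move=> fp fq fr; rewrite /wbr.
under eq_split_sum => a bc _ _.
  rewrite dgl_br_splitr -split_sum_scale.
  under eq_split_sum => b c _ _ do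
    rewrite dgl_brZr (dgl_jacobi (fp a) (fq b) (fr c)) scalerA scalerDr.
  rewrite split_sumD.
  over.
rewrite split_sumD; congr (_ + _).
  rewrite split_sumA; apply: eq_split_sum => ab c _ _.
  rewrite dgl_br_splitl -split_sum_scale.
  apply: eq_split_sum => a b <- _; rewrite dgl_brZl scalerA; congr (_ *: _).
  sgz_cases K.
rewrite split_sum_swap3 -split_sum_scale; apply: eq_split_sum => a bc _ _.
rewrite dgl_br_splitr -!split_sum_scale.
apply: eq_split_sum => b c _ _; rewrite dgl_brZr !scalerA; congr (_ *: _).
sgz_cases K.
Qed.

Lemma wbr_sumr (I : Type) (s : seq I) q f (F : I -> word -> h) w :
  wbr q f (fun b => \sum_(i <- s) F i b) w = \sum_(i <- s) wbr q f (F i) w.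
Proof.
rewrite /wbr -split_sum_sum; apply: eq_split_sum => a b _ _.
by rewrite dgl_br_sumr scaler_sumr.
Qed.

Lemma wbr_suml (I : Type) (s : seq I) q f (F : I -> word -> h) w :
  wbr q (fun b => \sum_(i <- s) F i b) f w = \sum_(i <- s) wbr q (F i) f w.
Proof.
rewrite /wbr -split_sum_sum; apply: eq_split_sum => a b _ _.
by rewrite dgl_br_suml scaler_sumr.
Qed.

Lemma wbrDr q f f1 f2 w : wbr q f (fun b => f1 b + f2 b) w = wbr q f f1 w + wbr q f f2 w.
Proof.
by rewrite /wbr -split_sumD; apply: eq_split_sum => a b _ _; rewrite dgl_brDr scalerDr.
Qed.

Lemma wbrDl q f f1 f2 w : wbr q (fun b => f1 b + f2 b) f w = wbr q f1 f w + wbr q f2 f w.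
Proof.
by rewrite /wbr -split_sumD; apply: eq_split_sum => a b _ _; rewrite dgl_brDl scalerDr.
Qed.

Lemma wbrZr q k f f1 w : wbr q f (fun b => k *: f1 b) w = k *: wbr q f f1 w.
Proof.
by rewrite /wbr -split_sum_scale; apply: eq_split_sum => a b _ _;
  rewrite dgl_brZr !scalerA mulrC.
Qed.

Lemma wbrZl q k f f1 w : wbr q (fun b => k *: f1 b) f w = k *: wbr q f1 f w.
Proof.
by rewrite /wbr -split_sum_scale; apply: eq_split_sum => a b _ _;
  rewrite dgl_brZl !scalerA mulrC.
Qed.

(** In a proper splitting both parts are strictly shorter, so a bracket in arity [n] only sees its
    arguments in arities below [n]. This locality is what makes corrections in one arity linear. *)
Lemma eq_wbr q f1 f1' f2 f2' n w :
  f1 [::] = 0 -> f1' [::] = 0 -> f2 [::] = 0 -> f2' [::] = 0 ->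
  (forall u, (size u < n)%N -> f1 u = f1' u) ->
  (forall u, (size u < n)%N -> f2 u = f2' u) -> (size w <= n)%N ->
  wbr q f1 f2 w = wbr q f1' f2' w.
Proof.
move=> n1 n1' n2 n2' e1 e2 wn; apply: eq_split_sum => a b _ sab.
have [a0|a0] := posnP (size a).
  by rewrite (size0nil a0) n1 n1' !dgl_br0l.
have [b0|b0] := posnP (size b).
  by rewrite (size0nil b0) n2 n2' !dgl_br0r.
rewrite e1 ?e2 //; apply: leq_trans wn; rewrite -sab.
  by rewrite -[X in (X < _)%N]add0n ltn_add2r.
by rewrite -[X in (X < _)%N]addn0 ltn_add2l.
Qed.

Lemma wbr0 q f1 f2 n w : f1 [::] = 0 -> f2 [::] = 0 ->
  (forall u, (size u < n)%N -> f1 u = 0) -> (size w <= n)%N -> wbr q f1 f2 w = 0.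
Proof.
move=> n1 n2 f10 wn.
rewrite (@eq_wbr q f1 (fun=> 0) f2 f2 n w) //.
by rewrite /wbr /split_sum big1 // => p _; rewrite dgl_br0l !scaler0.
Qed.

End Convolution.

Section Differential.
Variables (K : fieldType) (g h : dgLie K).
Local Notation V := (shift g 1).
Local Notation word := (word V).
Implicit Types (f : word -> h).

Definition wdiff (p : int) f : word -> h :=
  fun w => dgl_d h (f w) - (-1) ^ p *: wsum f (d_terms w).

Lemma wdiff_leibniz p q f f' w : wdegree p f -> wdegree q f' ->
  wdiff (p + q) (wbr q f f') w =
  wbr q (wdiff p f) f' w + (-1) ^ p *: wbr (q + 1) f (wdiff q f') w.
Proof.
move=> fp fq; rewrite /wdiff {1 2}/wbr split_sum_lin split_sum_d.
rewrite /wbr -scaleNr -!split_sum_scale -!split_sumD; apply: eq_split_sum => a b _ _.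
have e1 : wsum (fun u => (-1) ^ (q * wdeg u) *: dgl_br (f u) (f' b)) (d_terms a) =
    (-1) ^ (q * (1 + wdeg a)) *: dgl_br (wsum f (d_terms a)) (f' b).
  by rewrite dgl_br_wsuml -wsum_scale; apply: eq_wsum_d => u -> _.
rewrite e1 wsum_scale -dgl_br_wsumr lin_scale (dgl_leibniz _ (fp a)).
rewrite dgl_brBl dgl_brBr !dgl_brZl !dgl_brZr.
rewrite !scalerDr !scalerN !scalerA -!scaleNr !addrA [LHS](ACl (1*3*2*4)) /=.
congr (_ *: _ + _ *: _ + _ *: _ + _ *: _); sgz_cases K.
Qed.

Lemma eq_wdiff p f f' n w : (forall u, (size u <= n)%N -> f u = f' u) -> (size w <= n)%N
  ->
  wdiff p f w = wdiff p f' w.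
Proof.
move=> ff' wn; rewrite /wdiff ff' //; congr (_ - _ *: _).
by apply: eq_wsum_d => u _ /andP[uw _]; apply/ff'/(leq_trans uw).
Qed.

End Differential.

Section ConvolutionMaps.
Variables (K : numFieldType) (g h : dgLie K).
Local Notation V := (shift g 1).
Implicit Types (t : {linear CEp g -> h}).

Definition onw (U : Type) (t : CEp g -> U) : word V -> U := fun w => t (Sword w).

Lemma tens_map_CEdelta (U1 U2 : lmodType K) (A : {linear CEp g -> U1})
    (B : {linear CEp g -> U2}) w :
  tens_map A B (CEdelta g (Sword w)) =
  split_sum (fun a b => tprod (A (Sword a)) (B (Sword b))) w.
Proof. exact: tens_map_delta. Qed.

(** [conv_br], and next [conv_diff], bundled as linear maps; they stay convertible to the
    originals. *)
Definition cbr q t1 t2 : {linear CEp g -> h} :=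
  lie_tens h \o (tens_map (t1 \o Ssign V q) t2 \o CEdelta g).

Definition cdiff p t : {linear CEp g -> h} :=
  (dgl_d h \o t) \- ((-1) ^ p \*: (t \o CEd g)).

Lemma cbr_word q t1 t2 w : cbr q t1 t2 (Sword w) = wbr q (onw t1) (onw t2) w.
Proof.
rewrite -[LHS]/(lie_tens h (tens_map _ _ (CEdelta g (Sword w)))) tens_map_CEdelta
  split_sum_lin; apply: eq_split_sum => a b _ _ /=.
by rewrite /lie_tens tens_liftE /= /Ssign SliftE lin_scale dgl_brZl.
Qed.

Lemma CEd_word w : CEd g (Sword w) = wsum (@Sword K V) (d_terms w).
Proof. exact: SliftE. Qed.

Lemma cdiff_word p t w : cdiff p t (Sword w) = wdiff p (onw t) w.
Proof. by rewrite /cdiff /= CEd_word wsum_lin. Qed.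

Lemma has_degree_onw p t : has_degree p t -> wdegree p (onw t).
Proof. by move=> tp w; apply: degree_word. Qed.

Lemma onw_nil (U : lmodType K) (t : {linear CEp g -> U}) : onw t [::] = 0.
Proof. by rewrite /onw Sword_nil linear0. Qed.

Definition tens_d : {linear tens (CEp g) (CEp g) -> tens (CEp g) (CEp g)} :=
  tens_map (CEd g) idfun \+ tens_map (Ssign V 1) (CEd g).

Lemma tens_d_tprod x y :
  tens_d (tprod x y) = tprod (CEd g x) y + tprod (Ssign V 1 x) (CEd g y).
Proof.
rewrite -[LHS]/(tens_map (CEd g) idfun (tprod x y) +
  tens_map (Ssign V 1) (CEd g) (tprod x y)).
by rewrite !tens_mapE.
Qed.

Lemma tens_dE w1 y : tens_d (tprod (Sword w1) y) =
  tprod (CEd g (Sword w1)) y + (-1) ^ wdeg w1 *: tprod (Sword w1) (CEd g y).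
Proof. by rewrite tens_d_tprod SsignE mul1r tprodZl. Qed.

Lemma CEdelta_d c : CEdelta g (CEd g c) = tens_d (CEdelta g c).
Proof.
pose T : {linear CEp g -> tens (CEp g) (CEp g)} := CEdelta g \o CEd g.
pose T' : {linear CEp g -> tens (CEp g) (CEp g)} := tens_d \o CEdelta g.
rewrite -[LHS]/(T c) -[RHS]/(T' c); apply: Sp_ext => w.
rewrite -[LHS]/(CEdelta g (CEd g (Sword w))) -[RHS]/(tens_d (CEdelta g (Sword w))).
rewrite CEd_word wsum_lin.
transitivity (split_sum (fun a b => tens_d (tprod (Sword a) (Sword b))) w); last first.
  by rewrite -[RHS]/(tens_d (Sdelta V (Sword w))) SdeltaE /Sdelta_word split_sum_lin.
transitivity (wsum (split_sum (fun a b => tprod (@Sword K V a) (@Sword K V b))) (d_terms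
  w)).
  by apply: eq_wsum_d => u _ _; rewrite -[LHS]/(Sdelta V (Sword u)) SdeltaE.
rewrite split_sum_d; apply: eq_split_sum => a b _ _.
rewrite tens_dE !CEd_word; congr (_ + _ *: _).
  by rewrite -[RHS]/(tprodl (Sword b) (wsum _ _)) wsum_lin.
by rewrite -[RHS]/(tprodr (Sword a) (wsum _ _)) wsum_lin.
Qed.

End ConvolutionMaps.

(** * The projection as a Maurer-Cartan element, and the square of the differential *)

Section MaurerCartan.
Variables (K : numFieldType) (g : dgLie K).
Local Notation V := (shift g 1).

Lemma CEproj_word (w : word V) : CEproj g (Sword w) = single_letter w.
Proof. exact: SliftE. Qed.

Lemma CEproj_degree : has_degree 1 (CEproj g).
Proof.
apply: has_degree_words => -[|x [|y w]]; rewrite CEproj_word /=; try exact: homog0.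
by have := lhomog x; rewrite /homog /= wdeg_cons /wdeg big_nil addr0 addrC.
Qed.

Lemma single_letter_big (w : word V) : size w != 1 -> single_letter w = 0.
Proof. by case: w => [|x [|y w]]. Qed.

Lemma wsum_single_big (w : word V) : (2 < size w)%N -> wsum (@single_letter K g)
  (d_terms w) = 0.
Proof.
move=> w2; rewrite -(wsum0 g (d_terms w)); apply: eq_wsum_d => u _ /andP[_ uw].
by apply: single_letter_big; rewrite gtn_eqF // -ltnS (leq_trans w2).
Qed.

(** [CEproj] is the Taylor map of the identity. Its equation expresses the definition of [CEd] in
    arities 1 and 2; in higher arity no term has a single letter left, and no splitting has two
    parts of one letter. *)
Lemma CEproj_MC c : cdiff 1 (CEproj g) c + 2^-1 *: cbr 1 (CEproj g) (CEproj g) c = 0.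
Proof.
pose T : {linear CEp g -> g} := cdiff 1 (CEproj g) \+ (2^-1 \*: cbr 1 (CEproj g) (CEproj
  g)).
pose Z : {linear CEp g -> g} := \0.
rewrite -[LHS]/(T c) -[RHS]/(Z c); apply: Sp_ext => w.
rewrite -[RHS]/(0 : g) -[LHS]/(cdiff 1 (CEproj g) (Sword w) + 2^-1 *: cbr 1 (CEproj g)
  (CEproj g) (Sword w)).
rewrite cdiff_word cbr_word.
have -> : onw (CEproj g) = @single_letter K g by apply/funext => u; apply: CEproj_word.
rewrite /wdiff.
have [w2|] := ltnP 2 (size w).
  rewrite wsum_single_big // scaler0 subr0 single_letter_big ?gtn_eqF //;
    last exact: ltnW.
  rewrite linear0 add0r /wbr.
  rewrite [X in _ *: X](_ : _ = 0) ?scaler0 //.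
  rewrite -[RHS](split_sum0 g w); apply: eq_split_sum => a b _ sab.
  have [a1|] := eqVneq (size a) 1; last by move/single_letter_big=> ->;
    rewrite dgl_br0l scaler0.
  rewrite (@single_letter_big b) ?dgl_br0r ?scaler0 // gtn_eqF //.
  by move: w2; rewrite -sab a1.
case: w => [|x [|y []]] // _.
- by rewrite /wsum /wbr /split_sum big_nil big_seq1 /= linear0 dgl_br0l !scaler0 subrr
  addr0.
- rewrite d_sum_cons /wsum !big_nil scaler0 !addr0 /= expr1z scaleN1r opprK subrr add0r.
  rewrite /wbr !split_sum_cons /split_sum big_seq1 /= dgl_br0r dgl_br0l.
  by rewrite !scaler0 addr0 !scaler0.
rewrite !d_sum_cons !ad_sum_cons /wsum !big_nil /= linear0 sub0r oppr0 !scaler0 !addr0.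
rewrite add0r /wbr !split_sum_cons /split_sum big_seq1 /= !dgl_br0r ?dgl_br0l !scaler0
  !addr0 !add0r.
have hx := lhomog x; have hy := lhomog y.
(* By antisymmetry the two splittings of a word of two letters contribute equally, which absorbs the
   factor [2^-1]. *)
rewrite (dgl_antisym hy hx) !wdeg_cons /wdeg !big_nil !expr0z !mulr0 !expr0z !scale1r.
rewrite !addr0 !mul1r !scalerN !scalerA -!scaleNr -scalerDl scalerA -scalerDl.
set s := _ + _; rewrite (_ : s = - (-1) ^ ldeg x + 2^-1 * ((-1) ^ ldeg x + (-1) ^ ldeg
  x)).
  move: ((-1) ^ ldeg x) => u; have -> : u + u = 2 * u by rewrite mulr_natl mulr2n.
  by rewrite mulKf ?addNr ?scale0r // pnatr_eq0.
rewrite /s; congr (_ + _ * (_ + _)).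
- sgz_cases K.
- sgz_cases K.
Qed.

Lemma CEproj_CEd c :
  CEproj g (CEd g c) = - dgl_d g (CEproj g c) - 2^-1 *: cbr 1 (CEproj g) (CEproj g) c.
Proof.
have /eqP := CEproj_MC c.
rewrite -[cdiff 1 _ c]/(dgl_d g (CEproj g c) - (-1) ^ 1 *: CEproj g (CEd g c)).
rewrite expr1z scaleN1r opprK (addrC (dgl_d g _)) -addrA addr_eq0 => /eqP ->.
by rewrite opprD.
Qed.

(* The Jacobi identity and antisymmetry give [X = - 2 X]. *)
Lemma wbr_cube (V' : gradedSpace K) (f : word V' -> g) w : wdegree 1 f ->
  wbr (1 + 1) f (wbr 1 f f) w = 0.
Proof.
move=> f1; have := wbr_jacobi w f1 f1 f1.
rewrite (wbr_antisym w (wbr_degree f1 f1) f1) !mulr1 sgzD expr1z mulrNN mulr1 scale1r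
  scaleN1r.
set X := wbr _ _ _ _ => /eqP; rewrite -subr_eq0 opprD !opprK -mulr2n -mulrS -scaler_nat.
by rewrite scaler_eq0 pnatr_eq0 /= => /eqP.
Qed.

Lemma single_letterE : @single_letter K g = onw (CEproj g).
Proof. by apply/funext => w; rewrite /onw CEproj_word. Qed.

Lemma wbr_wsum (q : int) (f f' : word V -> g) w :
  wsum (wbr q f f') (d_terms w) =
  wbr q (fun a => (-1) ^ q *: wsum f (d_terms a)) f' w +
  wbr (q + 1) f (fun b => wsum f' (d_terms b)) w.
Proof.
rewrite /wbr split_sum_d -split_sumD; apply: eq_split_sum => a b _ _.
rewrite wsum_scale -dgl_br_wsumr scalerA dgl_brZl scalerA -!sgzD.
rewrite (_ : wsum _ _ = (-1) ^ (q * (1 + wdeg a)) *: dgl_br (wsum f (d_terms a)) (f' b)).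
  by congr (_ *: _ + _ *: _); congr (_ ^ _);
    rewrite ?mulrDl ?mulrDr ?mul1r ?mulr1 // addrC.
by rewrite dgl_br_wsuml -wsum_scale; apply: eq_wsum_d => u -> _.
Qed.

(** Two uses of [CEproj_CEd] give terms sorted by their number of brackets: those with none vanish
    because [dgl_d] squares to zero, those with one cancel by the Leibniz rule, and those with two
    vanish by [wbr_cube]. *)
Lemma CEproj_CEd_CEd w : CEproj g (CEd g (CEd g (Sword w))) = 0.
Proof.
set p := @single_letter K g.
have p1 : wdegree 1 p by rewrite /p single_letterE; apply/has_degree_onw/CEproj_degree.
pose q w := wsum p (d_terms w).
have qE u : q u = - dgl_d g (p u) - 2^-1 *: wbr 1 p p u.
  have := CEproj_CEd (Sword u); rewrite CEproj_word cbr_word -single_letterE => <-.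
  by rewrite CEd_word wsum_lin; apply: eq_wsum_d => v _ _; rewrite CEproj_word.
have -> : CEproj g (CEd g (CEd g (Sword w))) = wsum q (d_terms w).
  rewrite CEd_word !wsum_lin; apply: eq_wsum_d => u _ _.
  by rewrite CEd_word wsum_lin; apply: eq_wsum_d => v _ _; rewrite CEproj_word.
have -> : q = fun u => (- 1) *: dgl_d g (p u) + - 2^-1 *: wbr 1 p p u.
  by apply/funext => u; rewrite qE scaleN1r scaleNr.
rewrite wsumD !wsum_scale -wsum_lin wbr_wsum -/(q w).
have -> : (fun b => wsum p (d_terms b)) = fun u => (- 1) *: dgl_d g (p u) + - 2^-1 *:
  wbr 1 p p u.
  by apply/funext => u; rewrite -/(q u) qE scaleN1r scaleNr.
have -> : (fun a => (-1) ^ 1 *: wsum p (d_terms a)) = (fun a => dgl_d g (p a) + 2^-1 *: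
  wbr 1 p p a).
  by apply/funext => a; rewrite -/(q a) qE expr1z scaleN1r opprD !opprK.
rewrite qE.
rewrite wbrDl wbrDr wbrZl !wbrZr wbr_cube // (wbr_antisym w (wbr_degree p1 p1) p1).
rewrite wbr_cube //.
rewrite !scaler0 oppr0 scaler0 !addr0 linearB linearN /= lin_scale dgl_dd oppr0 sub0r.
rewrite scaleN1r opprK scaleNr; apply/eqP; rewrite subr_eq0; apply/eqP; congr (_ *: _).
rewrite /wbr split_sum_lin -split_sum_scale -split_sumD; apply: eq_split_sum => a b _ _.
rewrite lin_scale (dgl_leibniz _ (p1 a)) scalerDr !scalerA; congr (_ *: _ + _ *: _);
  sgz_cases K.
Qed.

(** The square of an odd coderivation is a coderivation: if it vanishes on shorter words, its value
    on [w] is primitive, and the projection of that value is known to be 0. *)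
Lemma CEd_CEd c : CEd g (CEd g c) = 0.
Proof.
pose T : {linear CEp g -> CEp g} := CEd g \o CEd g.
pose Z : {linear CEp g -> CEp g} := \0.
rewrite -[LHS]/(T c) -[RHS]/(Z c); apply: Sp_ext => w;
  rewrite -[LHS]/(CEd g (CEd g (Sword w))) -[RHS]/(0 : CEp g).
have [n wn] := ubnP (size w); elim: n w wn => // n IHn w wn.
have primE (x : CEp g) : CEdelta g x = 0 -> CEproj g x = 0 -> x = 0.
  by move=> x0 px; rewrite [x](primitiveE x0) px linear0.
apply: primE; last exact: CEproj_CEd_CEd.
rewrite !CEdelta_d -[CEdelta g (Sword w)]/(Sdelta V (Sword w)) SdeltaE /Sdelta_word
  !split_sum_lin.
rewrite -[RHS](split_sum0 _ w); apply: eq_split_sum => a b _ sab.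
have dd0 (u v : word V) : (size u + size v = size w)%N -> (0 < size v)%N -> CEd g (CEd g
  (Sword u)) = 0.
  move=> uv v0; apply: IHn; move: wn; rewrite ltnS -uv; apply: leq_trans.
  by rewrite -[X in (X < _)%N]addn0 ltn_add2l.
have [a0|a0] := posnP (size a).
  by rewrite (size0nil a0) Sword_nil tprod0l !linear0.
have [b0|b0] := posnP (size b).
  by rewrite (size0nil b0) Sword_nil tprod0r !linear0.
have ba : (size b + size a = size w)%N by rewrite addnC.
rewrite tens_dE linearD lin_scale tens_dE (dd0 b a ba a0) tprod0r scaler0 addr0.
rewrite tens_d_tprod.
rewrite (dd0 a b) // tprod0l add0r.
(* The differential raises the degree by 1, so the two cross terms have opposite signs. *)
have -> : Ssign V 1 (CEd g (Sword a)) = (-1) ^ (wdeg a + 1) *: CEd g (Sword a).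
  rewrite CEd_word wsum_lin -wsum_scale; apply: eq_wsum_d => u du _.
  by rewrite SsignE mul1r du addrC.
by rewrite tprodZl -scalerDl sgzD expr1z mulrN1 addNr scale0r.
Qed.

End MaurerCartan.

(** * The coalgebra map with a given corestriction *)

Lemma sum_triangle (U : zmodType) (G : nat -> nat -> U) N :
  (forall i j, (N <= i + j)%N -> G i j = 0) ->
  \sum_(n < N) \sum_(i < n.+1) G i (n - i)%N = \sum_(i < N) \sum_(j < N) G i j.
Proof.
move=> G0.
transitivity (\sum_(n < N) \sum_(i < N | (i <= n)%N) G i (n - i)%N).
  apply: eq_bigr => n _.
  by rewrite (big_ord_widen_cond N xpredT (fun i => G i (n - i)%N)).
rewrite (exchange_big_dep xpredT) //=; apply: eq_bigr => i _.
rewrite -(big_mkord (fun n => (i <= n)%N) (fun n => G i (n - i)%N)).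
rewrite -(big_mkord xpredT (G i)) (@big_cat_nat _ _ _ i) ?(ltnW (ltn_ord i)) //=.
rewrite big_nat_cond big1 ?add0r; last by move=> n /andP[/andP[_ ni] /(leq_trans ni)];
  rewrite ltnn.
rewrite -{1}[X in \sum_(X <= _ < _ | _) _]add0n big_addn.
have z : \sum_(N - i <= j < N) G i j = 0.
  by rewrite big_nat big1 // => n /andP[ni _]; apply: G0; rewrite -leq_subLR.
rewrite [RHS](@big_cat_nat _ _ _ (N - i)) ?leq_subr //= z addr0.
rewrite big_mkcond big_nat [RHS]big_nat; apply: eq_bigr => n _.
by rewrite leq_addl addnK.
Qed.

Section ExpCoalg.
Variables (K : numFieldType) (V W : gradedSpace K).
Variable f : {linear Sp V -> W}.
Hypothesis fdeg : forall w, homog (wdeg w) (f (Sword w)).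

Definition fletter (w : word V) : letter W := Letter (fdeg w).

Section Powers.
Variable U : lmodType K.
Implicit Types (k : word W -> U) (w : word V).

(* [pw n k w] sums [k [:: f a1; ...; f an]] over the ordered splittings of [w] into
   [n] subwords [a1, ..., an]. *)
Fixpoint pw n k w : U :=
  if n is n'.+1 then split_sum (fun a b => pw n' (fun u => k (fletter a :: u)) b) w
  else (nilp w)%:R *: k [::].

Lemma pwP n c k1 k2 k w : (forall u, k u = c *: k1 u + k2 u) ->
  pw n k w = c *: pw n k1 w + pw n k2 w.
Proof.
elim: n k1 k2 k w => [|n IHn] k1 k2 k w kE /=.
  by rewrite kE scalerDr !scalerA mulrC.
by apply: split_sumP => a b; apply: IHn.
Qed.

Lemma pw0 n w : pw n (fun=> 0) w = 0.
Proof.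
by rewrite (@pwP n (-1) (fun=> 0) (fun=> 0)) ?scaleN1r ?addNr // => _;
  rewrite scaler0 addr0.
Qed.

Lemma pwD n k1 k2 w : pw n (fun u => k1 u + k2 u) w = pw n k1 w + pw n k2 w.
Proof. by rewrite (@pwP n 1 k1 k2) ?scale1r // => u; rewrite scale1r. Qed.

Lemma pw_scale n c k w : pw n (fun u => c *: k u) w = c *: pw n k w.
Proof. by rewrite (@pwP n c k (fun=> 0)) ?pw0 ?addr0 // => u; rewrite addr0. Qed.

Lemma eq_pw n k k' w : (forall u, wdeg u = wdeg w -> size u = n -> k u = k' u) ->
  pw n k w = pw n k' w.
Proof.
elim: n k k' w => [|n IHn] k k' w kk' /=.
  case: w kk' => [|x w] kk' /=; last by rewrite !scale0r.
  by rewrite kk' // /wdeg !big_nil.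
apply: eq_split_sum => a b dab _; apply: IHn => u du su; apply: kk'.
  by rewrite wdeg_cons -dab du.
by rewrite /= su.
Qed.

Lemma pw_split (V' : gradedSpace K) n (F : word W -> word V' -> word V' -> U) (w' : word
  V') w :
  pw n (fun u => split_sum (F u) w') w =
  split_sum (fun b c => pw n (fun u => F u b c) w) w'.
Proof.
elim: n F w => [|n IHn] F w /=.
  by rewrite -split_sum_scale.
under eq_split_sum => a b _ _ do rewrite IHn.
rewrite /split_sum; under eq_bigr do rewrite scaler_sumr.
rewrite exchange_big; apply: eq_bigr => p _; rewrite scaler_sumr.
by apply: eq_bigr => q _; rewrite !scalerA mulrC.
Qed.

Lemma pw_multisym n k : multisym k -> multisym (pw n k).
Proof.
elim: n k => [|n IHn] k kP /=.
  have nn (u v : word V) x : nilp (u ++ x :: v) = false by case: u.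
  by split=> [u v x y z c _ _ _|u v x y]; rewrite !nn !scale0r ?scaler0 ?addr0.
apply: split_sum_multisym; split=> [b|a]; last exact/IHn/multisym_cons.
have [Sl Ss] := Sword_multisym V.
split=> [u v x y z c xy xz zE|u v x y].
- apply: pwP => t; apply: (kP.1 [::]); rewrite /= ?wdeg_cat ?wdeg_cons ?xy ?xz //.
  by rewrite (Sl u v x y z c) // linearP.
- rewrite -pw_scale; apply: eq_pw => t _ _.
  apply: (multilin_scale [::] t kP.1) => /=.
    by rewrite !wdeg_cat !wdeg_cons (addrCA (ldeg x)).
  by rewrite Ss lin_scale.
Qed.

(** With more parts than letters some part is empty, and the letter made from it has value 0. *)
Lemma pw_big n k w : multilin k -> (size w < n)%N -> pw n k w = 0.
Proof.
elim: n k w => // n IHn k w kl wn /=.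
rewrite -(split_sum0 U w); apply: eq_split_sum => -[|x a] b _ sab.
  rewrite -(pw0 n b); apply: eq_pw => u _ _.
  rewrite (multilin_scale [::] u kl (x := fletter [::]) (c := 0)) ?scale0r //=.
  by rewrite Sword_nil linear0.
apply: IHn; first by move=> u; apply: (kl (_ :: u)).
by rewrite -ltnS (leq_trans _ wn) // ltnS -sab /= addSn ltnS leq_addl.
Qed.

End Powers.

Lemma pw_lin (U U' : lmodType K) (T : {linear U -> U'}) n k w :
  T (pw n k w) = pw n (fun u => T (k u)) w.
Proof.
elim: n k w => [|n IHn] k w /=; first by rewrite lin_scale.
by rewrite split_sum_lin; apply: eq_split_sum => a b _ _; apply: IHn.
Qed.

Section PowersDelta.
Variable U : lmodType K.
Implicit Types (kk : word W -> word W -> U) (w : word V).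

Definition pw2 i j kk : word V -> U :=
  split_sum (fun a b => pw i (fun u => pw j (kk u) b) a).

Lemma pw2_Sl i j kk w :
  pw2 i.+1 j kk w = split_sum (fun a => pw2 i j (fun u => kk (fletter a :: u))) w.
Proof. exact/esym/(split_sumA (fun a b c => pw i (fun u => pw j (kk (fletter a :: u)) c)
  b)). Qed.

Lemma pw2_Sr i j kk w : pw2 i j.+1 kk w =
  split_sum (fun a => pw2 i j (fun u v =>
    (-1) ^ (wdeg a * wdeg u) *: kk u (fletter a :: v))) w.
Proof.
rewrite /pw2.
under [LHS]eq_split_sum => a bc _ _ do rewrite /= pw_split.
rewrite (split_sum_swap3 (fun a b c => pw i (fun u => pw j (fun v => kk u (fletter b ::
  v)) c) a)).
apply: eq_split_sum => a bc _ _; apply: eq_split_sum => b c _ _.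
by rewrite -pw_scale; apply: eq_pw => u -> _; rewrite pw_scale.
Qed.

(** Unshuffling [n] parts means choosing the [i] parts that go left; cocommutativity of the
    splittings of [w] makes all these choices contribute equally. The induction sends the first part
    left or right and uses Pascal's rule. *)
Lemma pw_delta n kk w :
  pw n (split_sum kk) w = \sum_(i < n.+1) 'C(n, i)%:R *: pw2 i (n - i)%N kk w.
Proof.
elim: n kk w => [|n IHn] kk w.
  rewrite big_ord1 bin0 scale1r /pw2 /= {1}/split_sum big_seq1 expr0z scale1r.
  by rewrite split_sum_nill.
rewrite [LHS]/=.
transitivity (split_sum (fun a b => \sum_(i < n.+1) 'C(n, i)%:R *:
   (pw2 i (n - i)%N (fun u => kk (fletter a :: u)) b +
    pw2 i (n - i)%N (fun u v => (-1) ^ (wdeg a * wdeg u) *: kk u (fletter a :: v)) b)) w).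
  apply: eq_split_sum => a b _ _.
  under eq_pw => u _ _ do rewrite split_sum_cons.
  rewrite IHn; apply: eq_bigr => i _; congr (_ *: _).
  rewrite /pw2 -split_sumD; apply: eq_split_sum => c d _ _.
  by rewrite -pwD; apply: eq_pw => u _ _; rewrite -pwD.
rewrite split_sum_sum.
under eq_bigr do rewrite split_sum_scale split_sumD -pw2_Sl -pw2_Sr scalerDr.
rewrite big_split /= [RHS]big_ord_recl /= bin0.
under [X in _ = _ + X]eq_bigr do rewrite binS natrD scalerDl.
rewrite big_split /= [RHS]addrA [RHS]addrC; congr (_ + _).
rewrite [LHS]big_ord_recl [X in _ = _ + X]big_ord_recr /= (@bin_small n n.+1) // mulr0n
  scale0r addr0 bin0 subn0.
by congr (_ + _); apply: eq_bigr => i _; rewrite /bump /= !add1n subSS subnSK.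
Qed.

End PowersDelta.
End ExpCoalg.

Section CoalgExp.
Variables (K : numFieldType) (V : gradedSpace K) (h : dgLie K).
Local Notation W := (shift h 1).
Variable f : {linear Sp V -> h}.
Hypothesis f1 : has_degree (V := SpG V) 1 f.

Let f' : {linear Sp V -> W} := f.

Lemma shift_degree w : homog (V := W) (wdeg w) (f' (Sword w)).
Proof. by have := degree_word w f1; rewrite addrC. Qed.

Local Notation pw := (pw shift_degree).

(** The truncation [N] is a parameter so that words of different arities can share it; by
    [cexpN_stable] any bound above the arity gives the same value. *)
Definition cexpN (U : lmodType K) N (k : word W -> U) w : U :=
  \sum_(n < N) (n`!%:R)^-1 *: pw n k w.

Lemma cexpN_multisym (U : lmodType K) N (k : word W -> U) : multisym k -> multisym
  (cexpN N k).
Proof.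
move=> kP; split=> [u v x y z c xy xz zE|u v x y].
- rewrite /cexpN scaler_sumr -big_split; apply: eq_bigr => n _ /=.
  rewrite ((pw_multisym shift_degree n kP).1 _ _ _ _ _ _ xy xz zE).
  by rewrite scalerDr !scalerA mulrC.
- rewrite /cexpN scaler_sumr; apply: eq_bigr => n _ /=.
  by rewrite ((pw_multisym shift_degree n kP).2) !scalerA mulrC.
Qed.

Lemma cexpN_stable (U : lmodType K) N (k : word W -> U) w : multilin k -> (size w < N)%N
  ->
  cexpN N k w = cexpN (size w).+1 k w.
Proof.
move=> kl wN; rewrite /cexpN -(subnKC wN) big_split_ord /= [X in _ + X]big1 ?addr0 //.
move=> i _; rewrite -[X in _ *: X]/(pw (size w + i).+1 k w) pw_big ?scaler0 //.
by rewrite ltnS leq_addr.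
Qed.

Definition cexp_word w : Sp W := cexpN (size w).+1 (@Sword K W) w.

Lemma cexp_nil : cexp_word [::] = 0.
Proof. by rewrite /cexp_word /cexpN big_ord1 /= Sword_nil !scaler0. Qed.

Lemma cexp_multisym : multisym cexp_word.
Proof.
have S := Sword_multisym W.
split=> [u v x y z c xy xz zE|u v x y]; rewrite /cexp_word !size_cat /=.
  exact: (cexpN_multisym _ S).1.
exact: (cexpN_multisym _ S).2.
Qed.

Definition cexp : {linear Sp V -> Sp W} := Slift cexp_nil cexp_multisym.

Lemma cexpE N w : (size w < N)%N -> cexp (Sword w) = cexpN N (@Sword K W) w.
Proof.
by move=> wN; rewrite /cexp SliftE cexpN_stable //; case: (Sword_multisym W).
Qed.

Lemma cexpN_lin (U U' : lmodType K) (T : {linear U -> U'}) N (k : word W -> U) w :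
  T (cexpN N k w) = cexpN N (fun u => T (k u)) w.
Proof.
by rewrite /cexpN linear_sum; apply: eq_bigr => n _; rewrite lin_scale pw_lin.
Qed.

Lemma cexp_degree : has_degree (V := SpG V) (W := SpG W) 0 cexp.
Proof.
apply: has_degree_words => w; rewrite addr0 (cexpE (ltnSn _)) /homog cexpN_lin; apply/eqP.
apply: eq_bigr => n _; congr (_ *: _); apply: eq_pw => u du _.
by apply/eqP; rewrite -du; apply: Sword_homog.
Qed.

Lemma cexp_proj c : CEproj h (cexp c) = f c.
Proof.
pose T : {linear Sp V -> h} := CEproj h \o cexp.
rewrite -[LHS]/(T c); apply: Sp_ext => -[|x w]; first by rewrite Sword_nil !linear0.
rewrite -[LHS]/(CEproj h (cexp (Sword (x :: w)))) (cexpE (ltnSn _)) cexpN_lin.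
have -> : (fun u => CEproj h (Sword u)) = @single_letter K h.
  by apply/funext => u; rewrite CEproj_word.
rewrite /cexpN [size _]/= !big_ord_recl big1 => [|n _].
  rewrite /= scale0r scaler0 add0r addr0 invr1 scale1r.
  exact: (split_sum_nilr (fun a => f (Sword a)) (x :: w)).
rewrite (eq_pw shift_degree (k' := fun=> 0)) ?pw0 ?scaler0 // => u _ su.
by rewrite single_letter_big // su.
Qed.

(** The exponential is multiplicative: a binomial coefficient over [n!] is the product of the
    inverses of [i!] and [(n - i)!]. The sum over [i + j <= size w] completes to a square, as the
    added terms ask for more parts than letters. *)
Lemma cexp_coalg : coalg_map cexp.
Proof.
move=> c; pose T : {linear Sp V -> tens (Sp W) (Sp W)} := Sdelta W \o cexp.
pose T' : {linear Sp V -> tens (Sp W) (Sp W)} := tens_map cexp cexp \o Sdelta V.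
rewrite -[LHS]/(T c) -[RHS]/(T' c); apply: Sp_ext => w.
rewrite -[LHS]/(Sdelta W (cexp (Sword w))) -[RHS]/(tens_map cexp cexp (Sdelta V (Sword
  w))).
rewrite tens_map_delta (cexpE (ltnSn _)) cexpN_lin.
pose kk (u v : word W) := tprod (Sword u) (Sword v).
pose G i j : tens (Sp W) (Sp W) := (i`!%:R^-1 * j`!%:R^-1) *: pw2 shift_degree i j kk w.
transitivity (\sum_(n < (size w).+1) \sum_(i < n.+1) G i (n - i)%N).
  apply: eq_bigr => n _.
  rewrite (@eq_pw _ _ _ _ shift_degree _ _ _ (split_sum kk)) => [|u _ _]; last first.
    exact: SdeltaE.
  rewrite pw_delta scaler_sumr; apply: eq_bigr => i _; rewrite scalerA; congr (_ *: _).
  have ni : (i <= n)%N by rewrite -ltnS.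
  rewrite -(bin_fact ni) natrM invfM mulrC mulrA divff;
    first by rewrite mul1r natrM invfM.
  by rewrite pnatr_eq0 -lt0n bin_gt0.
rewrite sum_triangle; last first.
  move=> i j ij; rewrite /G /pw2 -(split_sum0 _ w).
  rewrite -split_sum_scale; apply: eq_split_sum => a b _ sab.
  have Sl u : multilin (kk u).
    move=> u' v x y z c' xy xz zE.
    by rewrite /kk ((Sword_multisym W).1 _ _ _ _ _ _ xy xz zE) tprodDr tprodZr.
  have [bj|jb] := ltnP (size b) j.
    rewrite (eq_pw shift_degree (k' := fun=> 0)) ?pw0 ?scaler0 // => u _ _.
    exact: pw_big.
  rewrite pw_big ?scaler0 //.
    move=> u' v x y z c' xy xz zE.
    rewrite -pw_scale -pwD; apply: eq_pw => t _ _.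
    by rewrite /kk ((Sword_multisym W).1 _ _ _ _ _ _ xy xz zE) tprodDl tprodZl.
  by rewrite -(ltn_add2r (size b)) sab (leq_trans ij) // leq_add2l.
under eq_bigr => i _ do under eq_bigr => j _ do rewrite /G /pw2 -split_sum_scale.
under eq_bigr => i _ do rewrite -split_sum_sum.
rewrite -split_sum_sum; apply: eq_split_sum => a b _ sab.
have lea : (size a < (size w).+1)%N by rewrite ltnS -sab leq_addr.
have leb : (size b < (size w).+1)%N by rewrite ltnS -sab leq_addl.
rewrite (cexpE lea) (cexpE leb) /cexpN.
rewrite -/(tprodl _ _) linear_sum; apply: eq_bigr => i _.
rewrite -[RHS]/(tprodr _ _) linear_sum; apply: eq_bigr => j _.
rewrite -[RHS]/(tprod _ _) tprodZl tprodZr scalerA; congr (_ *: _).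
rewrite -[RHS]/(tprodl (pw j (@Sword K W) b) (pw i (@Sword K W) a)) pw_lin.
apply: eq_pw => u _ _; rewrite -[RHS]/(tprodr (Sword u) (pw j (@Sword K W) b)).
by rewrite pw_lin.
Qed.

End CoalgExp.

(** * Maurer-Cartan elements *)

Section Curvature.
Variables (K : numFieldType) (g h : dgLie K).
Local Notation V := (shift g 1).
Local Notation W := (shift h 1).

Definition curv (t : {linear CEp g -> h}) : {linear CEp g -> h} :=
  cdiff 1 t \+ (2^-1 \*: cbr 1 t t).

Lemma curvE t c : curv t c = cdiff 1 t c + 2^-1 *: cbr 1 t t c.
Proof. by []. Qed.

Lemma cdiffE p (t : {linear CEp g -> h}) c :
  cdiff p t c = dgl_d h (t c) - (-1) ^ p *: t (CEd g c).
Proof. by []. Qed.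

Lemma Ssign_homog (V' : gradedSpace K) q k (x : Sp V') : homog (V := SpG V') k x ->
  Ssign V' q x = (-1) ^ (q * k) *: x.
Proof.
move=> /eqP <-; rewrite -[gproj _ _ _]/(Sp_proj V' k x).
pose T : {linear Sp V' -> Sp V'} := Ssign V' q \o Sp_proj V' k.
pose T' : {linear Sp V' -> Sp V'} := (-1) ^ (q * k) \*: Sp_proj V' k.
rewrite -[LHS]/(T x) -[RHS]/(T' x); apply: Sp_ext => w.
rewrite -[LHS]/(Ssign V' q (Sp_proj V' k (Sword w))) -[RHS]/(_ *: Sp_proj V' k (Sword w)).
by rewrite Sp_projE; case: eqP => [<-|_]; rewrite ?SsignE // linear0 scaler0.
Qed.

Section Coalg.
Variable A : {linear CEp g -> CEp h}.
Hypotheses (A0 : has_degree 0 A) (AP : coalg_map (V := V) (W := W) A).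

Lemma Ssign_coalg q c : Ssign W q (A c) = A (Ssign V q c).
Proof.
pose T : {linear Sp V -> Sp W} := Ssign W q \o A.
pose T' : {linear Sp V -> Sp W} := A \o Ssign V q.
rewrite -[LHS]/(T c) -[RHS]/(T' c); apply: Sp_ext => w.
rewrite -[LHS]/(Ssign W q (A (Sword w))) -[RHS]/(A (Ssign V q (Sword w))).
have Aw := degree_word w A0; rewrite addr0 in Aw.
by rewrite SsignE lin_scale; apply: Ssign_homog.
Qed.

Lemma CEdelta_coalg c : CEdelta h (A c) = tens_map A A (CEdelta g c).
Proof. exact: AP. Qed.

Lemma cbr_pull (k : dgLie K) q (t1 t2 : {linear CEp h -> k}) (t1' t2' : {linear CEp g ->
  k}) c :
  (forall c, t1' c = t1 (A c)) -> (forall c, t2' c = t2 (A c)) ->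
  cbr q t1' t2' c = cbr q t1 t2 (A c).
Proof.
move=> e1 e2.
rewrite -[LHS]/(lie_tens k (tens_map (t1' \o Ssign V q) t2' (CEdelta g c))).
rewrite -[RHS]/(lie_tens k (tens_map (t1 \o Ssign W q) t2 (CEdelta h (A c)))).
rewrite CEdelta_coalg; congr (lie_tens k _).
pose T : {linear tens (CEp g) (CEp g) -> tens k k} := tens_map (t1 \o Ssign W q) t2 \o
  tens_map A A.
rewrite -[RHS]/(T _); apply: tens_ext => x y.
rewrite -[RHS]/(tens_map (t1 \o Ssign W q) t2 (tens_map A A (tprod x y))).
rewrite !tens_mapE; congr tprod; last exact: e2.
by rewrite -[LHS]/(t1' (Ssign V q x)) -[RHS]/(t1 (Ssign W q (A x))) e1 Ssign_coalg.
Qed.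

Variable t : {linear CEp g -> h}.
Hypothesis tA : forall c, CEproj h (A c) = t c.

(** The failure of [A] to be a chain map is a coderivation along [A], so it is governed by its
    projection, which is minus the curvature. *)
Definition defect c := CEd h (A c) - A (CEd g c).

Lemma defect_proj c : CEproj h (defect c) = - curv t c.
Proof.
rewrite /defect linearB CEproj_CEd !tA curvE cdiffE expr1z scaleN1r opprK.
rewrite -(@cbr_pull _ 1 (CEproj h) (CEproj h) t t c) //.
by rewrite !opprD addrAC.
Qed.

Lemma defect_arity w :
  (forall u, (size u < size w)%N -> defect (Sword u) = 0) ->
  CEdelta h (defect (Sword w)) = 0.
Proof.
move=> IH; rewrite /defect linearB CEdelta_d !CEdelta_coalg CEdelta_d.
rewrite -[CEdelta g _]/(Sdelta V (Sword w)) SdeltaE /Sdelta_word.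
apply/eqP; rewrite subr_eq0; apply/eqP; rewrite !split_sum_lin;
  apply: eq_split_sum => a b _ sab.
have [a0|a0] := posnP (size a).
  by rewrite (size0nil a0) Sword_nil !tprod0l !linear0.
have [b0|b0] := posnP (size b).
  by rewrite (size0nil b0) Sword_nil !tprod0r !linear0.
have ea : CEd h (A (Sword a)) = A (CEd g (Sword a)).
  by apply/eqP; rewrite -subr_eq0; apply/eqP/IH;
    rewrite -sab -[X in (X < _)%N]addn0 ltn_add2l.
have eb : CEd h (A (Sword b)) = A (CEd g (Sword b)).
  by apply/eqP; rewrite -subr_eq0; apply/eqP/IH;
    rewrite -sab -[X in (X < _)%N]add0n ltn_add2r.
by rewrite tens_mapE !tens_d_tprod linearD !tens_mapE ea eb Ssign_coalg.
Qed.

Lemma defect_iota w :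
  (forall u, (size u < size w)%N -> defect (Sword u) = 0) ->
  defect (Sword w) = - Siota W (curv t (Sword w)).
Proof. by move=> /defect_arity /primitiveE ->; rewrite defect_proj linearN. Qed.

Lemma defect0 n : (forall w, (size w <= n)%N -> curv t (Sword w) = 0) ->
  forall w, (size w <= n)%N -> defect (Sword w) = 0.
Proof.
move=> t0 w; have [m wm] := ubnP (size w); elim: m w wm => // m IHm w wm wn.
rewrite defect_iota ?t0 ?linear0 ?oppr0 // => u uw.
by apply: IHm; [apply: leq_trans uw _ | apply: leq_trans (ltnW uw) _].
Qed.

Lemma CEproj_CEd_iota y : CEproj h (CEd h (Siota W y)) = - dgl_d h y.
Proof.
pose T : {linear W -> h} := CEproj h \o (CEd h \o Siota W).
pose T' : {linear W -> h} := \- dgl_d h.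
rewrite -[LHS]/(T y) -[RHS]/(T' y); apply: homog_ext => k x kx.
rewrite -[LHS]/(CEproj h (CEd h (Siota W (lval (Letter kx))))) SiotaE CEd_word wsum_lin.
rewrite d_sum_cons CEproj_word /wsum !big_nil addr0 scaler0 addr0.
by [].
Qed.

(* Bianchi identity, to leading order *)
Lemma curv_closed n w : (forall w, (size w <= n)%N -> curv t (Sword w) = 0) ->
  size w = n.+1 -> cdiff 2 (curv t) (Sword w) = 0.
Proof.
move=> t0 wn.
(* The differential squares to zero, so it anticommutes with forming the defect; projecting this
   relation gives the closedness of the curvature. *)
have e : CEd h (defect (Sword w)) + defect (CEd g (Sword w)) = 0.
  by rewrite /defect linearB !CEd_CEd linear0 sub0r subr0 addNr.
have := congr1 (CEproj h) e; rewrite linearD linear0 defect_proj.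
rewrite defect_iota; last by move=> u; rewrite wn ltnS; apply: defect0.
rewrite !linearN CEproj_CEd_iota opprK => e'.
by rewrite cdiffE -[(-1) ^ 2]/((-1) ^+ 2) sqrrN expr1n scale1r.
Qed.

End Coalg.

Definition MC t := forall c, curv t c = 0.

Lemma taylor_MC (F : Linf g h) : MC (taylor F).
Proof.
move=> c; apply/oppr_inj; rewrite oppr0.
rewrite -(defect_proj (Lmap_degree F) (Lmap_delta F) (t := taylor F)) //.
by rewrite /defect Lmap_d subrr linear0.
Qed.

Lemma taylor_degree (F : Linf g h) : has_degree 1 (taylor F).
Proof.
move=> k x kx; have := CEproj_degree (Lmap_degree F kx).
by rewrite addr0.
Qed.

Lemma MC_words t : (forall w, curv t (Sword w) = 0) -> MC t.
Proof.
move=> t0 c; pose Z : {linear CEp g -> h} := \0.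
by rewrite -[RHS]/(Z c); apply: Sp_ext.
Qed.

Section OfMC.
Variable t : {linear CEp g -> h}.
Hypotheses (t1 : has_degree 1 t) (tMC : MC t).

Let A : {linear CEp g -> CEp h} := cexp (V := V) t1.

Lemma cexp_d c : CEd h (A c) = A (CEd g c).
Proof.
pose T : {linear CEp g -> CEp h} := CEd h \o A.
pose T' : {linear CEp g -> CEp h} := A \o CEd g.
rewrite -[LHS]/(T c) -[RHS]/(T' c); apply: Sp_ext => w.
apply/eqP; rewrite -subr_eq0; apply/eqP.
by apply: (defect0 (cexp_degree t1) (cexp_coalg t1) (cexp_proj t1)) (leqnn _) => u _.
Qed.

Definition Linf_of_MC : Linf g h :=
  MkLinf (cexp_degree t1) (cexp_coalg t1) cexp_d.

Lemma taylor_of_MC c : taylor Linf_of_MC c = t c.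
Proof. exact: cexp_proj. Qed.

End OfMC.

Lemma Linf_ext (F G : Linf g h) : (forall c, taylor F c = taylor G c) -> F =1 G.
Proof. by move=> FG; apply: coalg_map_unique FG; apply: Lmap_delta. Qed.

End Curvature.

(** * Acyclicity in a fixed arity *)

Section LetterDerivation.
Variables (K : fieldType) (V : gradedSpace K) (U : lmodType K).
Local Notation word := (word V).
Local Notation letter := (letter V).

Section OneDerivation.
Variables (T : letter -> letter) (tau : int).
Hypothesis ldegT : forall x, ldeg (T x) = ldeg x + tau.
Implicit Types (f : word -> U) (w : word).

(* The sum of the values of [f] on the words obtained by applying [T], of degree
   [tau], to one letter of [w] *)
Fixpoint tsum f w : U :=
  if w is x :: w' then f (T x :: w') + (-1) ^ (tau * ldeg x) *: tsum (fun u => f (x ::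
    u)) w'
  else 0.

Lemma tsumP c f1 f2 f w : (forall u, f u = c *: f1 u + f2 u) ->
  tsum f w = c *: tsum f1 w + tsum f2 w.
Proof.
elim: w f f1 f2 => [|x w IHw] f f1 f2 fE /=; first by rewrite scaler0 addr0.
rewrite fE (IHw _ (fun u => f1 (x :: u)) (fun u => f2 (x :: u))) //.
by rewrite !scalerDr !scalerA [_ * c]mulrC addrACA.
Qed.

Lemma tsum0 w : tsum (fun=> 0) w = 0.
Proof. by elim: w => //= x w ->; rewrite scaler0 addr0. Qed.

Lemma tsumD f1 f2 w : tsum (fun u => f1 u + f2 u) w = tsum f1 w + tsum f2 w.
Proof. by rewrite (@tsumP 1 f1 f2) ?scale1r // => u; rewrite scale1r. Qed.

Lemma tsum_scale c f w : tsum (fun u => c *: f u) w = c *: tsum f w.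
Proof. by rewrite (@tsumP c f (fun=> 0)) ?tsum0 ?addr0 // => u; rewrite addr0. Qed.

Lemma eq_tsum f f' w : (forall u, wdeg u = wdeg w + tau -> size u = size w -> f u = f'
  u) ->
  tsum f w = tsum f' w.
Proof.
elim: w f f' => //= x w IHw f f' ff'; rewrite ff' //; last first.
  by rewrite !wdeg_cons ldegT addrAC.
congr (_ + _ *: _); apply: IHw => u du su; apply: ff'; last by rewrite /= su.
by rewrite !wdeg_cons du addrA.
Qed.

Hypothesis T_lin : forall (x y z : letter) c, ldeg y = ldeg x -> ldeg z = ldeg x ->
  lval z = c *: lval x + lval y -> lval (T z) = c *: lval (T x) + lval (T y).

Lemma tsum_multisym f : multisym f -> multisym (tsum f).
Proof.
have cons_ms t f1 : multisym f1 -> multisym (fun v => f1 (t :: v)).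
  exact: multisym_cons.
move=> fP; split=> [u v x y z c xy xz zE|u v x y];
  elim: u f fP => [|s u IHu] f fP /=.
- rewrite (fP.1 [::] v (T x) (T y) (T z) c) ?ldegT ?xy ?xz //; last exact: T_lin.
  rewrite (@tsumP c (fun u => f (x :: u)) (fun u => f (y :: u))).
    by rewrite !scalerDr !scalerA ![_ * c]mulrC addrACA.
  by move=> u; apply: (fP.1 [::]).
- rewrite (IHu _ (cons_ms s _ fP)) (fP.1 (T s :: u) v x y z c) //.
  by rewrite !scalerDr !scalerA ![_ * c]mulrC addrACA.
- rewrite (fP.2 [::] v (T x) y) (fP.2 [::] v x (T y)) /= !ldegT.
  rewrite (@tsumP ((-1) ^ (ldeg x * ldeg y)) (fun u => f [:: y, x & u]) (fun=> 0));
    last first.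
    by move=> u; rewrite addr0; apply: (fP.2 [::]).
  rewrite tsum0 addr0 !scalerDr !scalerA addrCA; congr (_ *: _ + (_ *: _ + _ *: _)).
  + sgz_cases K.
  + sgz_cases K.
  + sgz_cases K.
- rewrite (IHu _ (cons_ms s _ fP)) (fP.2 (T s :: u) v x y).
  by rewrite !scalerDr !scalerA ![_ * (-1) ^ (ldeg x * ldeg y)]mulrC.
Qed.

End OneDerivation.

End LetterDerivation.

Lemma tsum_lin (K : fieldType) (V : gradedSpace K) (U U' : lmodType K) (S : {linear U ->
  U'})
    (T : letter V -> letter V) tau (f : word V -> U) w :
  S (tsum T tau f w) = tsum T tau (fun u => S (f u)) w.
Proof.
elim: w f => [|x w IHw] f /=; first by rewrite linear0.
by rewrite linearD lin_scale IHw.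
Qed.

Section Contraction.
Variables (K : numFieldType) (g h : dgLie K).
Local Notation V := (shift g 1).
Local Notation word := (word V).
Local Notation letter := (letter V).

Lemma tsum_dgl_d T tau (f : word -> h) w :
  dgl_d h (tsum T tau f w) = tsum T tau (fun u => dgl_d h (f u)) w.
Proof. exact: tsum_lin. Qed.

(** The bracket terms shorten the word, so only the linear differential is seen in the lowest arity
    of [f]; the sign is that of the differential of g[1]. *)
Lemma wsum_short (U : lmodType K) (f : word -> U) w :
  (forall u, (size u < size w)%N -> f u = 0) ->
  wsum f (d_terms w) = - tsum (@dletter K g) 1 f w.
Proof.
elim: w f => [|x w IHw] f f0; first by rewrite /wsum big_nil oppr0.
rewrite d_sum_cons IHw => [|u uw]; last by apply: f0.
rewrite (@eq_wsum_ad _ _ _ _ (fun=> 0)) => [|u _ su]; last by apply: f0; rewrite su /=.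
by rewrite wsum0 addr0 /= mul1r scalerN opprD.
Qed.

Variable ctr : {linear g -> g}.
Hypothesis ctr_deg : has_degree (-1) ctr.

(** Under the hypothesis [ctr_ctrP] that follows, this is a projection commuting with the
    differential; its kernel plays the role of the retract, and [ctr] contracts its image. *)
Definition ctrP x := dgl_d g (ctr x) + ctr (dgl_d g x).

Hypothesis ctr_ctrP : forall x, ctr (ctrP x) = ctr x.

Lemma cletter_homog (x : letter) : homog (V := V) (ldeg x + -1) (ctr (lval x)).
Proof. by have := ctr_deg (lhomog x); rewrite /homog /= addrA. Qed.
Definition cletter (x : letter) : letter := Letter (cletter_homog x).

(* The anticommutator of the derivations extending [dgl_d] and [ctr] is the
   derivation extending [ctrP]; see [dsum_csum]. *)
Fixpoint nsum (U : lmodType K) (f : word -> U) w : U :=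
  if w is x :: w' then
    f (cletter (dletter x) :: w') + f (dletter (cletter x) :: w') + nsum (fun u => f (x
      :: u)) w'
  else 0.

Local Notation dsum := (tsum (@dletter K g) 1).
Local Notation csum := (tsum cletter (-1)).

Lemma sgz_shift (i : int) : (-1 : K) ^ (-1 * i) = (-1) ^ i.
Proof. by rewrite mulN1r -invr_expz; case: (sgz_pm K i) => ->; rewrite ?invrN invr1. Qed.

Lemma dsum_csum (U : lmodType K) (f : word -> U) w :
  dsum (csum f) w + csum (dsum f) w = nsum f w.
Proof.
elim: w f => [|x w IHw] f /=; first by rewrite addr0.
rewrite -IHw !sgz_shift !mul1r.
rewrite !tsumD !tsum_scale.
rewrite !scalerDr !scalerA !sgzz !scale1r !sgzD expr1z mulrN1 -[(-1 : K) ^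
  (-1)]/((-1)^-1) invrN invr1 mulrN1.
rewrite !scaleNr !addrA [LHS](ACl (1*5*4*8*2*7*3*6)) /=.
by rewrite subrK addrK.
Qed.

Lemma ctrP_linear : linear ctrP.
Proof. by move=> a x y; rewrite /ctrP !linearP scalerDr addrACA. Qed.
HB.instance Definition _ := GRing.isLinear.Build K g g _ ctrP ctrP_linear.

Lemma ctrP_idem x : ctrP (ctrP x) = ctrP x.
Proof.
rewrite {1}/ctrP ctr_ctrP; congr (_ + _).
have -> : dgl_d g (ctrP x) = ctrP (dgl_d g x).
  by rewrite /ctrP linearD dgl_dd dgl_dd linear0 add0r addr0.
exact: ctr_ctrP.
Qed.

Lemma ctrP_homog (x : letter) : homog (V := V) (ldeg x) (ctrP (lval x)).
Proof.
apply: homogD.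
  by have := lhomog (dletter (cletter x)); rewrite /= -addrA addNr addr0.
by have := lhomog (cletter (dletter x)); rewrite /= -addrA subrr addr0.
Qed.

Definition pletter (x : letter) : letter := Letter (ctrP_homog x).

Lemma qletter_homog (x : letter) : homog (V := V) (ldeg x) (lval x - ctrP (lval x)).
Proof. by apply: homogB; [apply: lhomog | apply: ctrP_homog]. Qed.
Definition qletter (x : letter) : letter := Letter (qletter_homog x).

(** [X] stands for the image of [ctrP]; on a pure letter, [isX] is the eigenvalue, 0 or 1, of
    [ctrP]. *)
Definition isX (x : letter) : bool := ctrP (lval x) != 0.
Definition pure (x : letter) : bool := ctrP (lval x) == (isX x)%:R *: lval x.

Lemma pure_p x : pure (pletter x).
Proof.
rewrite /pure /isX /= ctrP_idem; have [->|] := eqVneq (ctrP (lval x)) 0.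
  by rewrite scaler0.
by rewrite scale1r.
Qed.

Lemma pure_q x : pure (qletter x).
Proof. by rewrite /pure /isX /= linearB /= ctrP_idem subrr eqxx scale0r. Qed.

Lemma pure_span (U : lmodType K) (f : word -> U) n : multilin f ->
  (forall w, size w = n -> all pure w -> f w = 0) -> forall w, size w = n -> f w = 0.
Proof.
(* The prefix, empty at the start, collects the letters already replaced by their two pure
   components. *)
move=> fl f0 w; rewrite -[w]/([::] ++ w).
elim: w [::] (isT : all pure [::]) => [|x w IHw] u up sw.
  by apply: f0; rewrite ?sw // cats0.
rewrite (fl u w (pletter x) (qletter x) x 1) //; last first.
  by rewrite /= scale1r addrC subrK.
rewrite -!cat_rcons !IHw ?scaler0 ?addr0 //.
- by rewrite all_rcons pure_q.
- by move: sw; rewrite cat_rcons !size_cat.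
- by rewrite all_rcons pure_p.
- by move: sw; rewrite cat_rcons !size_cat.
Qed.

Lemma nsum_pure (U : lmodType K) (f : word -> U) w : multilin f -> all pure w ->
  nsum f w = (count isX w)%:R *: f w.
Proof.
elim: w f => [|x w IHw] f fl /=; first by rewrite scale0r.
move=> /andP[px pw]; rewrite IHw //; last by move=> u; apply: (fl (x :: u)).
rewrite natrD scalerDl; congr (_ + _).
rewrite -(multilin_scale [::] w fl (z := pletter x)) //; last exact/eqP.
rewrite (fl [::] w (cletter (dletter x)) (dletter (cletter x)) (pletter x) 1) /=.
- by rewrite scale1r.
- by rewrite addrAC.
- by rewrite -addrA subrr addr0.
- by rewrite scale1r addrC.
Qed.

Lemma dletter_lin (x y z : letter) c : lval z = c *: lval x + lval y ->
  lval (dletter z) = c *: lval (dletter x) + lval (dletter y).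
Proof. by move=> /= ->; rewrite linearP. Qed.

Lemma cletter_lin (x y z : letter) c : lval z = c *: lval x + lval y ->
  lval (cletter z) = c *: lval (cletter x) + lval (cletter y).
Proof. by move=> /= ->; rewrite linearP. Qed.

Lemma dsum_dsum (U : lmodType K) (f : word -> U) w : multilin f -> dsum (dsum f) w = 0.
Proof.
elim: w f => [|x w IHw] f fl //=.
rewrite tsumD !tsum_scale IHw; last by move=> u; apply: (fl (x :: u)).
have -> : f (dletter (dletter x) :: w) = 0.
  rewrite (multilin_scale [::] w fl (x := dletter (dletter x)) (c := 0)) ?scale0r //.
  by rewrite /= dgl_dd.
by rewrite add0r scaler0 addr0 !mul1r -scalerDl sgzD expr1z mulrN1 addNr scale0r.
Qed.

Lemma tsum_degree T tau p (f : word -> h) : (forall x, ldeg (T x) = ldeg x + tau) ->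
  wdegree p f -> wdegree (p + tau) (tsum T tau f).
Proof.
move=> ldegT fp w; rewrite /homog tsum_lin; apply/eqP; apply: eq_tsum => // u du _.
by rewrite addrA (addrAC _ p) -du; apply/eqP/fp.
Qed.

(* A word whose letters lie in [ker ctrP] or in the image of [ctrP], with [m + 1] of
   the latter, is an eigenvector of the derivation extending [ctrP], for the
   eigenvalue [m + 1]: the induction kills [f] on such words for increasing [m]. *)
Lemma contract_words n p k m (f : word -> h) : (n - m <= k)%N ->
  multisym f -> wdegree p f ->
  (forall w, size w = n -> dgl_d h (f w) + (-1) ^ p *: dsum f w = 0) ->
  (forall w, size w = n -> all pure w -> (count isX w <= m)%N -> f w = 0) ->
  exists f' : word -> h, [/\ multisym f', wdegree (p - 1) f',
    forall w, size w = n -> dgl_d h (f' w) - (-1) ^ p *: dsum f' w = f w &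
    forall w, size w = n -> all (predC isX) w -> f' w = 0].
Proof.
have dP : forall (x y z : letter) c, ldeg y = ldeg x -> ldeg z = ldeg x ->
  lval z = c *: lval x + lval y -> lval (dletter z) = c *: lval (dletter x) + lval
    (dletter y).
  by move=> x y z c _ _; apply: dletter_lin.
have cP : forall (x y z : letter) c, ldeg y = ldeg x -> ldeg z = ldeg x ->
  lval z = c *: lval x + lval y -> lval (cletter z) = c *: lval (cletter x) + lval
    (cletter y).
  by move=> x y z c _ _; apply: cletter_lin.
elim: k m f => [|k IHk] m f mk fS fp fd f0.
  (* Here [n <= m], so every pure word of length [n] falls under [f0] and [f] vanishes in arity
     [n]. *)
  exists (fun=> 0); split => //.
  - by split=> [u v x y z c _ _ _|u v x y]; rewrite !scaler0 ?addr0.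
  - by move=> w; apply: homog0.
  - move=> w wn; rewrite tsum0 linear0 scaler0 subr0.
    apply/esym/(pure_span fS.1 _ wn) => u un up; apply: f0 => //.
    by rewrite (leq_trans (count_size _ _)) // un -subn_eq0 -leqn0.
(* With this constant the differential of [f1] is [nsum f] divided by [m + 1], which is [f] itself
   on pure words with exactly [m + 1] letters in [X]. *)
pose c0 : K := - (-1) ^ p / m.+1%:R.
pose f1 w := c0 *: csum f w.
have f1S : multisym f1 by apply/multisym_scale/tsum_multisym.
have f1p : wdegree (p - 1) f1.
  by move=> w; apply: homogZ; apply: (tsum_degree (tau := -1)).
have f1E w : size w = n -> dgl_d h (f1 w) - (-1) ^ p *: dsum f1 w = (m.+1%:R)^-1 *: nsum
  f w.
  move=> wn; rewrite /f1 lin_scale tsum_scale tsum_lin.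
  have -> : csum (fun u => dgl_d h (f u)) w = - (-1) ^ p *: csum (dsum f) w.
    rewrite -tsum_scale; apply: (eq_tsum (tau := -1)) => // u _ su.
    apply/eqP; rewrite scaleNr -addr_eq0; apply/eqP/fd; by rewrite su.
  rewrite -dsum_csum !scalerDr addrC -scaleNr !scalerA; congr (_ *: _ + _ *: _).
    by rewrite /c0 mulrA mulrNN sgzz mul1r.
  by rewrite /c0 mulrAC mulrNN sgzz mul1r.
(* The remainder is again closed, and it now vanishes on pure words with up to [m + 1] letters in
   [X]. *)
pose f2 w := f w - (dgl_d h (f1 w) - (-1) ^ p *: dsum f1 w).
have f2S : multisym f2.
  have L u : multisym u -> multisym (fun w => dgl_d h (u w)).
    move=> [ul us]; split=> [a b x y z c xy xz zE|a b x y].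
      by rewrite (ul _ _ _ _ _ _ xy xz zE) linearP.
    by rewrite us lin_scale.
  have -> : f2 = fun w => f w + ((-1) *: dgl_d h (f1 w) + (-1) ^ p *: dsum f1 w).
    by apply/funext => w; rewrite /f2 opprB scaleN1r [X in _ + X]addrC.
  apply: multisym_add => //; apply: multisym_add; first exact/multisym_scale/L.
  exact/multisym_scale/tsum_multisym.
have f2p : wdegree p f2.
  move=> w; apply: homogB; first exact: fp.
  apply: homogB; first by have := dgl_d_degree (f1p w); rewrite -!addrA addNr addr0.
  apply: homogZ; have := tsum_degree (T := @dletter K g) (tau := 1) (fun=> erefl) f1p w.
  by rewrite -addrA addNr addr0.
have f2d w : size w = n -> dgl_d h (f2 w) + (-1) ^ p *: dsum f2 w = 0.
  move=> wn; rewrite /f2.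
  have -> : dsum (fun w => f w - (dgl_d h (f1 w) - (-1) ^ p *: dsum f1 w)) w =
    dsum f w - dsum (fun w => dgl_d h (f1 w)) w.
    transitivity (dsum (fun w => f w + ((-1) *: dgl_d h (f1 w) + (-1) ^ p *: dsum f1 w))
      w).
      by apply: (eq_tsum (tau := 1)) => // u _ _;
        rewrite opprB scaleN1r [X in _ + X]addrC.
    rewrite !tsumD !tsum_scale dsum_dsum; last exact: f1S.1.
    by rewrite scaler0 addr0 scaleN1r.
  rewrite -tsum_dgl_d !(linearB (dgl_d h)) scalerBr dgl_dd sub0r (lin_scale (dgl_d h))
    opprK.
  by rewrite addrACA fd // add0r subrr.
have f20 w : size w = n -> all pure w -> (count isX w <= m.+1)%N -> f2 w = 0.
  move=> wn wp wm; rewrite /f2 f1E // nsum_pure //; last exact: fS.1.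
  rewrite scalerA; case: (ltngtP (count isX w) m.+1) wm => // [wm|->] _.
    by rewrite f0 // scaler0 subrr.
  by rewrite mulVf ?scale1r ?subrr // pnatr_eq0.
have [|f3 [f3S f3p f3E f30]] := IHk m.+1 f2 _ f2S f2p f2d f20.
  by move: mk; rewrite !leq_subLR addSnnS.
exists (fun w => f1 w + f3 w); split.
- exact: multisym_add.
- by move=> w; apply: homogD; [apply: f1p | apply: f3p].
- move=> w wn; rewrite linearD tsumD scalerDr opprD addrACA f3E // /f2.
  by rewrite addrCA subrr addr0.
- move=> w wn wX; rewrite f30 // addr0 /f1.
  (* On the retract [ctr] vanishes, because [ctr] equals [ctr] after [ctrP]. *)
  suff -> : csum f w = 0 by rewrite scaler0.
  elim: {wn} w f {f0 f2d f2p f2S f1S f1p fd fp f1E f1 f2 f20 f30 f3S f3p f3E} fS wX =>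
    //= x w IHw f fS /andP[/negPn/eqP xX wX].
  rewrite (IHw (fun u => f (x :: u))) ?scaler0 ?addr0 //; last exact: multisym_cons.
  rewrite (multilin_scale [::] w fS.1 (x := cletter x) (c := 0)) ?scale0r //.
  by rewrite /= -ctr_ctrP xX linear0.
Qed.

End Contraction.

Lemma onw_multisym (K : fieldType) (V : gradedSpace K) (U : lmodType K)
  (t : {linear Sp V -> U}) : multisym (fun w => t (Sword w)).
Proof.
have [Sl Ss] := Sword_multisym V.
split=> [u v x y z c xy xz zE|u v x y];
  first by rewrite (Sl _ _ _ _ _ _ xy xz zE) linearP.
by rewrite Ss lin_scale.
Qed.

Lemma lin_arity0 (K : fieldType) (V : gradedSpace K) (U : lmodType K)
    (t : {linear Sp V -> U}) n c : arity_le n c ->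
  (forall w, (size w <= n)%N -> t (Sword w) = 0) -> t c = 0.
Proof.
move=> cn t0; pose Z : {linear Sp V -> U} := \0.
by rewrite -[RHS]/(Z c); apply: (eq_on_arity cn).
Qed.

Section Symbol.
Variables (K : numFieldType) (g h : dgLie K) (A : {linear CEp g -> CEp h}).
Local Notation V := (shift g 1).
Local Notation W := (shift h 1).
Hypotheses (A0 : has_degree 0 A) (AP : coalg_map (V := V) (W := W) A).

Lemma lin_letter_homog (x : letter V) :
  homog (V := W) (ldeg x) (CEproj h (A (Sword [:: x]))).
Proof.
have := CEproj_degree (degree_word (V := V) [:: x] A0).
by rewrite wdeg_cons /wdeg big_nil addr0 addr0 /homog /= (addrC 1).
Qed.

Definition lin_letter (x : letter V) : letter W := Letter (lin_letter_homog x).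

Lemma coalg_letter x : A (Sword [:: x]) = Sword [:: lin_letter x].
Proof.
rewrite -(SiotaE (lin_letter x)); apply: primitiveE; rewrite AP tens_map_delta.
rewrite !split_sum_cons /split_sum big_seq1 /= Sword_nil !linear0 tprod0r tprod0l.
by rewrite scaler0 addr0 scaler0.
Qed.

Lemma coalg_symbol w : arity_le (size w).-1 (A (Sword w) - Sword (map lin_letter w)).
Proof. by apply: coalg_map_symbol => // x; apply: coalg_letter. Qed.

Lemma coalg_arity w : arity_le (size w) (A (Sword w)).
Proof. by apply: (coalg_map_arity (eps := lin_letter)) => // x; apply: coalg_letter. Qed.

End Symbol.

Section ContractMaps.
Variables (K : numFieldType) (g h : dgLie K).
Local Notation V := (shift g 1).
Local Notation letter := (letter V).

Variable ctr : {linear g -> g}.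
Hypothesis ctr_deg : has_degree (-1) ctr.
Hypothesis ctr_ctrP : forall x, ctr (ctrP ctr x) = ctr x.

(* In the application, [e = i r0] for a map [i] with coalgebra retraction [r0]. *)
Variable e : {linear CEp g -> CEp g}.
Hypotheses (e0 : has_degree 0 e) (eP : coalg_map (V := V) (W := V) e).
Hypothesis ee : forall c, e (e c) = e c.
Hypothesis e_ctrP : forall x : letter, ctrP ctr (CEproj g (e (Sword [:: x]))) = 0.
Hypothesis ctrP_e : forall x : letter, ctrP ctr (lval x) = 0 ->
  CEproj g (e (Sword [:: x])) = lval x.

Let eletter := lin_letter e0.
Let e_symbol := coalg_symbol e0 eP.
Let e_arity := coalg_arity e0 eP.

(** The primitive from [contract_words] vanishes on words in the retract, whereas vanishing on the
    image of [e] is wanted. Subtracting its composite with the idempotent [e] achieves this, and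
    changes nothing up to arity [n]. *)
Lemma contract_maps n p (t : {linear CEp g -> h}) : (0 < n)%N -> has_degree p t ->
  (forall w, (size w < n)%N -> t (Sword w) = 0) ->
  (forall c, t (e c) = 0) ->
  (forall w, size w = n -> cdiff p t (Sword w) = 0) ->
  exists s : {linear CEp g -> h}, [/\ has_degree (p - 1) s,
    forall w, (size w < n)%N -> s (Sword w) = 0,
    forall c, s (e c) = 0 &
    forall w, size w = n -> cdiff (p - 1) s (Sword w) = t (Sword w)].
Proof.
move=> n0 tp td' te td.
have short (f : word V -> h) w : (forall w, (size w < n)%N -> f w = 0) -> size w = n ->
  forall q, wdiff q f w = dgl_d h (f w) + (-1) ^ q *: tsum (@dletter K g) 1 f w.
  move=> f0 wn q; rewrite /wdiff wsum_short ?scalerN ?opprK // => u uw.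
  by apply: f0; rewrite -wn.
have tS := onw_multisym t.
have [|w wn|w wn wp wX|f' [f'S f'p f'E f'0]] :=
  @contract_words K g h ctr ctr_deg ctr_ctrP n p n 0 (onw t) _ tS (has_degree_onw tp).
- by rewrite subn0.
- by rewrite -(short (onw t)) // -cdiff_word td.
(* [e] fixes such a word up to lower arity, where [t] vanishes; hence [t] takes the same value on
   the word as on its image under [e], namely 0. *)
- have eX : map eletter w = w.
    have : all (predC (isX ctr)) w by rewrite all_predC has_count -leqNgt.
    elim: w {wn wp wX} => //= x w IHw /andP[/negPn/eqP xX /IHw ->].
    by congr (_ :: _); apply: letter_eq => //=; apply: ctrP_e.
  have := lin_arity0 (t := t) (e_symbol w); rewrite linearB te eX sub0r => e1.
  apply/eqP; rewrite -oppr_eq0; apply/eqP/e1 => u uw; apply: td'.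
  by rewrite -wn (leq_ltn_trans uw) // prednK // wn.
(* Cutting down to arity [n] makes [s0] vanish on lower words, so that only the leading term of [e]
   matters in [s0e]. *)
pose s0w w : h := (size w == n)%:R *: f' w.
have s0S : multisym s0w by exact: (arity_scale_multisym (fun m => (m == n)%:R)).
have s0nil : s0w [::] = 0 by rewrite /s0w /= eq_sym gtn_eqF // scale0r.
pose s0 : {linear CEp g -> h} := Slift s0nil s0S.
have s0E w : s0 (Sword w) = s0w w by apply: SliftE.
have s0n w : (size w < n)%N -> s0 (Sword w) = 0.
  by move=> wn; rewrite s0E /s0w ltn_eqF // scale0r.
have s0e w : (size w <= n)%N -> s0 (e (Sword w)) = 0.
  rewrite leq_eqVlt => /orP[/eqP wn|wn]; last first.
    by apply: (lin_arity0 (e_arity w)) => u uw; apply: s0n; apply: leq_ltn_trans wn.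
  rewrite -(subrK (Sword (map eletter w)) (e _)) linearD.
  rewrite (lin_arity0 (t := s0) (e_symbol w)) ?add0r; last first.
    by move=> u uw; apply: s0n; rewrite -wn (leq_ltn_trans uw) // prednK // wn.
  rewrite s0E /s0w size_map wn eqxx scale1r; apply: f'0; rewrite ?size_map //.
  by elim: w {wn} => //= x w ->; rewrite /isX /= e_ctrP eqxx.
pose s : {linear CEp g -> h} := s0 \- (s0 \o e).
exists s; split.
- apply: has_degree_words => w.
  rewrite -[s _]/(s0 (Sword w) - s0 (e (Sword w))).
  have d0 : has_degree (p - 1) s0.
    by apply: has_degree_words => u; rewrite s0E; apply: homogZ; apply: f'p.
  apply: homogB; apply: d0; first exact: Sword_homog.
  by have := degree_word w e0; rewrite addr0.
- move=> w wn; rewrite -[s _]/(s0 (Sword w) - s0 (e (Sword w))).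
  by rewrite s0n // s0e ?subr0 // ltnW.
- by move=> c; rewrite -[s _]/(s0 (e c) - s0 (e (e c))) ee subrr.
- move=> w wn; rewrite cdiff_word (@eq_wdiff _ _ _ _ _ s0w n) ?wn //; last first.
    move=> u un; rewrite /onw -[s _]/(s0 (Sword u) - s0 (e (Sword u))).
    by rewrite s0e // subr0.
  rewrite (short s0w) //; last by move=> u un; rewrite -s0E s0n.
  have es0 u : size u = n -> s0w u = f' u by rewrite /s0w => ->; rewrite eqxx scale1r.
  have -> : tsum (@dletter K g) 1 s0w w = tsum (@dletter K g) 1 f' w.
    by apply: (eq_tsum (tau := 1)) => // u _ su; rewrite es0 // su.
  rewrite es0 // sgzD -[(-1 : K) ^ (-1)]/((-1)^-1) invrN invr1 mulrN1 scaleNr.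
  exact: f'E.
Qed.

End ContractMaps.

(** * Retractions *)

Lemma dependent_choice (T : Type) (good : nat -> T -> Prop) (R : nat -> T -> T -> Prop)
  x0 :
  good 0 x0 -> (forall n x, good n x -> exists2 y, good n.+1 y & R n x y) ->
  exists u : nat -> T, forall n, good n (u n) /\ R n (u n) (u n.+1).
Proof.
move=> g0 step.
pose nxt n (x : {x | good n x}) : {y | good n.+1 y & R n (sval x) y} :=
  cid2 (step n _ (svalP x)).
pose u := nat_rect (fun n => {x | good n x}) (exist _ x0 g0)
  (fun n x => exist _ (s2val (nxt n x)) (s2valP (nxt n x))).
by exists (fun n => sval (u n)) => n; split;
  [exact: svalP | exact: s2valP' (nxt n (u n))].
Qed.

(** Completeness for the filtration by arity: step [n] already has the final values up to arity [n],
    so the limit reads off [u (size w)]. *)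
Lemma arity_limit (K : fieldType) (V : gradedSpace K) (U : lmodType K)
  (u : nat -> {linear Sp V -> U}) :
  (forall n w, (size w <= n)%N -> u n.+1 (Sword w) = u n (Sword w)) ->
  exists f : {linear Sp V -> U}, forall n w, (size w <= n)%N -> f (Sword w) = u n (Sword
    w).
Proof.
move=> ustab.
have uE n w : (size w <= n)%N -> u n (Sword w) = u (size w) (Sword w).
  by move=> /subnKC <-; elim: (n - _)%N => [|m IHm];
    rewrite ?addn0 // addnS ustab ?leq_addr.
have f0 : u (size (@nil (letter V))) (Sword [::]) = 0 by rewrite Sword_nil linear0.
have fS : multisym (fun w => u (size w) (Sword w)).
  split=> [a b x y z c xy xz zE|a b x y]; rewrite !size_cat /=.
    exact: (onw_multisym _).1.
  exact: (onw_multisym _).2.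
by exists (Slift f0 fS) => n w wn; rewrite SliftE uE.
Qed.

Section ConvolutionDegrees.
Variables (K : numFieldType) (g h : dgLie K).
Local Notation V := (shift g 1).
Implicit Types (t : {linear CEp g -> h}).

Lemma wdiff_degree p (f : word V -> h) : wdegree p f -> wdegree (p + 1) (wdiff p f).
Proof.
move=> fp w; apply: homogB; first by have := dgl_d_degree (fp w); rewrite -addrA.
apply: homogZ; rewrite /homog wsum_lin; apply/eqP/eq_wsum_d => u du _.
by rewrite addrA addrC addrA -du; apply/eqP/fp.
Qed.

Lemma cdiff_degree p t : has_degree p t -> has_degree (p + 1) (cdiff p t).
Proof.
move=> tp; apply: has_degree_words => w; rewrite cdiff_word.
exact/wdiff_degree/has_degree_onw.
Qed.

Lemma cbr_degree p q t1 t2 : has_degree p t1 -> has_degree q t2 ->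
  has_degree (p + q) (cbr q t1 t2).
Proof.
move=> tp tq; apply: has_degree_words => w; rewrite cbr_word.
by apply: wbr_degree; apply: has_degree_onw.
Qed.

Lemma curv_degree t : has_degree 1 t -> has_degree 2 (curv t).
Proof.
move=> t1 k x kx; rewrite curvE; apply: homogD; first exact: (cdiff_degree t1).
by apply: homogZ; apply: (cbr_degree t1 t1).
Qed.

Lemma eq_cdiff n p t t' w : (forall u, (size u <= n)%N -> t (Sword u) = t' (Sword u)) ->
  (size w <= n)%N -> cdiff p t (Sword w) = cdiff p t' (Sword w).
Proof. by move=> tt' wn; rewrite !cdiff_word; apply: eq_wdiff tt' wn. Qed.

Lemma eq_cbr n q t1 t2 t1' t2' w :
  (forall u, (size u < n)%N -> t1 (Sword u) = t1' (Sword u)) ->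
  (forall u, (size u < n)%N -> t2 (Sword u) = t2' (Sword u)) ->
  (size w <= n)%N -> cbr q t1 t2 (Sword w) = cbr q t1' t2' (Sword w).
Proof.
move=> e1 e2 wn; rewrite !cbr_word; apply: eq_wbr wn => //; exact: onw_nil.
Qed.

Lemma cdiffB p t t' c : cdiff p (t \- t') c = cdiff p t c - cdiff p t' c.
Proof.
have e x : (t \- t' : {linear CEp g -> h}) x = t x - t' x by [].
rewrite !cdiffE !e linearB scalerBr !opprB !addrA.
by rewrite [LHS](ACl (1*4*3*2)).
Qed.

Lemma cdiff0 n p t w : (forall u, (size u <= n)%N -> t (Sword u) = 0) ->
  (size w <= n)%N -> cdiff p t (Sword w) = 0.
Proof.
move=> t0 wn; rewrite (@eq_cdiff n _ _ \0) //.
by rewrite cdiffE /= linear0 scaler0 subrr.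
Qed.

End ConvolutionDegrees.

Lemma curv_pull (K : numFieldType) (g h k : dgLie K) (F : Linf g h)
    (t : {linear CEp h -> k}) (t' : {linear CEp g -> k}) c :
  (forall c, t' c = t (F c)) -> curv t' c = curv t (F c).
Proof.
move=> e; rewrite !curvE (cbr_pull (Lmap_degree F) (Lmap_delta F) _ _ e e) !cdiffE e.
by rewrite e Lmap_d.
Qed.

(* [i] is an [L_infty] morphism with a coalgebra retraction [r0], and [ctr] is a
   contraction of the target onto the image of the linear part of [i]. *)
Record contractible_to (K : numFieldType) (a b : dgLie K) (i : Linf a b)
    (r0 : {linear CEp b -> CEp a}) (ctr : {linear b -> b}) : Prop := ContractibleTo {
  ct_deg : has_degree (-1) ctr;
  ct_P : forall x, ctr (ctrP ctr x) = ctr x;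
  ct_r0_deg : has_degree 0 r0;
  ct_r0_coalg : coalg_map (V := shift b 1) (W := shift a 1) r0;
  ct_r0K : forall c, r0 (i c) = c;
  ct_i : forall x : letter (shift b 1), ctrP ctr (CEproj b (i (r0 (Sword [:: x])))) = 0;
  ct_ker : forall x : letter (shift b 1), ctrP ctr (lval x) = 0 ->
    CEproj b (i (r0 (Sword [:: x]))) = lval x
}.

Lemma comp_degree0 (K : fieldType) (U V W : gradedSpace K) (f : V -> W) (f' : U -> V) :
  has_degree 0 f -> has_degree 0 f' -> has_degree 0 (f \o f').
Proof. by move=> f0 f'0 k x /f'0; rewrite addr0 => /f0; rewrite /= addr0. Qed.

Lemma coalg_map_comp (K : numFieldType) (U V W : gradedSpace K)
    (A : {linear Sp V -> Sp W}) (B : {linear Sp U -> Sp V}) :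
  coalg_map A -> coalg_map B -> coalg_map (A \o B).
Proof.
move=> AP BP c; rewrite -[LHS]/(Sdelta W (A (B c))) AP BP.
pose T : {linear tens (Sp U) (Sp U) -> tens (Sp W) (Sp W)} := tens_map A A \o tens_map B
  B.
rewrite -[LHS]/(T _); apply: tens_ext => x y.
by rewrite -[LHS]/(tens_map A A (tens_map B B (tprod x y))) !tens_mapE.
Qed.

Section Contractible.
Variables (K : numFieldType) (a b : dgLie K) (i : Linf a b).
Variables (r0 : {linear CEp b -> CEp a}) (ctr : {linear b -> b}).
Hypothesis ct : contractible_to i r0 ctr.

Lemma contractible_solve (h : dgLie K) n p (t : {linear CEp b -> h}) : has_degree p t ->
  (forall w, (size w <= n)%N -> t (Sword w) = 0) ->
  (forall c, t (i c) = 0) ->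
  (forall w, size w = n.+1 -> cdiff p t (Sword w) = 0) ->
  exists s : {linear CEp b -> h}, [/\ has_degree (p - 1) s,
    forall w, (size w <= n)%N -> s (Sword w) = 0,
    forall c, s (i c) = 0 &
    forall w, size w = n.+1 -> cdiff (p - 1) s (Sword w) = t (Sword w)].
Proof.
move=> tp tn ti td; case: ct => cd cP rd rc rK ciP ck.
pose e : {linear CEp b -> CEp b} := i \o r0.
have e0 : has_degree 0 e by exact: comp_degree0 (Lmap_degree i) rd.
have eP : coalg_map (V := shift b 1) (W := shift b 1) e.
  exact: (coalg_map_comp (Lmap_delta i) rc).
have ee c : e (e c) = e c by rewrite /e /= rK.
have te c : t (e c) = 0 by apply: ti.
have [s [sp sn se sd]] := contract_maps cd cP e0 eP ee ciP ck (ltn0Sn n) tp tn te td.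
exists s; split => // c.
by have := se (i c); rewrite /e /= rK.
Qed.

(** [f0] is not assumed to satisfy the Maurer-Cartan equation. Its lowest curvature is closed by
    [curv_closed], and vanishes on the image of [i] because [CEproj] is a Maurer-Cartan element; so
    it is the differential of some [s]. Subtracting [s] removes it, the bracket being unchanged in
    that arity. *)
Lemma Linf_retraction (f0 : {linear CEp b -> a}) : has_degree 1 f0 ->
  (forall c, f0 (i c) = CEproj a c) ->
  exists r : Linf b a, forall c, r (i c) = c.
Proof.
move=> f01 f0i.
pose good n (f : {linear CEp b -> a}) := [/\ has_degree 1 f,
  forall c, f (i c) = CEproj a c &
  forall w, (size w <= n)%N -> curv f (Sword w) = 0].
pose R n (f f' : {linear CEp b -> a}) :=
  forall w, (size w <= n)%N -> f' (Sword w) = f (Sword w).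
have good0 : good 0%N f0.
  by split=> // w; rewrite leqn0 => /nilP ->; rewrite Sword_nil linear0.
have [|u uP] := dependent_choice (R := R) good0.
  move=> n f [f1 fi fn].
  have [|||s [s1 sn si sd]] := contractible_solve (n := n) (curv_degree f1).
  + exact: fn.
  + by move=> c; rewrite -(curv_pull (t' := CEproj a)) // curvE CEproj_MC.
  + by move=> w wn; apply: (curv_closed (cexp_degree f1) (cexp_coalg f1) (cexp_proj f1)
    fn).
  pose f' : {linear CEp b -> a} := f \- s.
  have f'E c : f' c = f c - s c by [].
  have ff' w : (size w <= n)%N -> f' (Sword w) = f (Sword w).
    by move=> wn; rewrite f'E sn // subr0.
  exists f' => //; split.
  + by move=> k x kx; rewrite f'E; apply: homogB; [apply: f1 | apply: (s1 k x kx)].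
  + by move=> c; rewrite f'E fi si subr0.
  + move=> w wn; rewrite curvE (@eq_cbr _ _ _ n.+1 _ _ _ f f) //.
    have -> : cdiff 1 f' (Sword w) = cdiff 1 f (Sword w) - cdiff 1 s (Sword w).
      exact: cdiffB.
    rewrite addrAC -curvE; move: wn; rewrite leq_eqVlt => /orP[/eqP wn|wn].
      by rewrite -[cdiff 1 s _]/(cdiff (2 - 1) s _) sd // subrr.
    by rewrite fn // (cdiff0 (n := n) _ sn) // subrr.
have [f fu] : exists f : {linear CEp b -> a},
    forall n w, (size w <= n)%N -> f (Sword w) = u n (Sword w).
  exact: arity_limit (fun n => (uP n).2).
have f1 : has_degree 1 f.
  apply: has_degree_words => w; rewrite (fu (size w)) //.
  by apply: degree_word; case: (uP (size w)) => [[]].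
have fMC : MC f.
  apply: MC_words => w; have [_ _ /(_ w (leqnn _)) <-] := (uP (size w)).1.
  rewrite !curvE (@eq_cdiff _ _ _ (size w) _ f (u (size w))) //; last exact: fu.
  by congr (_ + _ *: _); apply: (eq_cbr (n := (size w).+1)) => // v vw; apply: fu.
have fi c : f (i c) = CEproj a c.
  pose T : {linear CEp a -> a} := f \o i.
  rewrite -[LHS]/(T c); apply: Sp_ext => w; rewrite -[LHS]/(f (i (Sword w))).
  (* [i] does not raise the arity, so the limit may be replaced by [u (size w)] here. *)
  have [_ <- _] := (uP (size w)).1; apply: (eq_on_arity (V := shift b 1)) (fu (size w)).
  exact: coalg_arity (Lmap_degree i) (Lmap_delta i) w.
exists (Linf_of_MC f1 fMC) => c.
pose A : {linear CEp a -> CEp a} := cexp (V := shift b 1) f1 \o i.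
pose B : {linear CEp a -> CEp a} := idfun.
rewrite -[LHS]/(A c) -[RHS]/(B c); apply: (coalg_map_unique (V := shift a 1)).
- exact: coalg_map_comp (cexp_coalg f1) (Lmap_delta i).
- by move=> x; apply/esym;
  apply: (tens_ext (f := tens_map idfun idfun) (g := idfun)) => y z; rewrite tens_mapE.
- move=> x; rewrite -[CEproj a (A x)]/(CEproj a (cexp (V := shift b 1) f1 (i x))).
  by rewrite cexp_proj.
Qed.

End Contractible.

(** * Gauge flows *)

Lemma arity_ex (K : fieldType) (V : gradedSpace K) (c : Sp V) : exists n, arity_le n c.
Proof.
elim/Sp_ind: c => [|x y [m xm] [n yn]|k x [n xn]|w].
- by exists 0%N; rewrite /arity_le linear0.
- exists (m + n)%N; apply: arity_leD; first exact: arity_leS (leq_addr _ _) xm.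
  exact: arity_leS (leq_addl _ _) yn.
- by exists n; apply: arity_leZ.
- by exists (size w); apply: arity_le_word.
Qed.

Lemma sum_ord_rev (U : zmodType) (G : nat -> nat -> U) n :
  \sum_(i < n.+1) G i (n - i)%N = \sum_(i < n.+1) G (n - i)%N i.
Proof.
rewrite (reindex_inj rev_ord_inj) /=; apply: eq_bigr => i _.
by rewrite subSS subKn // -ltnS.
Qed.

Section Flow.
Variables (K : numFieldType) (g h : dgLie K).
Local Notation V := (shift g 1).
Variables (H a : {linear CEp g -> h}).

(* Taylor coefficients in [t] of the gauge flow of [H] through [a] *)
Fixpoint flow_coef n : {linear CEp g -> h} :=
  if n is n'.+1 then
    n%:R^-1 \*: (cbr 1 H (flow_coef n') \- ((n' == 0)%:R \*: cdiff 0 H))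
  else a.

Lemma flow_coefS n c : flow_coef n.+1 c =
  n.+1%:R^-1 *: (cbr 1 H (flow_coef n) c - (n == 0)%:R *: cdiff 0 H c).
Proof. by []. Qed.

Lemma flow_coef_mul n c : n.+1%:R *: flow_coef n.+1 c =
  cbr 1 H (flow_coef n) c - (n == 0)%:R *: cdiff 0 H c.
Proof. by rewrite flow_coefS scalerA divff ?scale1r // pnatr_eq0. Qed.

(** Every further bracket raises the lowest arity by one. This is why the flow is polynomial in [t]
    on each chain. *)
Lemma flow_coef_short n w : (size w < n)%N -> flow_coef n (Sword w) = 0.
Proof.
elim: n w => // n IHn w wn; rewrite flow_coefS.
case: n IHn wn => [|n] IHn wn.
  by move: wn; rewrite ltnS leqn0 => /nilP ->;
    rewrite Sword_nil !linear0 ?subrr ?subr0 ?oppr0 ?addr0 ?scaler0.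
rewrite scale0r subr0 (@eq_cbr _ _ _ n.+1 _ H (flow_coef n.+1) H \0) //.
rewrite cbr_word /wbr (_ : split_sum _ w = 0) ?scaler0 //.
by rewrite -[RHS](split_sum0 h w); apply: eq_split_sum => u v _ _;
  rewrite dgl_br0r scaler0.
Qed.

Lemma flow_coef_arity n c : arity_le (V := V) n c -> flow_coef n.+1 c = 0.
Proof. by move=> cn; apply: (lin_arity0 cn) => w wn; apply: flow_coef_short. Qed.

Fixpoint flow_part t n : {linear CEp g -> h} :=
  if n is n'.+1 then flow_part t n' \+ (t ^+ n \*: flow_coef n) else a.

Lemma flow_partE t n c : flow_part t n c = \sum_(k < n.+1) t ^+ k *: flow_coef k c.
Proof.
elim: n => [|n IHn]; first by rewrite big_ord1 expr0 scale1r.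
by rewrite big_ord_recr /= -IHn.
Qed.

Lemma flow_ex t : exists f : {linear CEp g -> h},
  forall n w, (size w <= n)%N -> f (Sword w) = flow_part t n (Sword w).
Proof.
apply: arity_limit => n w wn.
rewrite -[LHS]/(flow_part t n (Sword w) + t ^+ n.+1 *: flow_coef n.+1 (Sword w)).
by rewrite flow_coef_short // scaler0 addr0.
Qed.

Definition flow t : {linear CEp g -> h} := projT1 (cid (flow_ex t)).

Lemma flowE t n c : arity_le (V := V) n c ->
  flow t c = \sum_(k < n.+1) t ^+ k *: flow_coef k c.
Proof.
move=> cn; rewrite -flow_partE; apply: (eq_on_arity cn) => w wn.
by rewrite /flow; case: cid => f /= fE; apply: fE.
Qed.

Lemma cbr_flow t n c : arity_le (V := V) n c ->
  cbr 1 H (flow t) c = \sum_(k < n.+1) t ^+ k *: cbr 1 H (flow_coef k) c.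
Proof.
move=> cn; pose T : {linear CEp g -> h} := cbr 1 H (flow t).
have lin_sum m : exists T' : {linear CEp g -> h},
    forall c, T' c = \sum_(k < m) t ^+ k *: cbr 1 H (flow_coef k) c.
  elim: m => [|m [T' T'E]]; first by exists \0 => c'; rewrite big_ord0.
  exists (T' \+ (t ^+ m \*: cbr 1 H (flow_coef m))) => c'.
  by rewrite big_ord_recr /= -T'E.
have [T' T'E] := lin_sum n.+1; rewrite -T'E.
apply: (eq_on_arity cn) => w wn; rewrite T'E !cbr_word.
transitivity (wbr 1 (onw H) (fun u => \sum_(k < n.+1) t ^+ k *: onw (flow_coef k) u) w).
  apply: eq_split_sum => u v _ uv; congr (_ *: dgl_br _ _).
  by apply: flowE; apply: arity_le_word; apply: leq_trans wn; rewrite -uv leq_addl.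
by rewrite wbr_sumr; apply: eq_bigr => k _; rewrite wbrZr cbr_word.
Qed.

Hypotheses (H0 : has_degree 0 H) (a1 : has_degree 1 a).

Lemma flow_coef_degree n : has_degree 1 (flow_coef n).
Proof.
elim: n => [|n IHn] //; apply: has_degree_words => w; rewrite flow_coefS.
apply/homogZ/homogB; first by apply: degree_word; apply: (cbr_degree H0 IHn).
by apply: homogZ; apply: degree_word; apply: (cdiff_degree H0).
Qed.

Lemma flow_degree t : has_degree 1 (flow t).
Proof.
apply: has_degree_words => w; rewrite (flowE t (arity_le_word (leqnn _))).
apply: homog_sum => k; apply: homogZ; apply: degree_word; exact: flow_coef_degree.
Qed.

Lemma flow_gauge : gauge_flow H flow.
Proof.
split=> [|c]; first exact: flow_degree.
have [n cn] := arity_ex c.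
(* The last coefficient is 0 on [c]; listing it gives the derivative as many terms as the sum in
   [cbr_flow]. *)
exists (mkseq (fun k => flow_coef k c) n.+2); rewrite size_mkseq; split=> t.
  rewrite (flowE t cn) [RHS]big_ord_recr [X in _ = _ + X](_ : _ = 0) ?addr0; last first.
    by rewrite nth_mkseq // flow_coef_arity // scaler0.
  by apply: eq_bigr => k _; rewrite nth_mkseq // ltnW // ltnS ltn_ord.
rewrite -[LHS]/(- cdiff 0 H c + cbr 1 H (flow t) c) (cbr_flow t cn) [RHS]big_ord_recl [X
  in _ = X + _](_ : _ = 0) ?add0r; last first.
  by rewrite /= mulr0n scale0r.
rewrite [RHS](eq_bigr (fun k : 'I_n.+1 => t ^+ k *: cbr 1 H (flow_coef k) c -
   t ^+ k *: ((k == 0 :> nat)%:R *: cdiff 0 H c))) => [|k _]; last first.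
  rewrite lift0 nth_mkseq; last by rewrite ltnS.
  transitivity (t ^+ k *: (k.+1%:R *: flow_coef k.+1 c));
    last by rewrite flow_coef_mul scalerBr.
  by rewrite [RHS]scalerA mulr_natr.
rewrite sumrB addrC; congr (_ - _).
rewrite big_ord_recl expr0 !scale1r big1 ?addr0 // => k _.
by rewrite lift0 scale0r scaler0.
Qed.

Hypothesis aMC : MC a.

Lemma cdiff_cdiff c : cdiff 1 (cdiff 0 H) c = 0.
Proof.
rewrite !cdiffE CEd_CEd linear0 scaler0 subr0 linearB dgl_dd.
rewrite (lin_scale (dgl_d h)) expr0z !scale1r expr1z scaleN1r opprK sub0r.
by rewrite addNr.
Qed.

Let X n := onw (flow_coef n).
Let eta := onw H.

Let XE n : (fun w => n.+1%:R *: X n.+1 w) =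
  fun w => wbr 1 eta (X n) w + (- (n == 0)%:R) *: wdiff 0 eta w.
Proof.
by apply/funext => w; rewrite /X /onw flow_coef_mul cbr_word cdiff_word scaleNr.
Qed.

Let Xdeg n : wdegree 1 (X n).
Proof. exact/has_degree_onw/flow_coef_degree. Qed.

Let X_sym i j w : wbr 1 (X i) (X j) w = wbr 1 (X j) (X i) w.
Proof.
by rewrite (wbr_antisym w (Xdeg i) (Xdeg j)) mulr1 expr1z scaleN1r opprK.
Qed.

(** The coefficient of [t ^ n] in the curvature of the flow. The curvature moves by bracketing with
    [H]: [n + 1] times coefficient [n + 1] is the bracket of [H] with coefficient [n], which
    vanishes by induction. *)
Lemma flow_coef_MC n w :
  wdiff 1 (X n) w + 2^-1 *: \sum_(i < n.+1) wbr 1 (X i) (X (n - i)%N) w = 0.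
Proof.
elim: n w => [|n IHn] w.
  rewrite big_ord1 subn0.
  by have := aMC (Sword w); rewrite curvE cdiff_word cbr_word.
have n1 : n.+1%:R != 0 :> K by rewrite pnatr_eq0.
apply: (scalerI n1); rewrite scaler0 scalerDr.
have wdZ c (f : word V -> h) : wdiff 1 (fun w => c *: f w) w = c *: wdiff 1 f w.
  by rewrite /wdiff lin_scale wsum_scale scalerBr !scalerA mulrC.
have wdD (f f' : word V -> h) : wdiff 1 (fun w => f w + f' w) w = wdiff 1 f w + wdiff 1
  f' w.
  by rewrite /wdiff linearD wsumD scalerDr opprD addrACA.
rewrite -wdZ XE wdD wdZ (wdiff_leibniz (p := 0) (q := 1) w (has_degree_onw H0) (Xdeg n)).
have -> : wdiff 1 (wdiff 0 eta) w = 0.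
  have <- : onw (cdiff 0 H) = wdiff 0 eta by apply/funext => u; apply: cdiff_word.
  by rewrite -cdiff_word cdiff_cdiff.
rewrite scaler0 addr0 scale1r.
set B := fun i j => wbr 1 (X i) (X j) w.
have two0 : (2 : K) != 0 by rewrite pnatr_eq0.
(* The derivative of half the square of [X] is the bracket of the derivative with [X]: the weights
   of the indices [i] and [n + 1 - i] add up to [n + 1], and the bracket is symmetric on elements of
   degree 1. *)
have step2 : n.+1%:R *: (2^-1 *: \sum_(i < n.+2) B i (n.+1 - i)%N) =
    \sum_(i < n.+1) i.+1%:R *: B i.+1 (n - i)%N.
  apply: (scalerI two0); rewrite [LHS]scalerA [LHS]scalerA mulrAC divff // mul1r.
  pose G i j := j%:R *: B i j.
  have e1 : \sum_(i < n.+2) G i (n.+1 - i)%N = \sum_(i < n.+1) i.+1%:R *: B i.+1 (n -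
    i)%N.
    rewrite sum_ord_rev big_ord_recl /G scale0r add0r; apply: eq_bigr => i _.
    by rewrite lift0 subSS /B X_sym.
  rewrite [RHS]scaler_nat [RHS]mulr2n -e1 [X in _ = X + _]sum_ord_rev -big_split
    scaler_sumr.
  apply: eq_bigr => i _;
    rewrite /G /= [B (_ - _)%N _]X_sym -/(B _ _) -scalerDl -natrD subnKC // -ltnS.
  exact: ltn_ord.
have eta0 := has_degree_onw H0.
rewrite step2 (eq_bigr (fun i : 'I_n.+1 => wbr 1 (wbr 1 eta (X i)) (X (n - i)%N) w +
   - ((i == 0 :> nat)%:R *: wbr 1 (wdiff 0 eta) (X (n - i)%N) w))) => [|i _]; last first.
  by rewrite /B -wbrZl XE wbrDl wbrZl scaleNr.
rewrite sumrB [X in _ + (_ - X)]big_ord_recl scale1r [X in _ + (_ - (_ + X))]big1 => [|i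
  _]; last first.
  by rewrite lift0 scale0r.
rewrite addr0 subn0 addrC addrA subrK addrC.
have : wbr (1 + 1) eta (fun u => wdiff 1 (X n) u +
    2^-1 *: \sum_(i < n.+1) wbr 1 (X i) (X (n - i)%N) u) w = 0.
  rewrite (_ : (fun u => _) = fun=> 0); last by apply/funext.
  rewrite -[RHS](split_sum0 h w); apply: eq_split_sum => u v _ _.
  by rewrite dgl_br0r scaler0.
rewrite wbrDr wbrZr wbr_sumr => e; rewrite -[RHS]e; congr (_ + _).
apply: (scalerI two0); rewrite scalerA divff // scale1r scaler_nat mulr2n.
(* Twice the sum is written with the indices [i] and [n - i] exchanged in one copy, so that each
   pair is an instance of the Jacobi identity. *)
pose G i j := wbr 1 (wbr 1 eta (X i)) (X j) w.
transitivity (\sum_(i < n.+1) G i (n - i)%N + \sum_(i < n.+1) G (n - i)%N i).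
  by rewrite -sum_ord_rev.
rewrite -big_split.
apply: eq_bigr => i _ /=;
  rewrite (wbr_jacobi w eta0 (Xdeg i) (Xdeg (n - i)%N)) mul0r expr0z scale1r.
congr (_ + _); rewrite (wbr_antisym w (Xdeg i) (wbr_degree eta0 (Xdeg (n - i)%N))).
by rewrite add0r mulr1 expr1z scaleN1r opprK.
Qed.

(** At time 1 the curvature is the sum of its coefficients; products with [i + j] beyond the arity
    vanish, so the sums over a square and over a triangle agree. *)
Lemma flow1_MC : MC (flow 1).
Proof.
apply: MC_words => w; set N := size w.
have wN : arity_le (V := V) N (Sword w) by apply: arity_le_word.
have F1 u : (size u <= N)%N -> onw (flow 1) u = \sum_(k < N.+1) X k u.
  move=> uN; rewrite /onw (flowE 1 (arity_le_word uN)).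
  by apply: eq_bigr => k _; rewrite expr1n scale1r.
rewrite curvE cdiff_word cbr_word.
have -> : wdiff 1 (onw (flow 1)) w = \sum_(k < N.+1) wdiff 1 (X k) w.
  rewrite (@eq_wdiff _ _ _ _ _ (fun u => \sum_(k < N.+1) X k u) N) //.
  rewrite /wdiff linear_sum sumrB; congr (_ - _).
  rewrite -scaler_sumr; congr (_ *: _); rewrite /wsum exchange_big; apply: eq_bigr => p _.
  by rewrite scaler_sumr.
have -> : wbr 1 (onw (flow 1)) (onw (flow 1)) w =
    \sum_(i < N.+1) \sum_(j < N.+1) wbr 1 (X i) (X j) w.
  transitivity (wbr 1 (fun u => \sum_(k < N.+1) X k u) (fun u => \sum_(k < N.+1) X k u)
    w).
    apply: eq_split_sum => u v _ uv; rewrite !F1 //.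
      by rewrite /N -uv leq_addl.
    by rewrite /N -uv leq_addr.
  by rewrite exchange_big wbr_sumr; apply: eq_bigr => j _; apply: wbr_suml.
rewrite -(sum_triangle (G := fun i j => wbr 1 (X i) (X j) w)); last first.
  move=> i j ij; rewrite -(split_sum0 h w); apply: eq_split_sum => u v _ uv.
  have [ui|iu] := ltnP (size u) i.
    by rewrite /X /onw flow_coef_short // dgl_br0l scaler0.
  have vj : (size v < j)%N.
    by rewrite -(ltn_add2l (size u)) uv (leq_trans _ (leq_add iu (leqnn j))) //.
  by rewrite {2}/X /onw flow_coef_short // dgl_br0r scaler0.
by rewrite scaler_sumr -big_split big1 // => n _; apply: flow_coef_MC.
Qed.

Lemma flow0 : flow 0 =1 a.
Proof.
move=> c; have [n cn] := arity_ex c.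
rewrite (flowE 0 cn) big_ord_recl expr0 scale1r big1 ?addr0 // => k _.
by rewrite lift0 expr0n scale0r.
Qed.

End Flow.

Section FlowLocality.
Variables (K : numFieldType) (g h : dgLie K).
Local Notation V := (shift g 1).
Variable a : {linear CEp g -> h}.

Lemma eq_flow_coef (H H' : {linear CEp g -> h}) n k w :
  (forall u, (size u <= n)%N -> H (Sword u) = H' (Sword u)) -> (size w <= n)%N ->
  flow_coef H a k (Sword w) = flow_coef H' a k (Sword w).
Proof.
move=> HH'; elim: k w => // k IHk w wn; rewrite !flow_coefS.
rewrite (eq_cdiff 0 HH' wn); congr (_ *: (_ - _)).
by apply: (eq_cbr (n := n)) => // u un; [apply/HH'/ltnW | apply/IHk/ltnW].
Qed.

Lemma eq_flow (H H' : {linear CEp g -> h}) n t w :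
  (forall u, (size u <= n)%N -> H (Sword u) = H' (Sword u)) -> (size w <= n)%N ->
  flow H a t (Sword w) = flow H' a t (Sword w).
Proof.
move=> HH' wn; rewrite !(flowE _ _ _ (arity_le_word (leqnn (size w)))).
by apply: eq_bigr => k _; rewrite (eq_flow_coef _ HH' wn).
Qed.

(** Brackets only see lower arities, so in arity [n + 1] the perturbation acts through the term
    linear in the generator, which enters the coefficient of [t] alone. *)
Lemma flow_perturb (H s : {linear CEp g -> h}) n w :
  (forall u, (size u <= n)%N -> s (Sword u) = 0) -> (size w <= n.+1)%N ->
  flow (H \- s) a 1 (Sword w) = flow H a 1 (Sword w) + cdiff 0 s (Sword w).
Proof.
move=> s0 wn.
pose H' : {linear CEp g -> h} := H \- s.
have HE u : (size u <= n)%N -> H' (Sword u) = H (Sword u).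
  by move=> un; rewrite -[LHS]/(_ - s (Sword u)) s0 // subr0.
rewrite -[flow _ a 1]/(flow H' a 1).
have coefE k : flow_coef H' a k (Sword w) =
    flow_coef H a k (Sword w) + (k == 1)%:R *: cdiff 0 s (Sword w).
  case: k => [|k]; first by rewrite scale0r addr0.
  rewrite !flow_coefS.
  have -> : cbr 1 H' (flow_coef H' a k) (Sword w) = cbr 1 H (flow_coef H a k) (Sword w).
    apply: (eq_cbr (n := n.+1)) => [u|u|//]; rewrite ltnS => un; first exact: HE.
    exact: eq_flow_coef HE un.
  rewrite cdiffB; case: k => [|k]; last by rewrite !scale0r addr0.
  by rewrite !scale1r invr1 !scale1r opprB addrA addrAC.
rewrite !(flowE _ _ _ (arity_le_word (leqnn (size w)))).
under eq_bigr do rewrite coefE expr1n scale1r.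
rewrite big_split; congr (_ + _); first by apply: eq_bigr => k _; rewrite expr1n scale1r.
have [w0|w0] := posnP (size w).
  have s0w : cdiff 0 s (Sword w) = 0 by rewrite (size0nil w0) Sword_nil linear0.
  by rewrite s0w big1 // => k _; rewrite scaler0.
rewrite (bigD1 (Ordinal (w0 : (1 < (size w).+1)%N))) //= scale1r big1 ?addr0 // => k.
by rewrite -val_eqE /= => /negbTE ->; rewrite scale0r.
Qed.

End FlowLocality.

(** * Morphisms that agree on a retract are homotopic *)

Section Uniqueness.
Variables (K : numFieldType) (a b h : dgLie K) (i : Linf a b).
Variables (r0 : {linear CEp b -> CEp a}) (ctr : {linear b -> b}).
Hypothesis ct : contractible_to i r0 ctr.
Variables A B : Linf b h.
Hypothesis AB : forall c, A (i c) = B (i c).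

Lemma flow_coef_pull (H : {linear CEp b -> h}) k c : (forall c, H (i c) = 0) ->
  flow_coef H (taylor A) k.+1 (i c) = 0.
Proof.
move=> Hi; rewrite flow_coefS.
pose Z : {linear CEp a -> h} := \0.
have Hc c' : Z c' = H (i c') by rewrite Hi.
pose f : {linear CEp a -> h} := flow_coef H (taylor A) k \o i.
have fc c' : f c' = flow_coef H (taylor A) k (i c') by [].
rewrite -(cbr_pull (Lmap_degree i) (Lmap_delta i) _ _ Hc fc).
rewrite cdiffE Lmap_d !Hi linear0 scaler0 subr0 scaler0 subr0.
rewrite (_ : cbr 1 Z f c = 0) ?scaler0 //.
pose Z' : {linear CEp a -> h} := \0.
rewrite -[RHS]/(Z' c) -[LHS]/(cbr 1 Z f c); apply: (Sp_ext (V := shift a 1)) => w.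
rewrite cbr_word -[RHS]/(0 : h) -[RHS](split_sum0 h w); apply: eq_split_sum => u v _ _.
by rewrite dgl_br0l scaler0.
Qed.

(** In the first arity where the time-one flow [A'] of [A] differs from [B], the difference is
    closed: both satisfy the Maurer-Cartan equation with the same quadratic term. It vanishes on the
    image of [i], so it is the differential of some [s], by which the generator is corrected. *)
Lemma homotopic_of_restriction : homotopic A B.
Proof.
pose good n (H : {linear CEp b -> h}) := [/\ has_degree 0 H, forall c, H (i c) = 0 &
  forall w, (size w <= n)%N -> flow H (taylor A) 1 (Sword w) = taylor B (Sword w)].
pose R n (H H' : {linear CEp b -> h}) :=
  forall w, (size w <= n)%N -> H' (Sword w) = H (Sword w).
have good0 : good 0%N \0.
  split=> [k x _||w]; [exact: homog0|by []|].
  by rewrite leqn0 => /nilP ->; rewrite Sword_nil !linear0.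
have A1 := taylor_degree A; have B1 := taylor_degree B.
have flow_i (H : {linear CEp b -> h}) t c : (forall c, H (i c) = 0) ->
    flow H (taylor A) t (i c) = taylor A (i c).
  move=> Hi; have [n cn] := arity_ex (V := shift b 1) (i c).
  rewrite (flowE _ _ _ cn) big_ord_recl expr0 scale1r big1 ?addr0 // => k _.
  by rewrite lift0 flow_coef_pull // scaler0.
have [|u uP] := dependent_choice (R := R) good0.
  move=> n H [H0 Hi Hn].
  pose E : {linear CEp b -> h} := taylor B \- flow H (taylor A) 1.
  have EE c : E c = taylor B c - flow H (taylor A) 1 c by [].
  have [|||| s [s0 sn si sd]] := contractible_solve ct (n := n) (p := 1) (t := E).
  - by move=> k x kx; rewrite EE; apply: homogB; [apply: B1 | apply: flow_degree].
  - by move=> w wn; rewrite EE Hn // subrr.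
  - by move=> c; rewrite EE flow_i // /taylor /= AB subrr.
  - move=> w wn; rewrite cdiffB.
    have := flow1_MC H0 A1 (taylor_MC A) (Sword w); have := taylor_MC B (Sword w).
    rewrite !curvE => /eqP; rewrite addr_eq0 => /eqP -> /eqP; rewrite addr_eq0 => /eqP ->.
    rewrite opprK addrC; apply/eqP; rewrite subr_eq0; apply/eqP; congr (_ *: _).
    by apply: (eq_cbr (n := n.+1)) => [v vn|v vn|]; rewrite ?Hn ?wn.
  exists (H \- s); last by move=> w wn /=; rewrite sn // subr0.
  split.
  - by move=> k x kx; apply: homogB; [apply: H0 | apply: s0].
  - by move=> c /=; rewrite Hi si subr0.
  - move=> w wn; rewrite (flow_perturb _ _ sn wn).
    move: wn; rewrite leq_eqVlt => /orP[/eqP wn|wn].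
      by rewrite -[cdiff 0 s _]/(cdiff (1 - 1) s _) sd // EE addrC subrK.
    by rewrite Hn // (cdiff0 (n := n) _ sn) // addr0.
have [H HE] : exists H : {linear CEp b -> h},
    forall n w, (size w <= n)%N -> H (Sword w) = u n (Sword w).
  exact: arity_limit (fun n => (uP n).2).
have H0 : has_degree 0 H.
  apply: has_degree_words => w; rewrite (HE (size w)) //.
  by apply: degree_word; case: (uP (size w)) => [[]].
exists H => //; exists (flow H (taylor A)); split.
- exact: flow_gauge.
- exact: flow0.
- apply: Sp_ext => w; have [_ _ <-//] := (uP (size w)).1.
  exact: eq_flow (HE (size w)) (leqnn _).
Qed.

End Uniqueness.

(** * Generalized inverses *)

Section Complement.
Variables (K : fieldType) (X : lmodType K).

Definition subspace (S : X -> Prop) := S 0 /\ forall k x y, S x -> S y -> S (k *: x + y).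

Variable S : X -> Prop.
Hypothesis SP : subspace S.

Lemma subspaceZ (T : X -> Prop) k x : subspace T -> T x -> T (k *: x).
Proof. by move=> [T0 TP] Tx; rewrite -[_ *: _]addr0; apply: TP. Qed.
Lemma subspaceB (T : X -> Prop) x y : subspace T -> T x -> T y -> T (x - y).
Proof. by move=> [T0 TP] Tx Ty; rewrite addrC -scaleN1r; apply: TP. Qed.

Let cand := {T : X -> Prop | subspace T /\ forall x, S x -> T x -> x = 0}.
Let le (T T' : cand) : bool := `[< forall x, sval T x -> sval T' x >].

(** A maximal subspace among those meeting [S] in 0 is a complement. *)
Lemma complement_ex : exists T : X -> Prop, [/\ subspace T, forall x, S x -> T x -> x =
  0 &
  forall x, exists y, S y /\ T (x - y)].
Proof.
have [||||T Tmax] := @classical_sets.Zorn cand le.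
- by move=> T; apply/asboolP.
- by move=> T T' T'' /asboolP h /asboolP h'; apply/asboolP => x /h /h'.
- move=> [T TP] [T' TP'] /asboolP h /asboolP h'; apply: eq_exist; apply/funext => x;
  apply/propext.
  by split; [apply: h | apply: h'].
- move=> A Atot.
  (* The clause [x = 0] makes the union a subspace for the empty chain too. *)
  pose U x := x = 0 \/ exists2 T : cand, A T & sval T x.
  have UP : subspace U /\ forall x, S x -> U x -> x = 0.
    split; last by move=> x Sx [//|[T _ Tx]]; apply: (svalP T).2.
    split=> [|k x y]; first by left.
    move=> [->|[T AT Tx]]; first by rewrite scaler0 add0r.
    move=> [->|[T' AT' Ty]].
      by right; exists T => //; rewrite addr0; apply: subspaceZ => //; case: (svalP T).
    right; have [/asboolP h|/asboolP h] := Atot _ _ AT AT'.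
      by exists T' => //; apply: (svalP T').1.2 => //; apply: h.
    by exists T => //; apply: (svalP T).1.2 => //; apply: h.
  by exists (exist _ U UP) => T AT; apply/asboolP => x Tx; right; exists T.
exists (sval T); split; [exact: (svalP T).1 | exact: (svalP T).2|] => x.
apply: contrapT => nx.
have [Tsub TS] := svalP T.
(* [T'] is [T] enlarged by [x]. If it met [S] nontrivially, [x] would be the sum of an element of
   [S] and one of [T]; otherwise maximality puts [x] in [T]. Both contradict [nx]. *)
pose T' z := exists k t, sval T t /\ z = k *: x + t.
have T'P : subspace T' /\ forall x, S x -> T' x -> x = 0.
  split; first split.
  - by exists 0, 0; split; [exact: Tsub.1 | rewrite scale0r addr0].
  - move=> c _ _ [k [t [Tt ->]]] [l [u [Tu ->]]]; exists (c * k + l), (c *: t + u); split.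
      exact: Tsub.2.
    by rewrite scalerDr scalerA scalerDl addrACA.
  move=> z Sz [k [t [Tt zE]]].
  have [k0|k0] := eqVneq k 0.
    by apply: TS => //; rewrite zE k0 scale0r add0r.
  case: nx; exists (k^-1 *: z); split; first exact: subspaceZ.
  have -> : x - k^-1 *: z = (- k^-1) *: t.
    by rewrite zE scalerDr scalerA mulVf // scale1r opprD addrA subrr add0r scaleNr.
  exact: subspaceZ.
have le' : le T (exist _ T' T'P).
  by apply/asboolP => t Tt; exists 0, t; split=> //; rewrite scale0r add0r.
case: nx; exists 0; split; first exact: SP.1.
rewrite subr0 -(Tmax _ le'); exists 1, 0; split; first exact: Tsub.1.
by rewrite scale1r addr0.
Qed.

Lemma projection_ex : exists pi : {linear X -> X},
  (forall x, S (pi x)) /\ (forall x, S x -> pi x = x).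
Proof.
have [T [TP TS Tx]] := complement_ex.
pose f x := projT1 (cid (Tx x)).
have fP x : S (f x) /\ T (x - f x) by rewrite /f; case: cid.
have fU x y : S y -> T (x - y) -> f x = y.
  move=> Sy Ty; have [Sf Tf] := fP x; apply/eqP; rewrite -subr_eq0; apply/eqP/TS.
    exact: subspaceB.
  have -> : f x - y = (x - y) - (x - f x) by rewrite opprB [RHS]addrC addrA subrK.
  exact: subspaceB.
have flin : linear f.
  move=> k x y; apply: fU; first by apply: SP.2; [case: (fP x) | case: (fP y)].
  have -> : k *: x + y - (k *: f x + f y) = k *: (x - f x) + (y - f y).
    by rewrite opprD addrACA scalerBr.
  by apply: TP.2; [case: (fP x) | case: (fP y)].
pose F : {linear X -> X} := HB.pack f (GRing.isLinear.Build K X X _ f flin).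
exists F; split=> x; first by case: (fP x).
by move=> Sx; apply: fU; rewrite ?subrr //; case: TP.
Qed.
End Complement.

Lemma generalized_inverse (K : fieldType) (X : lmodType K) (D : {linear X -> X}) :
  exists s : {linear X -> X}, forall x, D (s (D x)) = D x.
Proof.
have kerP : subspace (fun x => D x = 0).
  by split=> [|k x y Dx Dy]; rewrite ?linear0 // linearP Dx Dy scaler0 addr0.
have imP : subspace (fun y => exists x, D x = y).
  split=> [|k _ _ [x <-] [y <-]]; first by exists 0; rewrite linear0.
  by exists (k *: x + y); rewrite linearP.
have [pi [pi1 pi2]] := projection_ex kerP; have [rho [rho1 rho2]] := projection_ex imP.
(* The chosen preimage is not linear in [y], but subtracting its projection to the kernel leaves a
   vector that depends only on its image under [D]. *)
pose s y := let x := projT1 (cid (rho1 y)) in x - pi x.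
have sE y x : D x = rho y -> s y = x - pi x.
  rewrite /s; case: cid => x' /= Dx' Dx.
  have h : pi x' - pi x = x' - x.
    by rewrite -linearB; apply: pi2; rewrite linearB Dx Dx' subrr.
  have -> : x' - pi x' = (x - pi x) + ((x' - x) - (pi x' - pi x)).
    by rewrite opprB addrACA (addrC x) subrK addKr.
  by rewrite h subrr addr0.
have slin : linear s.
  move=> k y z; rewrite (sE (k *: y + z) (k *: projT1 (cid (rho1 y)) + projT1 (cid (rho1
    z)))).
    by rewrite /s linearP opprD addrACA scalerBr.
  by rewrite !linearP; case: cid => ? /= ->; case: cid => ? /= ->.
pose F : {linear X -> X} := HB.pack s (GRing.isLinear.Build K X X _ s slin).
exists F => x; rewrite -[F (D x)]/(s (D x)) (sE _ x); last by rewrite rho2 //; exists x.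
by rewrite linearB pi1 subr0.
Qed.

(** * Factorization through the cylinder *)

Lemma gproj_cover (K : fieldType) (V : gradedSpace K) (x : V) : exists s : seq int,
  forall s', uniq s' -> {subset s <= s'} -> \sum_(k <- s') gproj V k x = x.
Proof.
have [s us xE] := gproj_sum x; exists s => s' us' ss'.
rewrite [RHS]xE (bigID (fun k => k \in s)) /= [X in _ + X]big1 ?addr0; last first.
  move=> k ks; rewrite xE linear_sum big_seq big1 // => i si.
  by rewrite gprojM; case: eqP => // ki; rewrite ki si in ks.
rewrite -[LHS]big_filter; apply: perm_big; apply: uniq_perm => //.
  by rewrite filter_uniq.
by move=> k; rewrite mem_filter; case ks: (k \in s) => //=; rewrite ss'.
Qed.

Lemma degree_gproj (K : fieldType) (V W : gradedSpace K) p (f : {linear V -> W}) k x :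
  has_degree p f -> f (gproj V k x) = gproj W (k + p) (f x).
Proof.
move=> fp; have [s us xE] := gproj_sum x.
rewrite {2}xE !linear_sum.
have e i : gproj W (k + p) (f (gproj V i x)) = if k == i then f (gproj V k x) else 0.
  have fi : homog (i + p) (f (gproj V i x)) by apply/fp/gproj_homog.
  by rewrite -(eqP fi) gprojM (inj_eq (addIr p)) (eqP fi); case: eqP => // ->.
under eq_bigr do rewrite e.
have [ks|ks] := boolP (k \in s).
  rewrite (bigD1_seq k) //= eqxx big1 ?addr0 // => i /negbTE ik.
  by rewrite eq_sym ik.
rewrite big_seq big1; last by move=> i si; case: eqP => // ki; rewrite ki si in ks.
rewrite xE linear_sum big_seq big1 ?linear0 // => i si.
by rewrite gprojM; case: eqP => // ki; rewrite ki si in ks.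
Qed.

Section Cylinder.
Variables (K : numFieldType) (g1 g2 : dgLie K).

(* [g2] times the cone of [g1]; an element of degree [k] is [(y, (x, z))] with
   [y], [x] of degree [k] and [z] of degree [k + 1] *)
Definition cyl_mod : lmodType K := (g2 * (g1 * g1))%type.
Implicit Types u v : cyl_mod.

Lemma cyl_eq u v : u.1 = v.1 -> u.2.1 = v.2.1 -> u.2.2 = v.2.2 -> u = v.
Proof. by case: u v => [? [? ?]] [? [? ?]] /= -> -> ->. Qed.

Definition cyl_proj_fun k u : cyl_mod :=
  (gproj g2 k u.1, (gproj g1 k u.2.1, gproj g1 (k + 1) u.2.2)).
Lemma cyl_proj_linear k : linear (cyl_proj_fun k).
Proof. by move=> a u v; rewrite /cyl_proj_fun !linearP. Qed.
HB.instance Definition _ k :=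
  GRing.isLinear.Build K cyl_mod cyl_mod _ (cyl_proj_fun k) (cyl_proj_linear k).
Definition cyl_proj k : {linear cyl_mod -> cyl_mod} := cyl_proj_fun k.

Lemma cyl_projM i j u : cyl_proj i (cyl_proj j u) = if i == j then cyl_proj j u else 0.
Proof.
rewrite /cyl_proj /= /cyl_proj_fun /= !gprojM (inj_eq (addIr 1)).
by case: eqP.
Qed.

Lemma cyl_sum1 (s : seq int) (F : int -> cyl_mod) :
  [/\ (\sum_(k <- s) F k).1 = \sum_(k <- s) (F k).1,
      (\sum_(k <- s) F k).2.1 = \sum_(k <- s) (F k).2.1 &
      (\sum_(k <- s) F k).2.2 = \sum_(k <- s) (F k).2.2].
Proof.
by elim: s => [|k s [IH1 IH2 IH3]]; rewrite ?big_nil // !big_cons /= IH1 IH2 IH3.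
Qed.

Lemma cyl_proj_sum u : exists2 s : seq int, uniq s & u = \sum_(k <- s) cyl_proj k u.
Proof.
have [s1 s1P] := gproj_cover u.1; have [s2 s2P] := gproj_cover u.2.1.
have [s3 s3P] := gproj_cover u.2.2.
pose s := undup (s1 ++ s2 ++ [seq k - 1 | k <- s3]).
have us : uniq s by apply: undup_uniq.
exists s => //; have [e1 e2 e3] := cyl_sum1 s (cyl_proj^~ u).
apply: cyl_eq; rewrite ?e1 ?e2 ?e3 /=.
- by rewrite s1P // => k ks; rewrite mem_undup mem_cat ks.
- by rewrite s2P // => k ks; rewrite mem_undup !mem_cat ks orbT.
rewrite -(big_map (fun k => k + 1) xpredT (fun k => gproj g1 k u.2.2)) s3P //.
  by rewrite map_inj_uniq //; apply: addIr.
move=> k ks; apply/mapP; exists (k - 1); last by rewrite subrK.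
by rewrite mem_undup !mem_cat (map_f (fun k => k - 1) ks) !orbT.
Qed.

Definition cyl_space : gradedSpace K := GradedSpace cyl_projM cyl_proj_sum.

Lemma cyl_homog k (u : cyl_space) : homog k u <->
  [/\ homog k u.1, homog k u.2.1 & homog (k + 1) u.2.2].
Proof.
split=> [/eqP e|[h1 h2 h3]]; last by apply/eqP/cyl_eq; apply/eqP.
by split; rewrite -e; apply: gproj_homog.
Qed.

(** The second and third slots form the cone of the identity of [g1]. *)
Definition cyl_d_fun (u : cyl_space) : cyl_space :=
  (dgl_d g2 u.1, (dgl_d g1 u.2.1 + u.2.2, - dgl_d g1 u.2.2)).
Lemma cyl_d_linear : linear cyl_d_fun.
Proof.
move=> a u v; apply: cyl_eq; rewrite /cyl_d_fun /= ?linearP //.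
by rewrite scalerDr addrACA.
Qed.
HB.instance Definition _ :=
  GRing.isLinear.Build K cyl_space cyl_space _ cyl_d_fun cyl_d_linear.
Definition cyl_d : {linear cyl_space -> cyl_space} := cyl_d_fun.

(** The cone is abelian: the Maurer-Cartan equation is linear in its components, and [cyl_i] can be
    written down explicitly. *)
Definition cyl_br (u v : cyl_space) : cyl_space := (dgl_br u.1 v.1, (0, 0)).

Lemma cyl_br_bilin : bilin cyl_br.
Proof.
by split=> [w a x y|w a x y]; apply: cyl_eq;
  rewrite /cyl_br /= ?dgl_brDl ?dgl_brDr ?dgl_brZl ?dgl_brZr // scaler0 addr0.
Qed.

Lemma cyl_d_degree : has_degree 1 cyl_d.
Proof.
move=> k u /cyl_homog [h1 h2 h3]; apply/cyl_homog; split.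
- exact: dgl_d_degree h1.
- by apply: homogD => //; apply: dgl_d_degree h2.
- by apply: homogN; apply: dgl_d_degree h3.
Qed.

Lemma cyl_br_degree i j u v : homog (V := cyl_space) i u -> homog (V := cyl_space) j v ->
  homog (V := cyl_space) (i + j) (cyl_br u v).
Proof.
move=> /cyl_homog [h1 _ _] /cyl_homog [h1' _ _]; apply/cyl_homog; split.
- exact: dgl_br_degree.
- exact: homog0.
- exact: homog0.
Qed.

Lemma cyl_dd u : cyl_d (cyl_d u) = 0.
Proof.
apply: cyl_eq; rewrite /= ?dgl_dd //.
  by rewrite linearD dgl_dd add0r subrr.
by rewrite linearN dgl_dd !oppr0.
Qed.

Lemma cyl_antisym i j u v : homog (V := cyl_space) i u -> homog (V := cyl_space) j v ->
  cyl_br u v = - ((-1) ^ (i * j) *: cyl_br v u).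
Proof.
move=> /cyl_homog [h1 _ _] /cyl_homog [h1' _ _]; apply: cyl_eq => /=.
- exact: dgl_antisym.
- by rewrite scaler0 oppr0.
- by rewrite scaler0 oppr0.
Qed.

Lemma cyl_jacobi i j k (u v w : cyl_space) : homog i u -> homog j v -> homog k w ->
  cyl_br u (cyl_br v w) =
    cyl_br (cyl_br u v) w + (-1) ^ (i * j) *: cyl_br v (cyl_br u w).
Proof.
move=> /cyl_homog [h1 _ _] /cyl_homog [h2 _ _] /cyl_homog [h3 _ _]; apply: cyl_eq => /=.
- exact: dgl_jacobi h3.
- by rewrite scaler0 addr0.
- by rewrite scaler0 addr0.
Qed.

Lemma cyl_leibniz i (u v : cyl_space) : homog i u ->
  cyl_d (cyl_br u v) = cyl_br (cyl_d u) v + (-1) ^ i *: cyl_br u (cyl_d v).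
Proof.
move=> /cyl_homog [h1 _ _]; apply: cyl_eq => /=.
- exact: dgl_leibniz.
- by rewrite linear0 scaler0 !addr0.
- by rewrite linear0 oppr0 scaler0 addr0.
Qed.

Definition cyl : dgLie K := DgLie cyl_br_bilin cyl_d_degree cyl_br_degree cyl_dd
  cyl_antisym cyl_jacobi cyl_leibniz.

Definition cyl_y_fun (u : cyl) : g2 := u.1.
Lemma cyl_y_linear : linear cyl_y_fun. Proof. by []. Qed.
HB.instance Definition _ := GRing.isLinear.Build K cyl g2 _ cyl_y_fun cyl_y_linear.
Definition cyl_y : {linear cyl -> g2} := cyl_y_fun.

Definition cyl_x_fun (u : cyl) : g1 := u.2.1.
Lemma cyl_x_linear : linear cyl_x_fun. Proof. by []. Qed.
HB.instance Definition _ := GRing.isLinear.Build K cyl g1 _ cyl_x_fun cyl_x_linear.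
Definition cyl_x : {linear cyl -> g1} := cyl_x_fun.

Definition cyl_z_fun (u : cyl) : g1 := u.2.2.
Lemma cyl_z_linear : linear cyl_z_fun. Proof. by []. Qed.
HB.instance Definition _ := GRing.isLinear.Build K cyl g1 _ cyl_z_fun cyl_z_linear.
Definition cyl_z : {linear cyl -> g1} := cyl_z_fun.

Definition cyl_in_fun (y : g2) : cyl := (y, (0, 0)).
Lemma cyl_in_linear : linear cyl_in_fun.
Proof. by move=> a x y; apply: cyl_eq => //=; rewrite scaler0 addr0. Qed.
HB.instance Definition _ := GRing.isLinear.Build K g2 cyl _ cyl_in_fun cyl_in_linear.
Definition cyl_in : {linear g2 -> cyl} := cyl_in_fun.

End Cylinder.

Section Strict.
Variables (K : numFieldType) (g h k : dgLie K) (phi : {linear h -> k}).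
Hypotheses (phi0 : has_degree 0 phi) (phi_d : forall x, phi (dgl_d h x) = dgl_d k (phi x))
  (phi_br : forall x y, phi (dgl_br x y) = dgl_br (phi x) (phi y)).

Lemma curv_strict (t : {linear CEp g -> h}) (t' : {linear CEp g -> k}) c :
  (forall c, t' c = phi (t c)) -> curv t' c = phi (curv t c).
Proof.
move=> tE; rewrite !curvE linearD !cdiffE linearB !(lin_scale phi) !tE phi_d;
  congr (_ + _ *: _).
pose T : {linear CEp g -> k} := phi \o cbr 1 t t.
rewrite -[RHS]/(T c); apply: (Sp_ext (V := shift g 1)) => w;
  rewrite -[RHS]/(phi (cbr 1 t t (Sword w))).
rewrite !cbr_word /wbr split_sum_lin; apply: eq_split_sum => a b _ _.
by rewrite lin_scale phi_br /onw !tE.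
Qed.

End Strict.

Section LinearPart.
Variables (K : numFieldType) (g h : dgLie K) (F : Linf g h).
Local Notation V := (shift g 1).

Definition lin_part : {linear g -> h} := taylor F \o Siota V.

Lemma lin_partE (x : letter V) : lin_part (lval x) = taylor F (Sword [:: x]).
Proof. by rewrite -[LHS]/(taylor F (Siota V (lval x))) SiotaE. Qed.

Lemma homog_shift k x : homog (V := g) k x -> homog (V := V) (k - 1) x.
Proof. by rewrite /homog /= addrC subrK. Qed.

Lemma lin_part_degree : has_degree 0 lin_part.
Proof.
move=> k x kx; have := degree_word [:: Letter (homog_shift kx)] (taylor_degree F).
by rewrite -lin_partE wdeg_cons /wdeg big_nil !addr0 /= subrK.
Qed.

(** The Maurer-Cartan equation in arity one, where the bracket vanishes. *)
Lemma lin_part_d x : lin_part (dgl_d g x) = dgl_d h (lin_part x).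
Proof.
pose T : {linear g -> h} := lin_part \o dgl_d g.
pose T' : {linear g -> h} := dgl_d h \o lin_part.
rewrite -[LHS]/(T x) -[RHS]/(T' x); apply: homog_ext => {}k {}x kx.
rewrite -[LHS]/(lin_part (lval (dletter (Letter (homog_shift kx))))).
rewrite -[RHS]/(dgl_d h (lin_part (lval (Letter (homog_shift kx))))) !lin_partE.
set l := Letter _.
have := taylor_MC F (Sword [:: l]); rewrite curvE cdiffE.
have -> : cbr 1 (taylor F) (taylor F) (Sword [:: l]) = 0.
  rewrite cbr_word; apply: (@wbr0 _ _ _ _ _ _ 1) => [||u|]; rewrite ?onw_nil //.
  by rewrite ltnS leqn0 => /nilP ->; rewrite onw_nil.
rewrite scaler0 addr0 expr1z scaleN1r opprK CEd_word wsum_lin d_sum_cons.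
by rewrite /wsum !big_nil scaler0 !addr0 => /eqP; rewrite subr_eq0 => /eqP.
Qed.

Lemma taylor1E k x : homog k x -> taylor1 F k x = lin_part x.
Proof.
move=> kx; rewrite -[x in RHS]/(lval (Letter (homog_shift kx))) lin_partE.
congr (taylor F (Sword [:: _])); apply: letter_eq => //=.
exact/eqP/homog_shift.
Qed.

End LinearPart.

Section CylinderMaps.
Variables (K : numFieldType) (g1 g2 : dgLie K) (F : Linf g1 g2).
Local Notation C := (cyl g1 g2).

Lemma cyl_y_degree : has_degree 0 (cyl_y g1 g2).
Proof. by move=> k u /cyl_homog [h _ _]; rewrite addr0. Qed.
Lemma cyl_x_degree : has_degree 0 (cyl_x g1 g2).
Proof. by move=> k u /cyl_homog [_ h _]; rewrite addr0. Qed.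
Lemma cyl_in_degree : has_degree 0 (cyl_in g1 g2).
Proof.
move=> k y ky; apply/cyl_homog; split; rewrite ?addr0 //; exact: homog0.
Qed.
Lemma cyl_in_d y : cyl_in g1 g2 (dgl_d g2 y) = dgl_d C (cyl_in g1 g2 y).
Proof. by apply: cyl_eq => //=; rewrite linear0 ?addr0 ?oppr0. Qed.

Definition cyl_p_taylor : {linear CEp C -> g2} := cyl_y g1 g2 \o CEproj C.
Lemma cyl_p_degree : has_degree 1 cyl_p_taylor.
Proof. by move=> k c kc; have := cyl_y_degree (CEproj_degree kc); rewrite addr0. Qed.
Lemma cyl_p_MC : MC cyl_p_taylor.
Proof.
move=> c; rewrite (curv_strict (phi := cyl_y g1 g2) _ _ (t := CEproj C)) //.
by rewrite curvE CEproj_MC linear0.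
Qed.
Definition cyl_p : Linf C g2 := Linf_of_MC cyl_p_degree cyl_p_MC.

Definition cyl_s_taylor : {linear CEp g2 -> C} := cyl_in g1 g2 \o CEproj g2.
Lemma cyl_s_degree : has_degree 1 cyl_s_taylor.
Proof. by move=> k c kc; have := cyl_in_degree (CEproj_degree kc); rewrite addr0. Qed.
Lemma cyl_s_MC : MC cyl_s_taylor.
Proof.
move=> c; rewrite (curv_strict (phi := cyl_in g1 g2) _ _ (t := CEproj g2)) //.
- by rewrite curvE CEproj_MC linear0.
- exact: cyl_in_d.
Qed.
Definition cyl_s : Linf g2 C := Linf_of_MC cyl_s_degree cyl_s_MC.

(* The last component is forced by the Maurer-Cartan equation in the cone. *)
Definition cyl_i_fun (c : CEp g1) : C :=
  (taylor F c, (CEproj g1 c, - cdiff 1 (CEproj g1) c)).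
Lemma cyl_i_linear : linear cyl_i_fun.
Proof.
move=> a x y; apply: cyl_eq; [exact: linearP | exact: linearP |].
rewrite -[LHS]/(- cdiff 1 (CEproj g1) (a *: x + y)).
rewrite -[RHS]/(a *: - cdiff 1 (CEproj g1) x - cdiff 1 (CEproj g1) y).
by rewrite linearP opprD scalerN.
Qed.
HB.instance Definition _ := GRing.isLinear.Build K (CEp g1) C _ cyl_i_fun cyl_i_linear.
Definition cyl_i_taylor : {linear CEp g1 -> C} := cyl_i_fun.

Lemma cyl_i_degree : has_degree 1 cyl_i_taylor.
Proof.
move=> k c kc; apply/cyl_homog; split.
- exact: taylor_degree kc.
- exact: CEproj_degree kc.
- by apply: homogN; have := cdiff_degree (@CEproj_degree _ g1) kc; rewrite addrA.
Qed.

Lemma cyl_i_MC : MC cyl_i_taylor.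
Proof.
move=> c.
have br0 : cyl_x g1 g2 (cbr 1 cyl_i_taylor cyl_i_taylor c) = 0 /\
           cyl_z g1 g2 (cbr 1 cyl_i_taylor cyl_i_taylor c) = 0.
  pose Tx : {linear CEp g1 -> g1} := cyl_x g1 g2 \o cbr 1 cyl_i_taylor cyl_i_taylor.
  pose Tz : {linear CEp g1 -> g1} := cyl_z g1 g2 \o cbr 1 cyl_i_taylor cyl_i_taylor.
  pose Z : {linear CEp g1 -> g1} := \0.
  split.
    rewrite -[LHS]/(Tx c) -[RHS]/(Z c); apply: (Sp_ext (V := shift g1 1)) => w.
    rewrite -[LHS]/(cyl_x g1 g2 (cbr 1 cyl_i_taylor cyl_i_taylor (Sword w))) -[RHS]/(0 :
      g1).
    rewrite cbr_word split_sum_lin -[RHS](split_sum0 g1 w);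
      apply: eq_split_sum => a b _ _.
    by rewrite lin_scale -[cyl_x _ _ _]/(0 : g1) scaler0.
  rewrite -[LHS]/(Tz c) -[RHS]/(Z c); apply: (Sp_ext (V := shift g1 1)) => w.
  rewrite -[LHS]/(cyl_z g1 g2 (cbr 1 cyl_i_taylor cyl_i_taylor (Sword w))) -[RHS]/(0 :
    g1).
  rewrite cbr_word split_sum_lin -[RHS](split_sum0 g1 w); apply: eq_split_sum => a b _ _.
  by rewrite lin_scale -[cyl_z _ _ _]/(0 : g1) scaler0.
have [brx brz] := br0.
apply: cyl_eq.
- rewrite -[LHS]/(cyl_y g1 g2 (curv cyl_i_taylor c)).
  by rewrite -(curv_strict (phi := cyl_y g1 g2) _ _ (t' := taylor F)) // taylor_MC.
- rewrite -[LHS]/(cyl_x g1 g2 (curv cyl_i_taylor c)) curvE linearD lin_scale brx scaler0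
  addr0.
  rewrite -[LHS]/((dgl_d g1 (CEproj g1 c) - cdiff 1 (CEproj g1) c) - (-1) ^ 1 *: CEproj
    g1 (CEd g1 c)).
  by rewrite addrAC -cdiffE subrr.
- rewrite -[LHS]/(cyl_z g1 g2 (curv cyl_i_taylor c)) curvE linearD lin_scale brz scaler0
  addr0.
  rewrite -[LHS]/(- dgl_d g1 (- cdiff 1 (CEproj g1) c) - (-1) ^ 1 *: (- cdiff 1 (CEproj
    g1) (CEd g1 c))).
  rewrite !cdiffE CEd_CEd linear0 scaler0 subr0 linearN opprK linearB dgl_dd sub0r.
  rewrite (lin_scale (dgl_d g1)) expr1z !scaleN1r !opprK.
  by rewrite subrr.
Qed.

Definition cyl_i : Linf g1 C := Linf_of_MC cyl_i_degree cyl_i_MC.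

Lemma cyl_pi c : cyl_p (cyl_i c) = F c.
Proof.
apply: (Linf_ext (F := Linf_comp cyl_p cyl_i)) => {}c.
rewrite -[LHS]/(taylor cyl_p (cyl_i c)) taylor_of_MC.
by rewrite -[LHS]/(cyl_y g1 g2 (taylor cyl_i c)) taylor_of_MC.
Qed.

Lemma cyl_ps c : cyl_p (cyl_s c) = c.
Proof.
apply: (Linf_ext (F := Linf_comp cyl_p cyl_s) (G := Linf_id g2)) => {}c.
rewrite -[LHS]/(taylor cyl_p (cyl_s c)) taylor_of_MC.
by rewrite -[LHS]/(cyl_y g1 g2 (taylor cyl_s c)) taylor_of_MC.
Qed.

(** The contracting homotopy of the cone; the associated [ctrP] is the identity on the cone and 0 on
    [g2]. *)
Definition cyl_s_ctr_fun (u : C) : C := (0, (0, u.2.1)).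
Lemma cyl_s_ctr_linear : linear cyl_s_ctr_fun.
Proof. by move=> a u v; apply: cyl_eq => //=; rewrite scaler0 addr0. Qed.
HB.instance Definition _ := GRing.isLinear.Build K C C _ cyl_s_ctr_fun cyl_s_ctr_linear.
Definition cyl_s_ctr : {linear C -> C} := cyl_s_ctr_fun.

Lemma cyl_s_ctrP u : ctrP cyl_s_ctr u = (0, (u.2.1, u.2.2)) :> C.
Proof.
apply: cyl_eq; rewrite /ctrP /= ?linear0 ?addr0 ?add0r //.
by rewrite addrA addNr add0r.
Qed.

Lemma cyl_s_contractible : contractible_to cyl_s cyl_p cyl_s_ctr.
Proof.
have pD := Lmap_degree cyl_p; have pC := Lmap_delta cyl_p.
have sE c : CEproj C (cyl_s c) = cyl_in g1 g2 (CEproj g2 c).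
  by rewrite -[LHS]/(taylor cyl_s c) taylor_of_MC.
have pE c : CEproj g2 (cyl_p c) = cyl_y g1 g2 (CEproj C c).
  by rewrite -[LHS]/(taylor cyl_p c) taylor_of_MC.
split=> //.
- move=> k u /cyl_homog [h1 h2 h3]; apply/cyl_homog; split; try exact: homog0.
  by rewrite subrK.
- by move=> u; rewrite cyl_s_ctrP.
- exact: cyl_ps.
- by move=> x; rewrite sE cyl_s_ctrP.
- move=> x; rewrite cyl_s_ctrP sE pE CEproj_word => -[e1 e2].
  by apply: cyl_eq => //=; rewrite -?e1 -?e2.
Qed.

End CylinderMaps.

Section GluedDegree.
Variables (K : fieldType) (V : gradedSpace K) (p : int) (s : {linear V -> V}).

Lemma degree_part_linear k : linear (fun x => gproj V (k + p) (s x)).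
Proof. by move=> a x y; rewrite !linearP. Qed.
(** The component of degree [p] of any linear map, used because a generalized inverse obtained by
    choice need not be homogeneous. *)
Definition degree_part : {linear V -> V} := glue degree_part_linear.

Lemma degree_partE k x : homog k x -> degree_part x = gproj V (k + p) (s x).
Proof. by move=> kx; rewrite /degree_part (glueE _ kx). Qed.

Lemma degree_part_degree : has_degree p degree_part.
Proof. by move=> k x kx; rewrite (degree_partE kx); apply: gproj_homog. Qed.

End GluedDegree.

Section Contraction.
Variables (K : numFieldType) (g1 g2 : dgLie K) (f : {linear g1 -> g2}).
Hypotheses (f_degree : has_degree 0 f) (f_d : forall x, f (dgl_d g1 x) = dgl_d g2 (f x)).
Hypotheses (f_inj : forall k x, cocycle k x -> cohomologous k (f x) 0 -> cohomologous k
  x 0)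
  (f_sur : forall k y, cocycle k y -> exists2 x, cocycle k x & cohomologous k (f x) y).
Local Notation C := (cyl g1 g2).

(* Projection of the cylinder with kernel the image of the linear part of
   [cyl_i], and the induced differential on its image, the cone of [f]. *)
Definition cyl_q_fun (u : C) : C := (u.1 - f u.2.1, (0, u.2.2)).
Lemma cyl_q_linear : linear cyl_q_fun.
Proof.
move=> a u v; apply: cyl_eq; rewrite /= ?scaler0 ?addr0 //.
by rewrite (linearP f) opprD scalerBr addrACA.
Qed.
HB.instance Definition _ := GRing.isLinear.Build K C C _ cyl_q_fun cyl_q_linear.
Definition cyl_q : {linear C -> C} := cyl_q_fun.

Lemma cyl_qq u : cyl_q (cyl_q u) = cyl_q u.
Proof. by apply: cyl_eq; rewrite //= linear0 subr0. Qed.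

(** The linear part of [cyl_i]; the last slot is 0 because the differential of [CEproj] vanishes on
    one letter. *)
Definition cyl_j_fun (x : g1) : C := (f x, (x, 0)).
Lemma cyl_j_linear : linear cyl_j_fun.
Proof. by move=> a x y; apply: cyl_eq; rewrite /= ?linearP // scaler0 addr0. Qed.
HB.instance Definition _ := GRing.isLinear.Build K g1 C _ cyl_j_fun cyl_j_linear.
Definition cyl_j : {linear g1 -> C} := cyl_j_fun.

Lemma cyl_qj x : cyl_q (cyl_j x) = 0.
Proof. by apply: cyl_eq; rewrite //= subrr. Qed.

Lemma cyl_decomp u : u = cyl_q u + cyl_j (cyl_x g1 g2 u).
Proof. by apply: cyl_eq; rewrite /= ?subrK ?add0r ?addr0. Qed.

Lemma cyl_dj x : dgl_d C (cyl_j x) = cyl_j (dgl_d g1 x).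
Proof.
by apply: cyl_eq; rewrite /= ?linear0 ?addr0 ?oppr0.
Qed.

Lemma cyl_q_degree : has_degree 0 cyl_q.
Proof.
move=> k u /cyl_homog [h1 h2 h3]; rewrite addr0; apply/cyl_homog; split=> //=.
- by apply: homogB => //; have := f_degree h2; rewrite addr0.
- exact: homog0.
Qed.

Definition cyl_D : {linear C -> C} := cyl_q \o (dgl_d C \o cyl_q).

Lemma cyl_DE u : cyl_D u = cyl_q (dgl_d C u).
Proof.
rewrite [u in RHS]cyl_decomp linearD cyl_dj linearD cyl_qj addr0.
by [].
Qed.

Lemma cyl_qD u : cyl_q (cyl_D u) = cyl_D u.
Proof. by rewrite cyl_DE cyl_qq. Qed.

Lemma cyl_Dq u : cyl_D (cyl_q u) = cyl_D u.
Proof. by rewrite -[LHS]/(cyl_q (dgl_d C (cyl_q (cyl_q u)))) cyl_qq. Qed.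

Lemma cyl_DD u : cyl_D (cyl_D u) = 0.
Proof.
rewrite (cyl_DE (cyl_D u)) -[X in cyl_q (dgl_d C X)]/(cyl_D u) cyl_DE.
rewrite -cyl_DE cyl_Dq.
by rewrite cyl_DE dgl_dd linear0.
Qed.

Lemma cyl_D_degree : has_degree 1 cyl_D.
Proof.
move=> k u ku; rewrite cyl_DE.
by have := cyl_q_degree (dgl_d_degree ku); rewrite addr0.
Qed.

(** The cone of a quasi-isomorphism is acyclic. From [f z = dy], injectivity on cohomology gives
    [z = dw]; the cocycle [y - f w] is then [f v - dt] by surjectivity, and [t], [w], [v] assemble
    into a primitive. *)
Lemma cyl_acyclic_homog k u : homog k u -> cyl_q u = u -> cyl_D u = 0 ->
  exists v, cyl_D v = u.
Proof.
case: u => [y [x z]] /cyl_homog [hy hx hz] qu Du; rewrite /= in hy hx hz.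
have x0 : 0 = x := congr1 (fun u : C => u.2.1) qu.
have e := cyl_DE (y, (x, z)); rewrite Du -{}x0 in e.
have d1 : 0 = dgl_d g2 y - f (dgl_d g1 0 + z) := congr1 (fun u : C => u.1) e.
have d2 : 0 = - dgl_d g1 z := congr1 (fun u : C => u.2.2) e.
rewrite linear0 add0r in d1.
have dz : dgl_d g1 z = 0 by apply/eqP; rewrite -oppr_eq0 -d2.
have dy : dgl_d g2 y = f z by apply/eqP; rewrite -subr_eq0 -d1.
have [||w hw zw] := f_inj (k := k + 1) (x := z).
- by split.
- by exists y; rewrite ?addrK // subr0 dy.
rewrite subr0 in zw; rewrite addrK in hw.
have [|v [hv dv] [t ht vt]] := f_sur (k := k) (y := y - f w).
- split; first by apply: homogB => //; have := f_degree hw; rewrite addr0.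
  by rewrite linearB -f_d -zw dy subrr.
exists ((- t, (0, - (w + v))) : C); rewrite cyl_DE; apply: cyl_eq.
- rewrite -[LHS]/(dgl_d g2 (- t) - f (dgl_d g1 0 + - (w + v))).
  rewrite linear0 add0r !linearN linearD opprK -vt.
  by rewrite opprB (addrC (f w)) addrA subrK subrK.
- exact: (congr1 (fun u : C => u.2.1) qu).
- by rewrite /= linearN opprK linearD dv addr0 -zw.
Qed.

Lemma cyl_acyclic u : cyl_q u = u -> cyl_D u = 0 -> exists v, cyl_D v = u.
Proof.
move=> qu Du; have [s us uE] := gproj_sum u.
suff [v vE] : exists v, cyl_D v = \sum_(k <- s) gproj C k u by exists v; rewrite vE -uE.
elim: {us uE} s => [|k s [v vE]]; first by exists 0; rewrite big_nil linear0.
have [||w wE] := cyl_acyclic_homog (@gproj_homog K C k u).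
- by rewrite (degree_gproj k u cyl_q_degree) addr0 qu.
- by rewrite (degree_gproj k u cyl_D_degree) Du linear0.
by exists (w + v); rewrite linearD vE wE big_cons.
Qed.

Lemma cyl_i_contraction : exists ctr : {linear C -> C}, [/\ has_degree (-1) ctr,
  forall u, ctr (ctrP ctr u) = ctr u, forall x, ctrP ctr (cyl_j x) = 0 &
  forall u, ctrP ctr u = 0 -> u = cyl_j (cyl_x g1 g2 u)].
Proof.
have [s0 s0P] := generalized_inverse cyl_D.
(* [cyl_D] is homogeneous of degree 1, so the part of degree -1 of a generalized inverse is still
   one, as [sP] checks. *)
pose s1 := degree_part (-1) s0.
pose s : {linear C -> C} := cyl_q \o (s1 \o cyl_q).
have sE u : s u = cyl_q (s1 (cyl_q u)) by [].
have sP u : cyl_D (s (cyl_D u)) = cyl_D u.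
  rewrite sE cyl_Dq cyl_qD.
  pose T : {linear C -> C} := cyl_D \o (s1 \o cyl_D).
  rewrite -[LHS]/(T u); apply: homog_ext => k x kx.
  rewrite -[LHS]/(cyl_D (s1 (cyl_D x))) (degree_partE _ _ (cyl_D_degree kx)) addrK.
  rewrite (degree_gproj k _ cyl_D_degree) s0P.
  exact/eqP/cyl_D_degree.
(* On the image of [cyl_q], the map [cyl_q - s cyl_D] projects onto the cycles, which are boundaries
   by acyclicity; [s] then inverts [cyl_D] on them. *)
pose c : {linear C -> C} := s \o (cyl_q \- (s \o cyl_D)).
have cE u : c u = s (cyl_q u - s (cyl_D u)) by [].
have sdeg : has_degree (-1) s.
  move=> k x kx; have := cyl_q_degree (degree_part_degree (-1) s0 (cyl_q_degree kx)).
  by rewrite !addr0.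
have qs u : cyl_q (s u) = s u by rewrite sE cyl_qq.
have homotopy u : cyl_D (c u) + c (cyl_D u) = cyl_q u.
  rewrite !cE cyl_DD linear0 subr0 cyl_qD.
  have [||v vE] := @cyl_acyclic (cyl_q u - s (cyl_D u)).
  - by rewrite linearB cyl_qq qs.
  - by rewrite linearB cyl_Dq sP subrr.
  by rewrite -vE sP vE subrK.
have qc u : cyl_q (c u) = c u by rewrite cE qs.
have cq u : c (cyl_q u) = c u by rewrite !cE cyl_qq cyl_Dq.
have cj x : c (cyl_j x) = 0 by rewrite -cq cyl_qj linear0.
have Pj x : ctrP c (cyl_j x) = 0 by rewrite /ctrP cj cyl_dj cj linear0 addr0.
(* [ctrP c] uses the full differential and may differ from [cyl_q] by a term in the image of
   [cyl_j]; [c] does not see that term. *)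
have qP u : cyl_q (ctrP c u) = cyl_q u.
  rewrite /ctrP linearD qc -cyl_DE -(homotopy u); congr (_ + _).
  by rewrite -[LHS]cq -cyl_DE.
exists c; split=> //.
- move=> k u ku; rewrite cE; apply: (sdeg); apply: homogB.
    by have := cyl_q_degree ku; rewrite addr0.
  by have := sdeg _ _ (cyl_D_degree ku); rewrite addrK.
- by move=> u; rewrite -cq qP cq.
- by move=> u Pu; rewrite {1}[u]cyl_decomp -qP Pu linear0 add0r.
Qed.

End Contraction.

Section Factorization.
Variables (K : numFieldType) (g1 g2 : dgLie K) (F : Linf g1 g2).
Hypothesis hF : Linf_qiso F.
Local Notation C := (cyl g1 g2).

Lemma lin_part_inj k x : cocycle k x -> cohomologous k (lin_part F x) 0 -> cohomologous
  k x 0.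
Proof.
move=> xk fx; have [inj _] := hF k; apply: inj => //.
  by split; [exact: homog0 | exact: linear0].
by rewrite !taylor1E ?linear0 //; [exact: homog0 | case: xk].
Qed.

Lemma lin_part_sur k y : cocycle k y ->
  exists2 x, cocycle k x & cohomologous k (lin_part F x) y.
Proof.
move=> yk; have [_ sur] := hF k; have [x xk xy] := sur y yk; exists x => //.
by move: xy; rewrite (taylor1E F xk.1).
Qed.

Lemma cyl_i_contractible : exists (f0 : {linear CEp C -> g1}) (r0 : {linear CEp C -> CEp
  g1})
    (ctr : {linear C -> C}), [/\ has_degree 1 f0,
  forall c, f0 (cyl_i F c) = CEproj g1 c & contractible_to (cyl_i F) r0 ctr].
Proof.
have [ctr [cd cP cj cker]] := cyl_i_contraction (lin_part_degree F) (lin_part_d F)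
  lin_part_inj lin_part_sur.
pose f0 : {linear CEp C -> g1} := cyl_x g1 g2 \o CEproj C.
have f01 : has_degree 1 f0.
  by move=> k c kc; have := cyl_x_degree (CEproj_degree kc); rewrite addr0.
have f0i c : f0 (cyl_i F c) = CEproj g1 c.
  rewrite -[LHS]/(cyl_x g1 g2 (taylor (cyl_i F) c)).
  by rewrite taylor_of_MC.
(* A retraction of coalgebras only: the first coordinate of the cone is not a chain map. Making it
   compatible with the differentials is the task of [Linf_retraction]. *)
pose r0 : {linear CEp C -> CEp g1} := cexp (V := shift C 1) f01.
have r0d : has_degree 0 r0 by exact: cexp_degree.
have r0c : coalg_map (V := shift C 1) (W := shift g1 1) r0 by exact: cexp_coalg.
have lin x : CEproj C (cyl_i F (r0 (Sword [:: x]))) = cyl_j (lin_part F) (cyl_x g1 g2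
  (lval x)).
  rewrite (coalg_letter r0d r0c) -[LHS]/(taylor (cyl_i F) (Sword [:: lin_letter r0d x])).
  have yE : lval (lin_letter r0d x) = cyl_x g1 g2 (lval x).
    rewrite -[LHS]/(CEproj g1 (r0 (Sword [:: x]))) cexp_proj.
    by rewrite -[LHS]/(cyl_x g1 g2 (CEproj C (Sword [:: x]))) CEproj_word.
  rewrite taylor_of_MC; apply: cyl_eq.
  - rewrite -[LHS]/(taylor F (Sword [:: lin_letter r0d x])) -lin_partE yE.
    by [].
  - by rewrite -[LHS]/(CEproj g1 (Sword [:: lin_letter r0d x])) CEproj_word -yE.
  - rewrite -[LHS]/(- cdiff 1 (CEproj g1) (Sword [:: lin_letter r0d x])) -[RHS]/(0 : g1).
    rewrite cdiffE CEd_word wsum_lin d_sum_cons /wsum !big_nil !CEproj_word /=.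
    by rewrite scaler0 !addr0 expr1z scaleN1r opprK subrr oppr0.
exists f0, r0, ctr; split=> //; split=> //.
- move=> c; pose A : {linear CEp g1 -> CEp g1} := r0 \o cyl_i F.
  pose B : {linear CEp g1 -> CEp g1} := idfun.
  rewrite -[LHS]/(A c) -[RHS]/(B c); apply: (coalg_map_unique (V := shift g1 1)).
  + exact: coalg_map_comp r0c (Lmap_delta (cyl_i F)).
  + exact: (Lmap_delta (Linf_id g1)).
  + by move=> x; rewrite -[CEproj g1 (A x)]/(CEproj g1 (r0 (cyl_i F x))) cexp_proj f0i.
- by move=> x; rewrite lin cj.
- by move=> x Px; rewrite lin -cker.
Qed.

End Factorization.

(** * Assembling the inverse *)

Section Homotopy.
Variable K : numFieldType.

Lemma homotopic_precomp (g1 g2 g3 : dgLie K) (A B : Linf g2 g3) (D : Linf g1 g2) :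
  homotopic A B -> homotopic (Linf_comp A D) (Linf_comp B D).
Proof.
move=> [H H0 [Ft [[Ftd Ftf] F0 F1]]].
pose H' : {linear CEp g1 -> g3} := H \o D.
pose Ft' t : {linear CEp g1 -> g3} := Ft t \o D.
have D0 := Lmap_degree D; have DC := Lmap_delta D.
exists H'; first by move=> k c kc; have := H0 _ _ (D0 _ _ kc); rewrite !addr0.
exists Ft'; split.
- split=> [t k c kc|c]; first by have := Ftd t _ _ (D0 _ _ kc); rewrite addr0.
  have [s [s1 s2]] := Ftf (D c); exists s; split=> t; first exact: s1.
  rewrite -[RHS]s2 -[LHS]/(- cdiff 0 H' c + cbr 1 H' (Ft' t) c).
  rewrite -[RHS]/(- cdiff 0 H (D c) + cbr 1 H (Ft t) (D c)).
  by rewrite !cdiffE Lmap_d -(cbr_pull D0 DC _ _ (t1' := H') (t2' := Ft' t)).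
- by move=> c; apply: F0.
- by move=> c; apply: F1.
Qed.

Lemma eq_homotopic (g1 g2 : dgLie K) (A A' B B' : Linf g1 g2) :
  A =1 A' -> B =1 B' -> homotopic A B -> homotopic A' B'.
Proof.
move=> AA' BB' [H H0 [Ft [Ff F0 F1]]]; exists H => //; exists Ft; split=> // c.
- by rewrite F0 -[LHS]/(CEproj g2 (A c)) AA'.
- by rewrite F1 -[LHS]/(CEproj g2 (B c)) BB'.
Qed.

Lemma Linf_qiso_invertible (g1 g2 : dgLie K) (F : Linf g1 g2) : Linf_qiso F ->
  exists G : Linf g2 g1,
    homotopic (Linf_comp G F) (Linf_id g1) /\ homotopic (Linf_comp F G) (Linf_id g2).
Proof.
move=> hF; have [f0 [r0 [ctr [f01 f0i ct]]]] := cyl_i_contractible hF.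
have [r ri] := Linf_retraction ct f01 f0i.
pose i := cyl_i F; pose p := cyl_p g1 g2; pose s := cyl_s g1 g2.
have pi c : p (i c) = F c by exact: cyl_pi.
have ps c : p (s c) = c by exact: cyl_ps.
exists (Linf_comp r s); split.
- have h : homotopic (Linf_comp (Linf_comp r s) p) r.
    apply: (homotopic_of_restriction (cyl_s_contractible g1 g2)) => c.
    by rewrite -[LHS]/(r (s (p (s c)))) ps.
  apply: eq_homotopic (homotopic_precomp i h) => c.
    by rewrite -[LHS]/(r (s (p (i c)))) pi.
  exact: ri.
- have h : homotopic (Linf_comp F r) p.
    apply: (homotopic_of_restriction ct) => c.
    by rewrite -[LHS]/(F (r (i c))) ri -pi.
  apply: eq_homotopic (homotopic_precomp s h) => c //.
  exact: ps.
Qed.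

End Homotopy.

Theorem theorem1 (R : realType) (g1 g2 : dgLie R[i]) (F : Linf g1 g2)
    (hF : Linf_qiso F) :
  exists G : Linf g2 g1,
    homotopic (Linf_comp G F) (Linf_id g1) /\
    homotopic (Linf_comp F G) (Linf_id g2).
Proof. exact: Linf_qiso_invertible hF. Qed.
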